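(* Let $d\in\mathbb{N}$, $\beta\in(0,\infty)$, let $\mu$ be a target distribution on $\mathbb{R}^d$ satisfying Assumptions (A), (B), (C) stated in the context (with constants $L_g,\rho,L'_f,\widetilde L_f$), and let $M,N\in\mathbb{N}$, $h=\tfrac1N$, $t_n=nh$. Let $(\widetilde Y^M_{t_n})_{0\le n\le N}$ be defined by $\widetilde Y^M_0=0$ and $$\widetilde Y^M_{t_{n+1}}=\widetilde Y^M_{t_n}+h\,\widetilde f^M_\beta(\widetilde Y^M_{t_n},t_n)+\sqrt{\beta}\,\big(W_{t_{n+1}}-W_{t_n}\big),\qquad n=0,\dots,N-1,$$ where $\widetilde f^M_\beta$ is the Monte Carlo estimator of the drift given in the context, based on $M$ samples $\xi_1,\dots,\xi_M$ that are generated once and reused at every step. Then there exists a constant $C$, independent of $d$, $h$ and $M$ (depending only on $L_g,\rho,\beta$), such that $$\mathcal{W}_2\big(\mathcal{L}aw(\widetilde Y^M_1),\mu\big)\le C\,d\,h+C\sqrt{\frac dM}.$$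
   Context: Notation: $\|\cdot\|$ is the Euclidean norm (operator norm for derivatives), $\gamma^d$ is the standard Gaussian distribution on $\mathbb{R}^d$, $\mathcal N(0,\beta\mathbf I_d)$ is the centred Gaussian with covariance $\beta\mathbf I_d$, $(W_t)_{t\in[0,1]}$ is a standard $d$-dimensional Brownian motion, $\mathcal{L}aw(X)$ is the distribution of $X$ (with respect to all randomness, i.e. on the product space carrying $W$ and the $\xi_j$), and $\mathcal W_2$ is the $L^2$-Wasserstein distance, $\mathcal W_2(\nu_1,\nu_2)=\inf\{(\mathbb E\|X-Y\|^2)^{1/2}:\mathcal{L}aw(X)=\nu_1,\ \mathcal{L}aw(Y)=\nu_2\}$. Assumption (A): the target distribution $\mu(\mathrm dx)\propto e^{-V(x)}\mathrm dx$ on $\mathbb{R}^d$, with $V:\mathbb{R}^d\to\mathbb{R}$, is absolutely continuous with respect to $\mathcal N(0,\beta\mathbf I_d)$. The Radon-Nikodym derivative is $$g_\beta(x)=\frac{\mathrm d\mu}{\mathrm d\mathcal N(0,\beta\mathbf I_d)}(x)=\frac{(2\pi\beta)^{d/2}}{Z}\exp\Big(-V(x)+\frac{\|x\|^2}{2\beta}\Big),\qquad Z=\int_{\mathbb{R}^d}e^{-V(x)}\mathrm dx .$$ The heat semigroup is $Q^\beta_t g_\beta(x)=\mathbb E_\xi[g_\beta(x+\sqrt{t\beta}\,\xi)]$, $\xi\sim\gamma^d$, $t\in[0,1]$, and the drift is $$f_\beta(x,t)=\beta\,\nabla\log\big(Q^\beta_{1-t}g_\beta(x)\big),\qquad x\in\mathbb{R}^d,\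 t\in[0,1].$$ Monte Carlo estimator: let $\xi_1,\dots,\xi_M$ be i.i.d. with law $\gamma^d$, independent of $W$. For $x\in\mathbb{R}^d$, $n=0,\dots,N-1$, $$\widetilde f^M_\beta(x,t_n)=\frac{\frac{\beta}{M}\sum_{j=1}^M\nabla g_\beta\big(x+\sqrt{(1-t_n)\beta}\,\xi_j\big)}{\frac1M\sum_{j=1}^M g_\beta\big(x+\sqrt{(1-t_n)\beta}\,\xi_j\big)}.$$ Assumption (B): $g_\beta$ and $\nabla g_\beta$ are $L_g$-Lipschitz continuous and $g_\beta\ge\rho>0$ on $\mathbb{R}^d$, for constants $L_g,\rho>0$. Assumption (C): for every $t\in[0,1]$, $f_\beta(\cdot,t):\mathbb{R}^d\to\mathbb{R}^d$ is twice continuously differentiable with bounded partial derivatives, and there is a constant $L'_f$, independent of $d,t$ and depending only on $L_g,\rho,\beta$, with $\|D^2f_\beta(x,t)(v_1,v_2)\|\le L'_f\|v_1\|\,\|v_2\|$ for all $x,v_1,v_2\in\mathbb{R}^d$, $t\in[0,1]$, where $D^2f_\beta(x,t)(v_1,v_2)$ is the second spatial derivative applied to $(v_1,v_2)$. Moreover, for every $x\in\mathbb{R}^d$, $f_\beta(x,\cdot):[0,1)\to\mathbb{R}^d$ is continuously differentiable and there is a constant $\widetilde L_f$, independent of $d,t$ and depending only on $L_g,\rho,\beta$, with $\|\partial_tf_\beta(x,t)\|\le\widetilde L_f\,d^{1/2}(1-t)^{-1/2}$ for all $t\in[0,1)$. *)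

(* Defs.v *)
From HB Require Import structures.
From mathcomp Require Import all_boot all_order all_algebra.
From mathcomp Require Import all_classical all_reals all_analysis.
From mathcomp Require Import measurable_realfun.

Set Implicit Arguments.
Unset Strict Implicit.
Unset Printing Implicit Defensive.

Import Order.TTheory GRing.Theory Num.Theory.
Import numFieldNormedType.Exports.

Local Open Scope classical_set_scope.
Local Open Scope ring_scope.

Definition enorm (R : realType) (d : nat) (x : 'rV[R]_d) : R :=
  Num.sqrt (\sum_(i < d) x ord0 i ^+ 2).

(* The topology of ['rV[R]_d] (induced by the sup norm) is the Euclidean one. *)
Definition borel_rV (R : realType) (d : nat) :=
  g_sigma_algebraType (@open 'rV[R]_d).

Definition cons_rV (R : realType) (d : nat)
    (p : measurableTypeR R * borel_rV R d) : borel_rV R d.+1 :=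
  row_mx (p.1%:M : 'M[R]_1) p.2.

Fixpoint lebesgue_rV (R : realType) (d : nat) : set (borel_rV R d) -> \bar R :=
  match d with
  | 0%N => @dirac _ (borel_rV R 0) (0 : 'rV[R]_0) R
  | d'.+1 =>
      pushforward (@lebesgue_measure R \x @lebesgue_rV R d')%E (@cons_rV R d')
  end.

Section lebesgue_rV_measure.
Context {R : realType}.

Lemma measurable_cons_rV d : measurable_fun setT (@cons_rV R d).
Proof.
apply: (@measurability _ _ _ (borel_rV R d.+1) setT _
  (@open 'rV[R]_d.+1) erefl) => _ [U oU <-].
rewrite setTI.
pose V (a b : rat) : set 'rV[R]_d := [set v | exists W : set 'rV[R]_d,
  [/\ open W, W v & forall x w, ratr a < x < ratr b -> W w ->
     U (@cons_rV R d (x, w))]].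
have oV a b : open (V a b).
  rewrite openE => v [W [oW Wv WU]].
  rewrite /interior; apply: (@filterS _ (nbhs v) _ W).
    by move=> w Ww; exists W.
  exact: open_nbhs_nbhs.
have -> : @cons_rV R d @^-1` U = \bigcup_(a : rat) \bigcup_(b : rat)
    ([set` `]ratr a : R, ratr b[] `*` V a b).
  apply/seteqP; split => [[x v] /= Uxv|[x v] [a _ [b _ [/= xab [W [_ Wv]]]]]]; last first.
    by apply => //; rewrite in_itv/= in xab.
  have /nbhs_ballP[e /= e0 eU] : nbhs (@cons_rV R d (x, v) : 'rV[R]_d.+1) U.
    exact: open_nbhs_nbhs.
  have [a /itvP aP] : exists a : rat, (ratr a : R) \in `]x - e, x[.
    by apply: rat_in_itvoo; rewrite ltrBlDr ltrDl.
  have [b /itvP bP] : exists b : rat, (ratr b : R) \in `]x, x + e[.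
    by apply: rat_in_itvoo; rewrite ltrDl.
  exists a => //; exists b => //; split => /=.
    by rewrite in_itv/= aP bP.
  exists (ball v e)°; split.
  - exact: open_interior.
  - exact: nbhsx_ballx.
  - move=> y w /andP[ay yb] /interior_subset vw; apply: eU.
    split => // i j.
    rewrite /cons_rV/= !mxE.
    case: splitP => k _; last by case: vw => _; apply.
    rewrite !mxE !ord1 eqxx !mulr1n /ball/= ltr_distlC.
    by rewrite (lt_trans _ ay) ?aP//= (lt_trans yb)// bP.
apply: bigcupT_measurable_rat => a; apply: bigcupT_measurable_rat => b.
apply: measurableX; first exact: measurable_itv.
exact: sub_sigma_algebra.
Qed.

Let cube d (n : nat) : set (borel_rV R d) :=
  [set v | forall j, v ord0 j \in `]- n%:R, n%:R[].

Let measurable_cube d n : measurable (@cube d n).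
Proof.
apply: sub_sigma_algebra; rewrite /= openE => v vn.
have : \forall w \near (nbhs (v : 'rV[R]_d)),
    forall j, (w : 'rV[R]_d) ord0 j \in `]- n%:R, n%:R[.
  apply: filter_forall => j.
  have := @coord_continuous R 1 d ord0 j v.
  move=> /(_ [set x | x \in `]- n%:R, n%:R[]); apply.
  apply: open_nbhs_nbhs; split; last exact: vn.
  exact: interval_open.
by [].
Qed.

Let lebesgue_rV_subproof d :
  exists2 m : {sigma_finite_measure set (borel_rV R d) -> \bar R},
    @lebesgue_rV R d = m & forall n, (m (@cube d n) < +oo)%E.
Proof.
elim: d => [|d [m mE mcube]].
  exists (@dirac _ (borel_rV R 0) (0 : 'rV[R]_0) R) => // n.
  by rewrite /= diracE ltry.
have [m1 m1E] : exists m1 : {measure set (borel_rV R d.+1) -> \bar R},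
    m1 = pushforward (@lebesgue_measure R \x m)%E (@cons_rV R d)
      :> (set _ -> \bar R).
  by exists (measure_function_pushforward__canonical__measure_function_Measure
    (@lebesgue_measure R \x m)%E (measurable_cons_rV (d := d))).
have m1cube n : (m1 (@cube d.+1 n) < +oo)%E.
  rewrite m1E /pushforward.
  have -> : @cons_rV R d @^-1` (@cube d.+1 n) =
      [set` `]- n%:R : R, n%:R[] `*` @cube d n.
    apply/seteqP; split => -[x v] /= => [xv|[xn vn] j].
      split=> [|j].
        have := xv (lshift d (ord0 : 'I_1) : 'I_(1 + d)).
        by rewrite /cons_rV (@row_mxEl _ 1 1 d) mxE.
      by have := xv (rshift 1 j : 'I_(1 + d)); rewrite /cons_rV (@row_mxEr _ 1 1 d).
    by rewrite /cons_rV mxE; case: splitP => k _; [rewrite mxE !ord1|exact: vn].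
  rewrite product_measure1E//=; last exact: measurable_cube.
  apply: lte_mul_pinfty; [exact: measure_ge0| |exact: mcube].
  by rewrite lebesgue_measure_itv/=; case: ifP.
have m1sf : sigma_finite [set: borel_rV R d.+1] m1.
  exists (@cube d.+1) => [|n]; last by split.
  apply/seteqP; split => // v _.
  exists (Num.truncn (\sum_j `|v ord0 j|)).+1 => // j.
  have vj : `|v ord0 j| <= \sum_i `|v ord0 i| 
    by rewrite (bigD1 j)//= lerDl sumr_ge0.
  rewrite in_itv/= -ltr_norml (le_lt_trans vj)//.
  exact: truncnS_gt.
pose H1 := isSFinite.Build _ _ _ _ (sfinite_measure_sigma_finite m1sf).
pose H2 := isSigmaFinite.Build _ _ _ _ m1sf.
pose m2 : {sigma_finite_measure set (borel_rV R d.+1) -> \bar R} :=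
  HB.pack_for (SigmaFiniteMeasure.type (borel_rV R d.+1) R) (Measure.sort m1)
    H1 H2.
exists m2 => //=.
by rewrite mE -m1E.
Qed.

Let lebesgue_rV0 d : @lebesgue_rV R d set0 = 0%E.
Proof. by have [m -> _] := lebesgue_rV_subproof d; exact: measure0. Qed.

Let lebesgue_rV_ge0 d A : (0 <= @lebesgue_rV R d A)%E.
Proof. by have [m -> _] := lebesgue_rV_subproof d; exact: measure_ge0. Qed.

Let lebesgue_rV_sigma_additive d : semi_sigma_additive (@lebesgue_rV R d).
Proof.
have [m -> _] := lebesgue_rV_subproof d; exact: measure_semi_sigma_additive.
Qed.

HB.instance Definition _ d := isMeasure.Build _ (borel_rV R d) R
  (@lebesgue_rV R d) (@lebesgue_rV0 d) (@lebesgue_rV_ge0 d)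
  (@lebesgue_rV_sigma_additive d).

Let lebesgue_rV_sigma_finite d :
  sigma_finite [set: borel_rV R d] (@lebesgue_rV R d).
Proof. by have [m -> _] := lebesgue_rV_subproof d; exact: sigma_finiteT. Qed.

HB.instance Definition _ d := Measure_isSigmaFinite.Build _ (borel_rV R d) R
  (@lebesgue_rV R d) (@lebesgue_rV_sigma_finite d).

End lebesgue_rV_measure.

Definition gauss_pdf (R : realType) (d : nat) (b : R) (x : 'rV[R]_d) : R :=
  (2 * pi * b) `^ (- (d%:R / 2)) * expR (- (enorm x ^+ 2 / (2 * b))).

(* The centred Gaussian with covariance [b I_d]; only meaningful for [0 < b]. *)
Definition gauss_rV (R : realType) (d : nat) (b : R) :
    set (borel_rV R d) -> \bar R :=
  fun A => (\int[@lebesgue_rV R d]_(x in A) (gauss_pdf b x)%:E)%E.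

Section gauss_rV_measure.
Context {R : realType} (d : nat) (b : R).

Lemma continuous_gauss_pdf : continuous (@gauss_pdf R d b).
Proof.
have cn : continuous (fun x : 'rV[R]_d => enorm x ^+ 2).
  rewrite (_ : (fun _ => _) = fun x : 'rV[R]_d => \sum_(i < d) x ord0 i ^+ 2).
    apply: continuous_big => [|i _ x]; first exact: add_continuous.
    by apply: (@cvgM _ _ (nbhs x)); exact: coord_continuous.
  by apply/funext => x; rewrite sqr_sqrtr// sumr_ge0// => i _; rewrite sqr_ge0.
move=> x; apply: (@cvgM _ _ (nbhs x)); first exact: cvg_cst.
apply: continuous_cvg; first exact: continuous_expR.
by apply: (@cvgN _ _ _ (nbhs x)); apply: (@cvgM _ _ (nbhs x));
  [exact: cn|exact: cvg_cst].
Qed.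

Lemma continuous_measurable_rV (f : 'rV[R]_d -> R) :
  continuous f -> measurable_fun [set: borel_rV R d] f.
Proof.
move=> /continuousP cf.
apply: (measurability _ (RGenOInfty.measurableE R)) => _ [_ [a ->] <-].
rewrite setTI; apply: sub_sigma_algebra; apply: cf; exact: interval_open.
Qed.

Let gauss_rV0 : @gauss_rV R d b set0 = 0%E.
Proof. exact: integral_set0. Qed.

Let gauss_rV_ge0 A : (0 <= @gauss_rV R d b A)%E.
Proof.
by apply: integral_ge0 => x _; rewrite lee_fin mulr_ge0 ?powR_ge0 ?expR_ge0.
Qed.

Let gauss_rV_sigma_additive : semi_sigma_additive (@gauss_rV R d b).
Proof.
move=> F mF tF mUF.
have mpdf : measurable_fun [set: borel_rV R d] (EFin \o @gauss_pdf R d b).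
  apply/measurable_EFinP; apply: continuous_measurable_rV.
  exact: continuous_gauss_pdf.
have pdf0 (x : 'rV[R]_d) : (0 <= (gauss_pdf b x)%:E)%E.
  by rewrite lee_fin mulr_ge0 ?powR_ge0 ?expR_ge0.
rewrite {2}/gauss_rV ge0_integral_bigcup//; last exact: measurable_funS mpdf.
by apply: is_cvg_ereal_nneg_natsum_cond => n _ _; exact: integral_ge0.
Qed.

HB.instance Definition _ := isMeasure.Build _ (borel_rV R d) R
  (@gauss_rV R d b) gauss_rV0 gauss_rV_ge0 gauss_rV_sigma_additive.

End gauss_rV_measure.

Definition grad (R : realType) (d : nat) (f : 'rV[R]_d -> R) (x : 'rV[R]_d) :
    'rV[R]_d :=
  \row_(i < d) 'D_(delta_mx ord0 i) f x.

(* In finite dimension, [x |-> 'd F x] is continuous (for the operator norm)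
   iff every directional derivative [x |-> 'D_v F x] is. *)
Definition C1_map (R : realType) (d : nat) (F : 'rV[R]_d -> 'rV[R]_d) : Prop :=
  (forall x, differentiable F x) /\ forall v, continuous ('D_v F).

Definition C2_map (R : realType) (d : nat) (F : 'rV[R]_d -> 'rV[R]_d) : Prop :=
  C1_map F /\ forall v, C1_map ('D_v F).

Definition D2 (R : realType) (d : nat) (F : 'rV[R]_d -> 'rV[R]_d)
    (x v1 v2 : 'rV[R]_d) : 'rV[R]_d :=
  'D_v1 ('D_v2 F) x.

Definition bounded_map (R : realType) (d : nat) (F : 'rV[R]_d -> 'rV[R]_d) :=
  exists K : R, forall x, enorm (F x) <= K.

Definition bounded_partials (R : realType) (d : nat)
    (F : 'rV[R]_d -> 'rV[R]_d) : Prop :=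
  forall i j : 'I_d,
    bounded_map ('D_(delta_mx ord0 i) F) /\
    bounded_map ('D_(delta_mx ord0 j) ('D_(delta_mx ord0 i) F)).

(* Derivative relative to the half-open interval [[0, 1[], hence one-sided
   at [0]. *)
Definition is_time_derive (R : realType) (d : nat) (f : R -> 'rV[R]_d) (t : R)
    (l : 'rV[R]_d) : Prop :=
  (s - t)^-1 *: (f s - f t) @[s --> within `[0, 1[%classic t^'] --> l.

Section follmer_drift.
Context {R : realType} {d : nat} (beta : R) (V : 'rV[R]_d -> R).

Definition partition_function : R :=
  (\int[@lebesgue_rV R d]_x expR (- V x))%R.

(* Radon-Nikodym derivative of the target with respect to [gauss_rV d beta]. *)
Definition g_beta (x : 'rV[R]_d) : R :=
  (2 * pi * beta) `^ (d%:R / 2) / partition_function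
  * expR (- V x + enorm x ^+ 2 / (2 * beta)).

Definition heat (t : R) (g : 'rV[R]_d -> R) (x : 'rV[R]_d) : R :=
  (\int[@gauss_rV R d 1]_z g (x + Num.sqrt (t * beta) *: (z : 'rV[R]_d)))%R.

Definition f_beta (x : 'rV[R]_d) (t : R) : 'rV[R]_d :=
  beta *: grad (fun y => ln (heat (1 - t) g_beta y)) x.

Definition mc_drift (M : nat) (z : 'I_M -> 'rV[R]_d) (x : 'rV[R]_d) (t : R) :
    'rV[R]_d :=
  (M%:R^-1 * \sum_(j < M) g_beta (x + Num.sqrt ((1 - t) * beta) *: z j))^-1 *:
  ((beta / M%:R) *:
    \sum_(j < M) grad g_beta (x + Num.sqrt ((1 - t) * beta) *: z j)).

(* [w] is a path of the Brownian motion, [z] a realisation of the samples;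
   the n-th iterate is the value at time [n / N]. *)
Fixpoint mc_euler (N M : nat) (w : R -> 'rV[R]_d) (z : 'I_M -> 'rV[R]_d)
    (n : nat) : 'rV[R]_d :=
  match n with
  | 0%N => 0
  | k.+1 =>
      let y := mc_euler N w z k in
      y + N%:R^-1 *: mc_drift z y (k%:R / N%:R)
        + Num.sqrt beta *: (w (k.+1%:R / N%:R) - w (k%:R / N%:R))
  end.

Definition gibbs_target (mu : set (borel_rV R d) -> \bar R) : Prop :=
  [/\ measurable_fun [set: borel_rV R d] V,
      (@lebesgue_rV R d).-integrable [set: borel_rV R d]
        (fun x => (expR (- V x))%:E) &
      forall A : set (borel_rV R d), measurable A ->
        mu A = ((partition_function^-1)%:E *
                \int[@lebesgue_rV R d]_(x in A) (expR (- V x))%:E)%E].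

Definition assumptionA (mu : set (borel_rV R d) -> \bar R) : Prop :=
  gibbs_target mu /\ mu `<< @gauss_rV R d beta.

Definition assumptionB (Lg rho : R) : Prop :=
  [/\ forall x, differentiable g_beta x,
      forall x y, `|g_beta x - g_beta y| <= Lg * enorm (x - y),
      forall x y, enorm (grad g_beta x - grad g_beta y) <= Lg * enorm (x - y) &
      forall x, rho <= g_beta x].

Definition assumptionC (Lf' Lft : R) : Prop :=
  [/\ forall t : R, 0 <= t <= 1 ->
        C2_map (f_beta^~ t) /\ bounded_partials (f_beta^~ t),
      forall (t : R) x v1 v2, 0 <= t <= 1 ->
        enorm (D2 (f_beta^~ t) x v1 v2) <= Lf' * enorm v1 * enorm v2 &
      forall x, exists dtf : R -> 'rV[R]_d,
        [/\ forall t : R, 0 <= t < 1 -> is_time_derive (f_beta x) t (dtf t),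
            {within `[0, 1[%classic, continuous dtf} &
            forall t : R, 0 <= t < 1 ->
              enorm (dtf t) <= Lft * Num.sqrt d%:R / Num.sqrt (1 - t)]].

End follmer_drift.

Section random_vectors.
Context {R : realType} {dO : measure_display} {Omega : measurableType dO}
  (P : probability Omega R) {d : nat}.

Definition has_law (X : Omega -> borel_rV R d)
    (nu : set (borel_rV R d) -> \bar R) : Prop :=
  forall A : set (borel_rV R d), measurable A -> P (X @^-1` A) = nu A.

Definition mutually_independent (I : finType) (X : I -> Omega -> borel_rV R d) :
    Prop :=
  forall (J : {set I}) (A : I -> set (borel_rV R d)),
    (forall i, measurable (A i)) ->
    P (\bigcap_(i in [set` J]) (X i @^-1` A i)) =
    (\prod_(i in J) P (X i @^-1` A i))%E.

Definition sigma_family (I : Type) (D : set I)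
    (X : I -> Omega -> borel_rV R d) : set (set Omega) :=
  <<s \bigcup_(i in D) preimage_set_system setT (X i) measurable >>.

Definition independent_sigma (F G : set (set Omega)) : Prop :=
  forall A B, F A -> G B -> P (A `&` B) = (P A * P B)%E.

Definition increment (W : R -> Omega -> borel_rV R d) (s t : R) (w : Omega) :
    borel_rV R d :=
  (W t w : 'rV[R]_d) - (W s w : 'rV[R]_d).

(* Only the times in [[0, 1]] are constrained. *)
Definition brownian_motion (W : R -> Omega -> borel_rV R d) : Prop :=
  [/\ (forall t : R, 0 <= t <= 1 -> measurable_fun setT (W t)),
      {ae P, forall w, W 0 w = (0 : 'rV[R]_d)},
      (forall s t : R, 0 <= s -> s < t -> t <= 1 ->
        has_law (increment W s t) (@gauss_rV R d (t - s))),
      (forall (n : nat) (t : nat -> R), 0 <= t 0%N -> t n <= 1 ->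
        (forall i, (i < n)%N -> t i <= t i.+1) ->
        mutually_independent (fun i : 'I_n => increment W (t i) (t i.+1))) &
      {ae P, forall w,
        {within `[0, 1]%classic, continuous (fun t : R => W t w : 'rV[R]_d)}}].

Definition iid_standard_gaussian (M : nat)
    (xi : 'I_M -> Omega -> borel_rV R d) : Prop :=
  [/\ forall j, measurable_fun setT (xi j),
      forall j, has_law (xi j) (@gauss_rV R d 1) &
      mutually_independent xi].

End random_vectors.

Definition wasserstein2 (R : realType) (d : nat)
    (nu1 nu2 : set (borel_rV R d) -> \bar R) : \bar R :=
  ereal_inf [set c : \bar R |
    exists (dT : measure_display) (T : measurableType dT) (Q : probability T R)
           (X Y : {mfun T >-> borel_rV R d}),
    [/\ has_law Q X nu1, has_law Q Y nu2 &
        c = ((\int[Q]_w (enorm ((X w : 'rV[R]_d) - (Y w : 'rV[R]_d)) ^+ 2)%:E)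
             `^ (2^-1)%R)%E]].

(* Main.v *)
(* Everything happens on the probability space carrying [W] and the samples, so
   that no theory of stochastic differential equations is needed.  The solution
   of dX = f(X, t) dt + sqrt(beta) dW is replaced by the limit Y of the Euler
   schemes with the exact drift f and step sizes h / 2^k driven by the same W:
   - since the noise is additive and f has a bounded second derivative, halving
     the step size changes the endpoint by O(d h) in L^2, so Y exists and is
     within O(d h) of the scheme of step h;
   - f is beta times the gradient of log E g(x + sqrt((1 - t) beta) xi), so for
     a test function psi the quotient of the Gaussian averages of psi
     and g is transported by the diffusion (Doob's h-transform).  The Euler
     schemes respect it up to O(h^(1/2)), so E (psi / g)(Y) is the mean of psi
     under N(0, beta I), that is, Y has law mu;
   - the Monte Carlo drift is Lipschitz and, at a point independent of the
     samples, has variance O(d / M); a discrete Gronwall argument compares the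
     scheme using it with the exact scheme.
   The pair (Monte Carlo scheme, Y) is a coupling that bounds the distance. *)

Require Import Defs.
From HB Require Import structures.
From mathcomp Require Import all_boot all_order all_algebra.
From mathcomp Require Import all_classical all_reals all_analysis.
From mathcomp Require Import measurable_realfun ring lra.

Set Implicit Arguments.
Unset Strict Implicit.
Unset Printing Implicit Defensive.

Import Order.TTheory GRing.Theory Num.Theory.
Import numFieldNormedType.Exports.

Local Open Scope classical_set_scope.
Local Open Scope ring_scope.

(** * Euclidean norm *)

Section euclidean.
Context {R : realType} {d : nat}.
Implicit Types (x y z v w : 'rV[R]_d) (a b c : R).

(** The strong and the weak estimates obey different rules. The strong one needs constants free of
    [d]; its factor [d] comes from the second-order term of the drift, since a standard Gaussian [z]
    has mean square norm [d]. The weak one only serves to identify the law of the limit, so its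
    constant may depend on [d] and on the test function in any way. Since [g] may be unbounded, the
    law is identified through quotients [psi / g], bounded by [1 / rho] when [psi] takes values in
    [[0, 1]]. The Brownian motion comes without a filtration. Adaptedness is therefore measurability
    with respect to the increments of a grid, and conditional expectations become partial integrals
    over an independent variable. Halving the step makes the coarse scheme adapted to the fine grid
    as well. The additive noise cancels in every difference of two schemes, and the drifts are
    bounded; so these differences are bounded variables and raise no question of integrability. *)

Definition dot x y : R := \sum_(i < d) x ord0 i * y ord0 i.

Lemma dotC x y : dot x y = dot y x.
Proof. by apply: eq_bigr => i _; rewrite mulrC. Qed.

Lemma dotDr x y z : dot x (y + z) = dot x y + dot x z.
Proof. by rewrite /dot -big_split; apply: eq_bigr => i _; rewrite mxE mulrDr. Qed.

Lemma dotZr a x y : dot x (a *: y) = a * dot x y.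
Proof. by rewrite /dot mulr_sumr; apply: eq_bigr => i _; rewrite mxE mulrCA. Qed.

Lemma dotDl x y z : dot (x + y) z = dot x z + dot y z.
Proof. by rewrite dotC dotDr !(dotC z). Qed.

Lemma dotZl a x y : dot (a *: x) y = a * dot x y.
Proof. by rewrite dotC dotZr dotC. Qed.

Lemma dotNr x y : dot x (- y) = - dot x y.
Proof. by rewrite -scaleN1r dotZr mulN1r. Qed.

Lemma dotNl x y : dot (- x) y = - dot x y.
Proof. by rewrite dotC dotNr dotC. Qed.

Lemma dotBr x y z : dot x (y - z) = dot x y - dot x z.
Proof. by rewrite dotDr dotNr. Qed.

Lemma dotBl x y z : dot (x - y) z = dot x z - dot y z.
Proof. by rewrite dotDl dotNl. Qed.

Lemma dot0r x : dot x 0 = 0.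
Proof. by rewrite -(scale0r 0) dotZr mul0r. Qed.

Lemma dot0l x : dot 0 x = 0.
Proof. by rewrite dotC dot0r. Qed.

Lemma dot_sumr (I : Type) (r : seq I) (F : I -> 'rV[R]_d) x :
  dot x (\sum_(i <- r) F i) = \sum_(i <- r) dot x (F i).
Proof.
by elim/big_rec2: _ => [|i u v _ <-]; rewrite ?dot0r// dotDr.
Qed.

Lemma dot_delta x i : dot (delta_mx ord0 i) x = x ord0 i.
Proof.
rewrite /dot (bigD1 i)//= mxE !eqxx mul1r big1 ?addr0// => j ji.
by rewrite mxE eqxx (negbTE ji) mul0r.
Qed.

Lemma enorm_ge0 x : 0 <= enorm x.
Proof. exact: sqrtr_ge0. Qed.

Lemma enorm_sqr x : enorm x ^+ 2 = dot x x.
Proof.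
rewrite /enorm sqr_sqrtr; last by apply: sumr_ge0 => i _; rewrite sqr_ge0.
by apply: eq_bigr => i _; rewrite expr2.
Qed.

Lemma enorm0 : enorm (0 : 'rV[R]_d) = 0.
Proof. by apply/eqP; rewrite -sqrf_eq0 enorm_sqr dot0r. Qed.

Lemma ler_enorm x c : 0 <= c -> dot x x <= c ^+ 2 -> enorm x <= c.
Proof.
by move=> c0; rewrite -enorm_sqr ler_pXn2r// nnegrE enorm_ge0.
Qed.

Lemma enorm_eq0 x : enorm x = 0 -> x = 0.
Proof.
move=> /(congr1 (fun t => t ^+ 2)); rewrite enorm_sqr expr0n/= => /eqP.
rewrite /dot psumr_eq0; last by move=> i _; rewrite -expr2 sqr_ge0.
move=> /allP x0; apply/rowP => i; rewrite mxE; apply/eqP.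
by have := x0 i; rewrite mem_index_enum -expr2 sqrf_eq0; apply.
Qed.

Lemma dot_le x y : dot x y <= enorm x * enorm y.
Proof.
have [x0|x0] := eqVneq (enorm x) 0.
  by rewrite x0 (enorm_eq0 x0) dot0l mul0r.
have [y0|y0] := eqVneq (enorm y) 0.
  by rewrite y0 (enorm_eq0 y0) dot0r mulr0.
have xy : 0 < enorm x * enorm y by rewrite mulr_gt0// lt_neqAle enorm_ge0 eq_sym ?x0 ?y0.
have : 0 <= enorm (enorm y *: x - enorm x *: y) ^+ 2 by rewrite sqr_ge0.
rewrite enorm_sqr dotBr !dotBl !dotZl !dotZr -!enorm_sqr (dotC y x).
move=> H; rewrite -subr_ge0 -(pmulr_rge0 _ xy).
by move: H; set a := enorm x; set b := enorm y; set c := dot x y; lra.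
Qed.

Lemma normr_dot_le x y : `|dot x y| <= enorm x * enorm y.
Proof.
rewrite ler_norml dot_le andbT lerNl -dotNl (le_trans (dot_le _ _))//.
by rewrite -(scaleN1r x) /enorm; under eq_bigr do rewrite mxE mulN1r sqrrN.
Qed.

Lemma enormD x y : enorm (x + y) <= enorm x + enorm y.
Proof.
apply: ler_enorm; first by rewrite addr_ge0 ?enorm_ge0.
rewrite dotDl !dotDr sqrrD -!enorm_sqr (dotC y x).
by have := dot_le x y; lra.
Qed.

Lemma enormZ a x : enorm (a *: x) = `|a| * enorm x.
Proof.
apply/eqP; rewrite -(@eqrXn2 _ 2)// ?mulr_ge0 ?enorm_ge0//.
by rewrite exprMn !enorm_sqr dotZl dotZr mulrA -expr2 real_normK ?num_real.
Qed.

Lemma enormN x : enorm (- x) = enorm x.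
Proof. by rewrite -scaleN1r enormZ normrN1 mul1r. Qed.

Lemma enormB x y : enorm (x - y) <= enorm x + enorm y.
Proof. by rewrite (le_trans (enormD _ _))// enormN. Qed.

Lemma enormC x y : enorm (x - y) = enorm (y - x).
Proof. by rewrite -enormN opprB. Qed.

Lemma enorm_sum (I : Type) (r : seq I) (F : I -> 'rV[R]_d) :
  enorm (\sum_(i <- r) F i) <= \sum_(i <- r) enorm (F i).
Proof.
elim/big_rec2: _ => [|i u v _ h]; first by rewrite enorm0.
by rewrite (le_trans (enormD _ _))// lerD2l.
Qed.

(** Duality: testing against every [w] reduces bounds on vector-valued averages and gradients to
    scalar ones. The choice [w := x] suffices. *)
Lemma enorm_le_dot x c : 0 <= c -> (forall w, dot w x <= c * enorm w) ->
  enorm x <= c.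
Proof.
move=> c0 /(_ x); rewrite -enorm_sqr expr2.
have [->//|x0] := eqVneq (enorm x) 0.
by rewrite ler_pM2r// lt_neqAle eq_sym x0 enorm_ge0.
Qed.

Lemma normr_coord_le x i : `|x ord0 i| <= enorm x.
Proof.
rewrite -dot_delta (le_trans (normr_dot_le _ _))//.
suff -> : enorm (delta_mx ord0 i : 'rV[R]_d) = 1 by rewrite mul1r.
by apply/eqP; rewrite -(@eqrXn2 _ 2) ?enorm_ge0// enorm_sqr dot_delta mxE !eqxx expr1n.
Qed.

Lemma enorm_le_norm x : enorm x <= Num.sqrt d%:R * `|x|.
Proof.
apply: ler_enorm; first by rewrite mulr_ge0 ?sqrtr_ge0.
rewrite exprMn sqr_sqrtr ?ler0n// mulr_natl.
rewrite -[X in _ *+ X]card_ord -sumr_const; apply: ler_sum => i _.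
rewrite -expr2 -[leLHS]ger0_norm ?sqr_ge0// normrX ler_pXn2r ?nnegrE//.
by rewrite [in leRHS]/Num.norm/= mx_normrE (le_bigmax _ _ (ord0, i)).
Qed.

Lemma norm_le_enorm x : `|x| <= enorm x.
Proof.
rewrite [leLHS]mx_normrE; apply: bigmax_le; first exact: enorm_ge0.
by move=> [i j] _; rewrite (ord1 i)/= normr_coord_le.
Qed.

Lemma lipschitz_continuous (f : 'rV[R]_d -> R) K :
  (forall x y, `|f x - f y| <= K * enorm (x - y)) -> continuous f.
Proof.
move=> fK x; apply/(@cvgrPdist_le _ _ _ (nbhs x)) => e e0.
have c0 : 0 < e / (`|K| * Num.sqrt d%:R + 1).
  by rewrite divr_gt0// ltr_wpDl// mulr_ge0// sqrtr_ge0.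
apply: filterS (nbhsx_ballx x _ c0) => y.
rewrite -ball_normE/= => /ltW.
rewrite ler_pdivlMr ?ltr_wpDl// ?mulr_ge0// ?sqrtr_ge0// => xy.
apply: (le_trans (fK _ _)).
apply: (@le_trans _ _ (`|K| * (Num.sqrt d%:R * `|x - y|))).
  by rewrite (le_trans (ler_norm _))// normrM ler_wpM2l// ger0_norm ?enorm_ge0// enorm_le_norm.
by have := normr_ge0 (x - y); lra.
Qed.

Lemma lipschitz_continuous_vec (f : 'rV[R]_d -> 'rV[R]_d) K :
  (forall x y, enorm (f x - f y) <= K * enorm (x - y)) -> continuous f.
Proof.
move=> fK x; apply/(@cvgrPdist_le _ _ _ (nbhs x)) => e e0.
have := @lipschitz_continuous (fun y => enorm (f x - f y)) K.
have h y z : `|enorm (f x - f y) - enorm (f x - f z)| <= K * enorm (y - z).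
  have : enorm (f y - f z) <= K * enorm (y - z) := fK y z.
  have := enormD (f x - f y) (f y - f z); have := enormD (f x - f z) (f z - f y).
  by rewrite !subrKA (enormC (f z)) ler_norml; lra.
move=> /(_ h x) /(@cvgrPdist_le _ _ _ (nbhs x)) /(_ _ e0); rewrite subrr enorm0; apply: filterS => y.
by rewrite sub0r normrN ger0_norm ?enorm_ge0//; apply: le_trans; exact: norm_le_enorm.
Qed.

End euclidean.

(** * Borel sets and random vectors *)

Section boxes.
Context {R : realType} {d : nat}.

Definition box (a b : 'I_d -> R) : set (borel_rV R d) :=
  [set x | forall i, x ord0 i \in `]a i, b i[].

Lemma open_rat_boxes (U : set 'rV[R]_d) : open U ->
  U = \bigcup_(q in [set q : {ffun 'I_d -> rat * rat} |
         box (fun i => ratr (q i).1) (fun i => ratr (q i).2) `<=` U])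
      box (fun i => ratr (q i).1) (fun i => ratr (q i).2).
Proof.
move=> oU; apply/seteqP; split => [x Ux|x [q /= qU qx]]; last exact: qU.
have /nbhs_ballP[e /= e0 eU] : nbhs x U by exact: open_nbhs_nbhs.
have /choice[q qP] : forall i : 'I_d, exists q : rat * rat,
    [/\ (ratr q.1 : R) \in `]x ord0 i - e, x ord0 i[ &
        (ratr q.2 : R) \in `]x ord0 i, x ord0 i + e[].
  move=> i.
  have [a aP] : exists a : rat, (ratr a : R) \in `]x ord0 i - e, x ord0 i[.
    by apply: rat_in_itvoo; rewrite ltrBlDr ltrDl.
  have [b bP] : exists b : rat, (ratr b : R) \in `]x ord0 i, x ord0 i + e[.
    by apply: rat_in_itvoo; rewrite ltrDl.
  by exists (a, b).
exists [ffun i => q i] => /=.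
  move=> y /= yq; apply: eU; split => // i j; rewrite (ord1 i).
  have [] := qP j; have := yq j; rewrite !ffunE !in_itv/= /ball/=.
  move=> /andP[y1 y2] /andP[h1 h2] /andP[h3 h4].
  by rewrite ltr_distlC (lt_trans h1 y1) (lt_trans y2 h4).
move=> i; have [] := qP i; rewrite !ffunE !in_itv/=.
by move=> /andP[_ ->] /andP[-> _].
Qed.

Lemma open_box a b : open (box a b : set 'rV[R]_d).
Proof.
rewrite openE => v vn.
have : \forall w \near (nbhs (v : 'rV[R]_d)),
    forall j, (w : 'rV[R]_d) ord0 j \in `]a j, b j[.
  apply: filter_forall => j.
  have := @coord_continuous R 1 d ord0 j v.
  move=> /(_ [set x | x \in `]a j, b j[]); apply.
  apply: open_nbhs_nbhs; split; last exact: vn.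
  exact: interval_open.
by [].
Qed.

(** Every open set is a union of boxes with rational corners, which are countably many. This serves
    twice: measurability can be checked coordinate by coordinate, and boxes form a pi-system, so
    they determine a finite measure. *)
Lemma borel_rV_boxes :
  @measurable _ (borel_rV R d) =
  <<s [set A | exists a b, A = box a b] >>.
Proof.
apply/seteqP; split => A.
  apply: smallest_sub => [|U /= oU]; first exact: smallest_sigma_algebra.
  rewrite (open_rat_boxes oU).
  rewrite bigcup_mkcond.
  apply: (@countable_bigcupT_measurable _ (g_sigma_algebraType
    [set A : set (borel_rV R d) | exists a b, A = box a b])) => // q.
  case: ifP => _; last exact: measurable0.
  by apply: sub_sigma_algebra => /=; do 2 eexists.
apply: smallest_sub => [|U /= [a [b ->]]].
  exact: smallest_sigma_algebra.
by apply: sub_sigma_algebra; exact: open_box.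
Qed.

Lemma measurable_box a b : measurable (box a b).
Proof. by apply: sub_sigma_algebra; exact: open_box. Qed.

Lemma continuous_measurable_vec (f : 'rV[R]_d -> 'rV[R]_d) :
  continuous f -> measurable_fun [set: borel_rV R d] (f : borel_rV R d -> borel_rV R d).
Proof.
move=> /continuousP cf.
apply: (measurability (rT := borel_rV R d) (@open 'rV[R]_d)) => // _ [U oU <-].
by rewrite setTI; apply: sub_sigma_algebra; exact: cf.
Qed.

Lemma measurable_coord i :
  measurable_fun [set: borel_rV R d] (fun x : borel_rV R d => x ord0 i).
Proof. by apply: continuous_measurable_rV; exact: coord_continuous. Qed.

Lemma measurable_fun_rV dT (T : measurableType dT) (X : T -> borel_rV R d) :
  (forall i, measurable_fun setT (fun t => X t ord0 i)) -> measurable_fun setT X.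
Proof.
move=> mX; apply: (measurability _ borel_rV_boxes) => _ [_ [a [b ->]] <-].
rewrite setTI (_ : X @^-1` _ = \bigcap_(i in [set: 'I_d])
    (fun t => X t ord0 i) @^-1` [set` `]a i, b i[]); last first.
  by apply/seteqP; split => t /= h i; [move=> _; exact: h|exact: h].
apply: fin_bigcap_measurable => // i _.
by rewrite -[X in measurable X]setTI; apply: mX => //; exact: measurable_itv.
Qed.

Section combinators.
Context {dT : measure_display} {T : measurableType dT}.
Implicit Types X Y : T -> borel_rV R d.

Lemma measurable_fun_coord X i :
  measurable_fun setT X -> measurable_fun setT (fun t => X t ord0 i).
Proof. by move=> mX; exact: (measurableT_comp (measurable_coord i) mX). Qed.

Lemma measurable_addV X Y : measurable_fun setT X -> measurable_fun setT Y ->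
  measurable_fun setT (fun t => (X t : 'rV[R]_d) + Y t : borel_rV R d).
Proof.
move=> mX mY; apply: measurable_fun_rV => i; under eq_fun do rewrite mxE.
by apply: measurable_funD; exact: measurable_fun_coord.
Qed.

Lemma measurable_scaleV (a : T -> R) X : measurable_fun setT a ->
  measurable_fun setT X ->
  measurable_fun setT (fun t => a t *: (X t : 'rV[R]_d) : borel_rV R d).
Proof.
move=> ma mX; apply: measurable_fun_rV => i; under eq_fun do rewrite mxE.
by apply: measurable_funM => //; exact: measurable_fun_coord.
Qed.

Lemma measurable_subV X Y : measurable_fun setT X -> measurable_fun setT Y ->
  measurable_fun setT (fun t => (X t : 'rV[R]_d) - Y t : borel_rV R d).
Proof.
move=> mX mY; apply: measurable_fun_rV => i; under eq_fun do rewrite !mxE.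
by apply: measurable_funB; exact: measurable_fun_coord.
Qed.

Lemma measurable_sumV (I : Type) (r : seq I) (F : I -> T -> borel_rV R d) :
  (forall i, measurable_fun setT (F i)) ->
  measurable_fun setT (fun t => \sum_(i <- r) (F i t : 'rV[R]_d) : borel_rV R d).
Proof.
move=> mF; apply: measurable_fun_rV => j; under eq_fun do rewrite summxE.
by apply: measurable_sum => i; exact: measurable_fun_coord.
Qed.

Lemma measurable_dot X Y : measurable_fun setT X -> measurable_fun setT Y ->
  measurable_fun setT (fun t => dot (X t) (Y t)).
Proof.
move=> mX mY; apply: measurable_sum => i.
by apply: measurable_funM; exact: measurable_fun_coord.
Qed.

Lemma continuous_enorm : continuous (@enorm R d).
Proof.
apply: (@lipschitz_continuous _ _ _ 1) => x y; rewrite mul1r.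
have := enormD y (x - y); have := enormD x (y - x); rewrite !subrKC (enormC y x).
by rewrite ler_norml; lra.
Qed.

Lemma measurable_enorm X : measurable_fun setT X ->
  measurable_fun setT (fun t => enorm (X t)).
Proof.
move=> mX.
exact: (measurableT_comp (continuous_measurable_rV continuous_enorm) mX).
Qed.

End combinators.
End boxes.

(** * Gaussian integrals *)

Section density.
Local Open Scope ereal_scope.
Context {dT : measure_display} {T : measurableType dT} {R : realType}.
Variables (mu nu : {measure set T -> \bar R}) (f : T -> R).
Hypothesis mf : measurable_fun setT f.
Hypothesis f0 : forall x, (0 <= f x)%R.
Hypothesis nuE : forall A, measurable A -> nu A = \int[mu]_(x in A) (f x)%:E.

Let integral_density_indic A : measurable A ->
  \int[nu]_x (\1_A x)%:E = \int[mu]_x ((\1_A x)%:E * (f x)%:E).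
Proof.
move=> mA; rewrite integral_indic// setIT nuE// integral_mkcond epatch_indic.
by apply: eq_integral => x _; rewrite muleC.
Qed.

Import HBNNSimple.

Let integral_density_nnsfun (g : {nnsfun T >-> R}) :
  \int[nu]_x (g x)%:E = \int[mu]_x ((g x)%:E * (f x)%:E).
Proof.
under [LHS]eq_integral do rewrite fimfunE -fsumEFin//.
rewrite [LHS]ge0_integral_fsum//; last 2 first.
  - by move=> r; exact/measurable_EFinP/measurableT_comp.
  - by move=> n x _; rewrite EFinM nnfun_muleindic_ge0.
under [RHS]eq_integral.
  move=> x xD; rewrite fimfunE -fsumEFin// ge0_mule_fsuml; last first.
    by move=> r; rewrite EFinM nnfun_muleindic_ge0.
  over.
rewrite [RHS]ge0_integral_fsum//; last 2 first.
  - move=> r; apply/measurable_EFinP; apply: measurable_funM => //.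
    by apply/measurableT_comp => //.
  - by move=> n x _; rewrite EFinM mule_ge0//; last exact: f0; rewrite nnfun_muleindic_ge0.
apply: eq_fsbigr => r _.
have [r0|r0] := ltP r 0%R.
  have -> : g @^-1` [set r] = set0.
    by apply/seteqP; split => // x /= gxr; have : (0 <= g x)%R by []; rewrite gxr leNgt r0.
  by rewrite !integral0_eq// => x _; rewrite indicE in_set0 mulr0 ?mul0e.
under eq_integral do rewrite EFinM.
rewrite ge0_integralZl//; last exact/measurable_EFinP.
rewrite integral_density_indic// -ge0_integralZl//.
- by apply: eq_integral => x _; rewrite EFinM muleA.
- by apply: emeasurable_funM; exact/measurable_EFinP.
- by move=> x _; rewrite mule_ge0// lee_fin.
Qed.

(** Indicators, simple functions and monotone limits in turn. The density enters as a hypothesis on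
    the values of [nu], so that the lemma applies both to [gauss_rV] and to the law of the limit
    reweighted by [1 / g]. *)
Lemma ge0_integral_density (F : T -> \bar R) : measurable_fun setT F ->
  (forall x, 0 <= F x) -> \int[nu]_x F x = \int[mu]_x (F x * (f x)%:E).
Proof.
move=> mF F0.
pose g := nnsfun_approx measurableT mF.
transitivity (limn (fun n => \int[nu]_x (g n x)%:E)).
  rewrite -monotone_convergence//=.
  - apply: eq_integral => ? /[!inE] xD; apply/esym/cvg_lim => //=.
    exact: cvg_nnsfun_approx.
  - by move=> n; exact/measurable_EFinP/measurable_funTS.
  - by move=> n ? _; rewrite lee_fin.
  - by move=> ? _ ? ? mn; rewrite lee_fin; exact/lefP/nd_nnsfun_approx.
under eq_fun do rewrite integral_density_nnsfun.
rewrite -monotone_convergence//=.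
- apply: eq_integral => x _; apply/cvg_lim => //=.
  apply: cvgeZr => //; exact: cvg_nnsfun_approx.
- by move=> n; apply: emeasurable_funM; apply/measurable_EFinP => //; exact/measurable_funTS.
- by move=> n ? _; rewrite mule_ge0// lee_fin.
- move=> ? _ ? ? mn; rewrite lee_wpmul2r ?lee_fin//.
  exact/lefP/nd_nnsfun_approx.
Qed.

End density.

Section gauss_density.
Local Open Scope ereal_scope.
Context {R : realType} (d : nat) (b : R).

Lemma gauss_pdf_ge0 (x : 'rV[R]_d) : (0 <= gauss_pdf b x)%R.
Proof. by rewrite mulr_ge0 ?powR_ge0 ?expR_ge0. Qed.

Lemma measurable_gauss_pdf : measurable_fun [set: borel_rV R d] (gauss_pdf b).
Proof. apply: continuous_measurable_rV; exact: continuous_gauss_pdf. Qed.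

Lemma ge0_integral_gauss (F : borel_rV R d -> \bar R) : measurable_fun setT F ->
  (forall x, 0 <= F x) ->
  \int[@gauss_rV R d b]_x F x = \int[@lebesgue_rV R d]_x (F x * (gauss_pdf b x)%:E).
Proof.
apply: ge0_integral_density => //; first exact: measurable_gauss_pdf.
exact: gauss_pdf_ge0.
Qed.

Lemma ge0_integral_cons (F : borel_rV R d.+1 -> \bar R) : measurable_fun setT F ->
  (forall x, 0 <= F x) ->
  \int[@lebesgue_rV R d.+1]_x F x =
  \int[@lebesgue_measure R]_s \int[@lebesgue_rV R d]_x F (cons_rV (s, x)).
Proof.
move=> mF F0.
transitivity (\int[pushforward (@lebesgue_measure R \x @lebesgue_rV R d)
  (@cons_rV R d)]_x F x); first by [].
rewrite ge0_integral_pushforward//=; last exact: measurable_cons_rV.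
rewrite preimage_setT fubini_tonelli1//=.
exact: (measurableT_comp mF (measurable_cons_rV (d:=d))).
Qed.

End gauss_density.

Definition pushforward_measure {d1 d2 : measure_display} {T1 : measurableType d1}
    {T2 : measurableType d2} {R : realType} (m : {measure set T1 -> \bar R})
    (f : T1 -> T2) (mf : measurable_fun setT f) : {measure set T2 -> \bar R} :=
  measure_function_pushforward__canonical__measure_function_Measure m mf.

(** * Dilations of the Lebesgue and Gaussian measures *)

Section lebesgue_scaling.
Local Open Scope ereal_scope.
Context {R : realType}.

(** By uniqueness of the Lebesgue measure it is enough to compare the lengths of half-open
    intervals. *)
Lemma lebesgue_measure_scale (c : R) (F : measurableTypeR R -> \bar R) : c != 0%R ->
  measurable_fun setT F -> (forall x, 0 <= F x) ->
  `|c|%:E * \int[@lebesgue_measure R]_x F (c * x)%R = \int[@lebesgue_measure R]_x F x.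
Proof.
move=> c0 mF F0.
have mc : measurable_fun [set: measurableTypeR R] (fun x => (c * x)%R : measurableTypeR R).
  exact: measurable_funM.
pose m := pushforward_measure (@lebesgue_measure R) mc.
pose m' : {measure set _ -> \bar R} := mscale (NngNum (normr_ge0 c)) m.
transitivity (\int[m']_x F x).
  rewrite ge0_integral_mscale// /= ge0_integral_pushforward//.
apply: eq_measure_integral => A mA _; apply/esym.
apply: (@lebesgue_measure_unique R m') => // _ [[a b] _ <-].
rewrite /m' /= /mscale /= /pushforward/=.
have c0' : (0 < `|c|)%R by rewrite normr_gt0.
case: (ltgtP c 0%R) c0 => // cs _.
(* A negative factor swaps the ends of the interval and moves its closed side; the length is
   unaffected. *)
- have -> : (fun x => (c * x)%R) @^-1` `]a, b] = [set` `[b / c, a / c[%R].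
    apply/seteqP; split => x /=; rewrite !in_itv/= ler_ndivrMr// ltr_ndivlMr//;
      by rewrite ![(x * _)%R]mulrC andbC.
  rewrite !lebesgue_measure_itv/= !lte_fin ltr_nM2r ?invr_lt0//.
  case: ifPn => _; last by rewrite mule0.
  by rewrite -!EFinB -EFinM (ltr0_norm cs); congr EFin; field; rewrite lt_eqF.
- have -> : (fun x => (c * x)%R) @^-1` `]a, b] = [set` `]a / c, b / c]%R].
    apply/seteqP; split => x /=; rewrite !in_itv/= ler_pdivlMr// ltr_pdivrMr//;
      by rewrite ![(x * _)%R]mulrC.
  rewrite !lebesgue_measure_itv/= !lte_fin ltr_pM2r ?invr_gt0//.
  case: ifPn => _; last by rewrite mule0.
  by rewrite -!EFinB -EFinM (gtr0_norm cs); congr EFin; field; rewrite gt_eqF.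
Qed.

Lemma cons_rV_scale d (c : R) s (x : 'rV[R]_d) :
  cons_rV ((c * s)%R, (c *: x)%R) = (c *: (cons_rV (s, x) : 'rV[R]_d.+1))%R.
Proof. by rewrite /cons_rV/= (@scale_row_mx _ 1 1 d) scale_scalar_mx. Qed.

Lemma measurable_scale_rV d (c : R) :
  measurable_fun setT (fun x : borel_rV R d => (c *: (x : 'rV[R]_d))%R : borel_rV R d).
Proof. by apply: measurable_scaleV => //; exact: measurable_id. Qed.

Lemma lebesgue_rV_scale d (c : R) (F : borel_rV R d -> \bar R) : c != 0%R ->
  measurable_fun setT F -> (forall x, 0 <= F x) ->
  (`|c| ^+ d)%:E * \int[@lebesgue_rV R d]_x F (c *: (x : 'rV[R]_d))%R =
  \int[@lebesgue_rV R d]_x F x.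
Proof.
move=> c0; elim: d F => [|d IH] F mF F0.
  rewrite expr0 mul1e; apply: eq_integral => x _; congr F.
  by apply/rowP => -[].
have mcons := measurableT_comp mF (measurable_cons_rV (R := R) (d := d)).
have mFc := measurableT_comp mF (measurable_scale_rV (d := d.+1) c).
rewrite !ge0_integral_cons// exprSr EFinM -muleA.
pose G s := \int[@lebesgue_rV R d]_x F (cons_rV (s, x)).
have mG : measurable_fun setT G.
  by apply: (measurable_fun_fubini_tonelli_F (m2 := @lebesgue_rV R d) (fun p => F (cons_rV p))).
have G0 s : 0 <= G s by exact: integral_ge0.
rewrite -(lebesgue_measure_scale c0 mG)// muleCA; congr (_ * _).
have mH := measurableT_comp mFc (measurable_cons_rV (R := R) (d := d)).
rewrite -ge0_integralZl//.
- apply: eq_integral => s _.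
  under eq_integral do rewrite -cons_rV_scale.
  rewrite (IH (fun x => F (cons_rV ((c * s)%R, x))))//.
  by apply: (measurableT_comp mcons); exact: pair1_measurable.
- by apply: (measurable_fun_fubini_tonelli_F (m2 := @lebesgue_rV R d) (fun p => F (c *: (cons_rV p : 'rV[R]_d.+1))%R)).
- by move=> s _; exact: integral_ge0.
Qed.

(** The factor [|c| ^+ d] is the Jacobian of [lebesgue_rV_scale]; the two match in
    [gauss_rV_scale]. *)
Lemma gauss_pdf_scale d (c b : R) (x : 'rV[R]_d) : c != 0%R -> (0 < b)%R ->
  gauss_pdf b x = (`|c| ^+ d * gauss_pdf (c ^+ 2 * b) (c *: x))%R.
Proof.
move=> c0 b0; rewrite /gauss_pdf [RHS]mulrA; congr (_ * expR _)%R; last first.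
  rewrite enormZ exprMn real_normK ?num_real//; congr (- _)%R.
  by field; rewrite c0 gt_eqF.
have c2 : (0 <= c ^+ 2)%R by rewrite sqr_ge0.
rewrite (_ : 2 * pi * (c ^+ 2 * b) = c ^+ 2 * (2 * pi * b))%R; last by ring.
rewrite (powRM _ c2); last by rewrite !mulr_ge0 ?pi_ge0// ltW.
rewrite -(real_normK (num_real c)) -(powR_mulrn 2)// -powRrM mulrN.
rewrite [(_ * (d%:R / _))%R]mulrC divfK// powR_invn// mulrA divff ?mul1r//.
by rewrite expf_neq0// normr_eq0.
Qed.

Lemma gauss_rV_scale d (c b : R) (F : borel_rV R d -> \bar R) : c != 0%R -> (0 < b)%R ->
  measurable_fun setT F -> (forall x, 0 <= F x) ->
  \int[@gauss_rV R d b]_x F (c *: (x : 'rV[R]_d))%R =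
  \int[@gauss_rV R d (c ^+ 2 * b)]_x F x.
Proof.
move=> c0 b0 mF F0.
have mFc := measurableT_comp mF (measurable_scale_rV (d := d) c).
rewrite (ge0_integral_gauss _ mFc (fun=> F0 _)) (ge0_integral_gauss _ mF F0).
have mp : measurable_fun [set: borel_rV R d]
    (fun x => F x * (@gauss_pdf R d (c ^+ 2 * b) x)%:E).
  by apply: emeasurable_funM => //; apply/measurable_EFinP; exact: measurable_gauss_pdf.
have p0 x : 0 <= F x * (@gauss_pdf R d (c ^+ 2 * b) x)%:E.
  by rewrite mule_ge0// lee_fin gauss_pdf_ge0.
rewrite -(lebesgue_rV_scale c0 mp p0) -ge0_integralZl//.
- by apply: eq_integral => x _; rewrite (gauss_pdf_scale _ c0 b0) EFinM muleCA.
- exact: (measurableT_comp mp (measurable_scale_rV (d := d) c)).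
Qed.

End lebesgue_scaling.

(** * Product structure and total mass of the Gaussian measure *)

Section gauss_recursion.
Local Open Scope ereal_scope.
Context {R : realType}.

Lemma dot_cons_rV d (s t : R) (x y : 'rV[R]_d) :
  dot (cons_rV (s, x)) (cons_rV (t, y)) = (s * t + dot x y)%R.
Proof.
rewrite /dot big_ord_recl; congr (_ * _ + _)%R.
- have -> : ord0 = lshift d (ord0 : 'I_1) :> 'I_(1 + d) by exact: val_inj.
  by rewrite /cons_rV (@row_mxEl _ 1 1 d) mxE.
- have -> : ord0 = lshift d (ord0 : 'I_1) :> 'I_(1 + d) by exact: val_inj.
  by rewrite /cons_rV (@row_mxEl _ 1 1 d) mxE.
- apply: eq_bigr => i _.
  have -> : lift ord0 i = rshift 1 i :> 'I_(1 + d) by exact: val_inj.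
  by rewrite /cons_rV !(@row_mxEr _ 1 1 d).
Qed.

Lemma gauss_pdf_cons d (b s : R) (x : 'rV[R]_d) : (0 < b)%R ->
  gauss_pdf b (cons_rV (s, x)) = (normal_pdf 0 (Num.sqrt b) s * gauss_pdf b x)%R.
Proof.
move=> b0; rewrite normal_pdfE/=; last by rewrite gt_eqF// sqrtr_gt0.
rewrite /normal_peak /normal_fun /gauss_pdf mulrACA -expRD.
rewrite (sqr_sqrtr (ltW b0)) subr0; congr (_ * expR _)%R.
  rewrite -powR12_sqrt; last by rewrite mulrn_wge0// mulr_ge0 ?pi_ge0// ltW.
  rewrite -powRN -[(b * pi *+ 2)%R]mulr_natl mulrA (mulrAC 2%R b pi).
  rewrite -powRD; last by apply/implyP => _; rewrite !mulf_neq0 ?gt_eqF ?pi_gt0.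
  by congr (_ `^ _)%R; rewrite -natr1; field.
rewrite !enorm_sqr dot_cons_rV -expr2.
by field; rewrite gt_eqF.
Qed.

Lemma ge0_integral_gauss_cons d (b : R) (F : borel_rV R d.+1 -> \bar R) :
  (0 < b)%R -> measurable_fun setT F -> (forall x, 0 <= F x) ->
  \int[@gauss_rV R d.+1 b]_x F x =
  \int[@lebesgue_measure R]_s
     ((\int[@gauss_rV R d b]_x F (cons_rV (s, x))) * (normal_pdf 0 (Num.sqrt b) s)%:E).
Proof.
move=> b0 mF F0.
have mcons := measurableT_comp mF (measurable_cons_rV (R := R) (d := d)).
have mFs s : measurable_fun setT (fun x => F (cons_rV (s, x))).
  by apply: (measurableT_comp mcons); exact: pair1_measurable.
rewrite (ge0_integral_gauss _ mF)//.
rewrite (@ge0_integral_cons R d (fun x => F x * (gauss_pdf b x)%:E)).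
- apply: eq_integral => s _; rewrite (ge0_integral_gauss _ (mFs s))// muleC.
  rewrite -ge0_integralZl//.
  + by apply: eq_integral => x _; rewrite gauss_pdf_cons// EFinM muleCA.
  + apply: emeasurable_funM => //; apply/measurable_EFinP.
    exact: measurable_gauss_pdf.
  + by move=> x _; rewrite mule_ge0// lee_fin gauss_pdf_ge0.
  + by rewrite lee_fin normal_pdf_ge0.
- by apply: emeasurable_funM => //; apply/measurable_EFinP; exact: measurable_gauss_pdf.
- by move=> x; rewrite mule_ge0// lee_fin gauss_pdf_ge0.
Qed.

Lemma gauss_rV_setT d (b : R) : (0 < b)%R -> @gauss_rV R d b setT = 1.
Proof.
move=> b0; elim: d => [|d IH].
  rewrite /gauss_rV integral_dirac//.
    rewrite diracT mul1e /gauss_pdf mul0r oppr0 powRr0 mul1r enorm0 expr0n/=.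
    by rewrite mul0r oppr0 expR0.
  by apply/measurable_EFinP; exact: measurable_gauss_pdf.
rewrite -[LHS]mul1e -integral_cst//.
rewrite (ge0_integral_gauss_cons b0 (measurable_cst 1))//.
rewrite -[RHS](@integral_normal_pdf R 0 (Num.sqrt b)); apply: eq_integral => s _.
by rewrite -[RHS]mul1e; congr (_ * _); rewrite integral_cst// mul1e; exact: IH.
Qed.

Lemma integral_gauss_cst d (b : R) (c : \bar R) : (0 < b)%R ->
  \int[@gauss_rV R d b]_x c = c.
Proof.
move=> b0; rewrite integral_cst// -[RHS]mule1; congr (_ * _).
exact: gauss_rV_setT.
Qed.

End gauss_recursion.

(** * Second moments and an exponential moment of the Gaussian measure *)

Section gauss_moments.
Local Open Scope ereal_scope.
Context {R : realType}.

Let S := \int[@lebesgue_measure R]_x (x ^+ 2 * normal_pdf 0 1 x)%:E.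

Let expn (a x : R) : R := expR (- (a * x ^+ 2) / 2).

Let integral_expn (a : R) : (0 < a)%R ->
  \int[@lebesgue_measure R]_x (normal_peak 1 * expn (a ^+ 2) x)%:E = (a^-1)%R%:E.
Proof.
move=> a0.
have a10 : (a^-1 != 0)%R by rewrite gt_eqF// invr_gt0.
transitivity (\int[@lebesgue_measure R]_x ((a^-1)%R%:E * (normal_pdf 0 a^-1 x)%:E)).
  apply: eq_integral => x _; rewrite -EFinM normal_pdfE//= /normal_fun.
  rewrite mulrA; congr (EFin (_ * expR _)%R).
    rewrite /normal_peak expr1n mul1r -mulrnAr sqrtrM ?sqr_ge0//.
    rewrite sqrtr_sqr ger0_norm ?invr_ge0 ?ltW// invfM invrK mulrA mulVf ?mul1r//.
    by rewrite gt_eqF.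
  by rewrite subr0 -mulr_natr; field; rewrite gt_eqF.
rewrite ge0_integralZl//.
- by rewrite integral_normal_pdf mule1.
- by apply/measurable_EFinP; exact: measurable_normal_pdf.
- by move=> x _; rewrite lee_fin normal_pdf_ge0.
- by rewrite lee_fin invr_ge0 ltW.
Qed.

Let phiE x : normal_pdf 0 1 x = (normal_peak 1 * expn 1 x)%R.
Proof.
rewrite normal_pdfE ?oner_neq0//= /normal_fun subr0 expr1n.
by rewrite /expn mul1r.
Qed.

Let mexpn a : measurable_fun setT (expn a).
Proof.
apply: measurableT_comp => //; apply: measurable_funM => //.
apply: measurableT_comp => //; apply: measurable_funM => //.
Qed.

(** Integrate [1 - k x^2 <= exp (- k x^2)] against the normal density, with [k = (b^2 - 1) / 2]. The
    right side becomes a Gaussian of standard deviation [1 / b], with integral [1 / b], so that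
    [1 - 1 / b <= k S], that is, [S >= 2 / (b (b + 1))]. No integration by parts is involved. *)
Let S_ge (b : R) : (1 < b)%R -> 1 <= (b ^+ 2)%:E * S.
Proof.
move=> b1; have b0 : (0 < b)%R by exact: lt_trans b1.
have k0 : (0 < (b ^+ 2 - 1) / 2)%R.
  by rewrite divr_gt0// subr_gt0 -(expr1n _ 2) ltr_pXn2r// nnegrE ltW.
have : 1 <= ((b ^+ 2 - 1) / 2)%:E * S + (b^-1)%R%:E.
  rewrite -[leLHS](@integral_normal_pdf R 0 1) -(integral_expn b0) /S.
  rewrite -ge0_integralZl//; first last.
  - by rewrite lee_fin ltW.
  - by move=> x _; rewrite lee_fin mulr_ge0 ?sqr_ge0 ?normal_pdf_ge0.
  - apply/measurable_EFinP; apply: measurable_funM => //.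
    exact: measurable_normal_pdf.
  rewrite -ge0_integralD//; first last.
  - apply/measurable_EFinP; apply: measurable_funM => //; exact: mexpn.
  - by move=> x _; rewrite lee_fin mulr_ge0 ?normal_peak_ge0 ?expR_ge0.
  - apply: emeasurable_funM => //; apply/measurable_EFinP; apply: measurable_funM => //.
    exact: measurable_normal_pdf.
  - by move=> x _; rewrite -EFinM lee_fin mulr_ge0 ?(ltW k0)// mulr_ge0 ?sqr_ge0 ?normal_pdf_ge0.
  apply: ge0_le_integral => //.
  - by move=> x _; rewrite lee_fin normal_pdf_ge0.
  - by apply/measurable_EFinP; exact: measurable_normal_pdf.
  - apply: emeasurable_funD.
      apply: emeasurable_funM => //; apply/measurable_EFinP; apply: measurable_funM => //.
      exact: measurable_normal_pdf.
    apply/measurable_EFinP; apply: measurable_funM => //; exact: mexpn.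
  move=> x _; rewrite -EFinM -EFinD lee_fin !phiE.
  have -> : expn (b ^+ 2) x = (expn 1 x * expR (- ((b ^+ 2 - 1) / 2 * x ^+ 2)))%R.
    by rewrite /expn -expRD; congr expR; field.
  have := expR_ge1Dx (- ((b ^+ 2 - 1) / 2 * x ^+ 2)).
  set e := expR _; set k := ((b ^+ 2 - 1) / 2)%R => h.
  have p0 : (0 <= normal_peak 1 * expn 1 x)%R by rewrite mulr_ge0 ?normal_peak_ge0 ?expR_ge0.
  move: p0; set p := normal_peak 1; set q := expn 1 x => p0.
  have : (p * q <= (k * x ^+ 2 + e) * (p * q))%R by rewrite ler_peMl//; lra.
  by congr (_ <= _)%R; ring.
have : 0 <= S by apply: integral_ge0 => x _; rewrite lee_fin mulr_ge0 ?sqr_ge0 ?normal_pdf_ge0.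
case: S => [s| |]//.
- rewrite -!EFinM -EFinD !lee_fin => s0 h.
  have h2 : (1 - b^-1 <= (b ^+ 2 - 1) / 2 * s)%R by lra.
  have : ((1 - b^-1) * b <= (b ^+ 2 - 1) / 2 * s * b)%R by rewrite ler_pM2r.
  rewrite mulrBl mul1r mulVf ?gt_eqF// => h3.
  nra.
- by move=> _ _; rewrite gt0_muley ?leey// lte_fin exprn_gt0.
Qed.

(** Mirror image of [S_ge]: [1 + k x^2 <= exp (k x^2)] with [k = (1 - a^2) / 2] gives
    [S <= 2 / (a (1 + a))], and in particular that [S] is finite. *)
Let S_le (a : R) : (0 < a < 1)%R -> (a ^+ 2)%:E * S <= 1.
Proof.
move=> /andP[a0 a1].
have k0 : (0 < (1 - a ^+ 2) / 2)%R.
  by rewrite divr_gt0// subr_gt0 -(expr1n _ 2) ltr_pXn2r// nnegrE ltW.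
have : ((1 - a ^+ 2) / 2)%:E * S + 1 <= (a^-1)%R%:E.
  rewrite -[X in _ + X](@integral_normal_pdf R 0 1) -(integral_expn a0) /S.
  rewrite -ge0_integralZl//; first last.
  - by rewrite lee_fin ltW.
  - by move=> x _; rewrite lee_fin mulr_ge0 ?sqr_ge0 ?normal_pdf_ge0.
  - apply/measurable_EFinP; apply: measurable_funM => //.
    exact: measurable_normal_pdf.
  rewrite -ge0_integralD//; first last.
  - by apply/measurable_EFinP; exact: measurable_normal_pdf.
  - by move=> x _; rewrite lee_fin normal_pdf_ge0.
  - apply: emeasurable_funM => //; apply/measurable_EFinP; apply: measurable_funM => //.
    exact: measurable_normal_pdf.
  - by move=> x _; rewrite -EFinM lee_fin mulr_ge0 ?(ltW k0)// mulr_ge0 ?sqr_ge0 ?normal_pdf_ge0.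
  apply: ge0_le_integral => //.
  - move=> x _; rewrite -EFinM -EFinD lee_fin addr_ge0 ?normal_pdf_ge0//.
    by rewrite mulr_ge0 ?(ltW k0)// mulr_ge0 ?sqr_ge0 ?normal_pdf_ge0.
  - apply: emeasurable_funD.
      apply: emeasurable_funM => //; apply/measurable_EFinP; apply: measurable_funM => //.
      exact: measurable_normal_pdf.
    by apply/measurable_EFinP; exact: measurable_normal_pdf.
  - apply/measurable_EFinP; apply: measurable_funM => //; exact: mexpn.
  move=> x _; rewrite -EFinM -EFinD lee_fin !phiE.
  have -> : expn (a ^+ 2) x = (expn 1 x * expR ((1 - a ^+ 2) / 2 * x ^+ 2))%R.
    by rewrite /expn -expRD; congr expR; field.
  have := expR_ge1Dx ((1 - a ^+ 2) / 2 * x ^+ 2).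
  set e := expR _; set k := ((1 - a ^+ 2) / 2)%R => h.
  have p0 : (0 <= normal_peak 1 * expn 1 x)%R by rewrite mulr_ge0 ?normal_peak_ge0 ?expR_ge0.
  move: p0; set p := normal_peak 1; set q := expn 1 x => p0.
  have : ((k * x ^+ 2 + 1) * (p * q) <= e * (p * q))%R by rewrite ler_wpM2r//; lra.
  by congr (_ <= _)%R; ring.
have : 0 <= S by apply: integral_ge0 => x _; rewrite lee_fin mulr_ge0 ?sqr_ge0 ?normal_pdf_ge0.
case: S => [s| |]//.
- rewrite -!EFinM -EFinD !lee_fin => s0 h.
  have : (((1 - a ^+ 2) / 2 * s + 1) * a <= a^-1 * a)%R by rewrite ler_pM2r.
  rewrite mulVf ?gt_eqF// => h3.
  nra.
- by move=> _; rewrite gt0_muley ?lte_fin.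
Qed.

Lemma normal_second_moment : S = 1.
Proof.
have : 0 <= S by apply: integral_ge0 => x _; rewrite lee_fin mulr_ge0 ?sqr_ge0 ?normal_pdf_ge0.
have := S_ge; have := S_le.
case: S => [s| |]//.
- move=> h1 h2; rewrite lee_fin => s0.
  have [s1|s1|->//] := ltgtP s 1%R.
  + have s0' : (0 < s)%R.
      rewrite lt_neqAle s0 andbT; apply/eqP => s0'.
      by have := h2 2%R (ltr1n _ 2); rewrite -s0' mule0 lee_fin lt_geF// ltr01.
    (* Then [b^2 s = 4 s / (1 + s)^2 < 1] by the inequality of arithmetic and geometric means.
       Likewise the [a] below gives [a^2 s = (1 + s)^2 / (4 s) > 1]. *)
    pose b : R := (2 / (1 + s))%R.
    have b1 : (1 < b)%R by rewrite ltr_pdivlMr; lra.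
    have := h2 b b1; rewrite -EFinM lee_fin leNgt => /negP; case.
    rewrite /b expr_div_n -mulrA mulrCA mulrC ltr_pdivrMr ?exprn_gt0//; nra.
  + pose a : R := ((1 + s) / (2 * s))%R.
    have s2 : (0 < 2 * s)%R by lra.
    have a1 : (0 < a < 1)%R.
      by apply/andP; split; [rewrite divr_gt0//; lra|rewrite ltr_pdivrMr//; lra].
    have := h1 a a1; rewrite -EFinM lee_fin leNgt => /negP; case.
    rewrite /a expr_div_n -mulrA mulrCA mulrC ltr_pdivlMr ?exprn_gt0//.
    have : (0 < s * (s - 1) ^+ 2)%R by rewrite mulr_gt0 ?exprn_gt0//; lra.
    lra.
- move=> h _ _; have := h (2^-1)%R.
  rewrite invr_gt0 invf_lt1 ?ltr1n// ltr0n => /(_ isT).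
  by rewrite gt0_muley// lte_fin exprn_gt0//; lra.
Qed.

End gauss_moments.

Section gauss_moments_rV.
Local Open Scope ereal_scope.
Context {R : realType}.

(** Adding the reflected integral ([s] replaced by [- s]) cancels the cross term, so only integrals
    of nonnegative functions occur. *)
Let normal_affine_sq (a r : R) :
  \int[@lebesgue_measure R]_s (((r + a * s) ^+ 2)%R%:E * (normal_pdf 0 1 s)%:E) =
  (r ^+ 2 + a ^+ 2)%:E.
Proof.
pose I := \int[@lebesgue_measure R]_s (((r + a * s) ^+ 2)%R%:E * (normal_pdf 0 1 s)%:E).
rewrite -/I.
have m (c : R) : measurable_fun [set: measurableTypeR R]
    (fun s : R => ((r + c * s) ^+ 2)%R%:E * (normal_pdf 0 1 s)%:E).
  apply: emeasurable_funM; apply/measurable_EFinP; last exact: measurable_normal_pdf.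
  by apply: measurable_funX; apply: measurable_funD => //; exact: measurable_funM.
have p0 (c : R) s : 0 <= ((r + c * s) ^+ 2)%R%:E * (normal_pdf 0 1 s)%:E.
  by rewrite -EFinM lee_fin mulr_ge0 ?sqr_ge0 ?normal_pdf_ge0.
have I2 : I + I = (2 * (r ^+ 2 + a ^+ 2))%:E.
  rewrite {1}/I -(lebesgue_measure_scale (c := -1) _ (m a) (p0 a)) ?oppr_eq0 ?oner_neq0//.
  rewrite normrN1 mul1e.
  under eq_integral => s _.
    rewrite (_ : normal_pdf 0 1 (-1 * s) = normal_pdf 0 1 s)%R; last first.
      by rewrite !normal_pdfE ?oner_neq0//= /normal_fun !subr0 mulN1r sqrrN.
    rewrite (_ : r + a * (-1 * s) = r + (- a) * s)%R; last by ring.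
    over.
  rewrite -ge0_integralD//.
  transitivity (\int[@lebesgue_measure R]_s ((2 * a ^+ 2)%:E * (s ^+ 2 * normal_pdf 0 1 s)%:E +
      (2 * r ^+ 2)%:E * (normal_pdf 0 1 s)%:E)).
    by apply: eq_integral => s _; rewrite -!EFinM -!EFinD; congr EFin; ring.
  have m1 : measurable_fun [set: measurableTypeR R] (fun s : R => (normal_pdf 0 1 s)%:E).
    by apply/measurable_EFinP; exact: measurable_normal_pdf.
  have m2 : measurable_fun [set: measurableTypeR R] (fun s : R => (s ^+ 2 * normal_pdf 0 1 s)%:E).
    apply/measurable_EFinP; apply: measurable_funM => //.
    exact: measurable_normal_pdf.
  have n0 (s : R) : 0 <= (normal_pdf 0 1 s)%:E by rewrite lee_fin normal_pdf_ge0.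
  have n2 (s : R) : 0 <= (s ^+ 2 * normal_pdf 0 1 s)%:E.
    by rewrite lee_fin mulr_ge0 ?sqr_ge0 ?normal_pdf_ge0.
  have k1 : 0 <= (2 * a ^+ 2)%R%:E by rewrite lee_fin mulr_ge0 ?sqr_ge0.
  have k2 : 0 <= (2 * r ^+ 2)%R%:E by rewrite lee_fin mulr_ge0 ?sqr_ge0.
  rewrite ge0_integralD//; first last.
  - exact: emeasurable_funM.
  - by move=> s _; exact: mule_ge0.
  - exact: emeasurable_funM.
  - by move=> s _; exact: mule_ge0.
  rewrite !ge0_integralZl// normal_second_moment integral_normal_pdf !mule1 -EFinD.
  by congr EFin; ring.
case: I I2 => [x| |]//.
by rewrite -EFinD => -[h]; congr EFin; lra.
Qed.

(** The free constant [r] carries the induction on [d]: the first coordinate is absorbed into it.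
    This single formula later yields both the mean and the covariance. *)
Lemma gauss_affine_sq d (a : 'rV[R]_d) (r : R) :
  \int[@gauss_rV R d 1]_x (((r + dot a x) ^+ 2)%R%:E) = (r ^+ 2 + dot a a)%:E.
Proof.
elim: d a r => [|d IH] a r.
  transitivity (\int[@gauss_rV R 0 1]_x (r ^+ 2 + dot a a)%R%:E).
    by apply: eq_integral => x _; rewrite /dot !big_ord0 !addr0.
  by rewrite integral_gauss_cst.
have [a0 [a' ->]] : exists a0 a', a = cons_rV (a0, a').
  exists ((lsubmx (a : 'rV_(1 + d))) ord0 ord0), (rsubmx (a : 'rV_(1 + d))).
  by rewrite -[LHS](@hsubmxK _ 1 1 d) /cons_rV/= -mx11_scalar.
rewrite ge0_integral_gauss_cons//; first last.
- by move=> x; rewrite lee_fin sqr_ge0.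
- apply/measurable_EFinP; apply: measurable_funX; apply: measurable_funD => //.
  by apply: measurable_dot; [exact: measurable_cst|exact: measurable_id].
rewrite sqrtr1.
under eq_integral => s _.
  under eq_integral do rewrite dot_cons_rV addrA.
  rewrite IH EFinD ge0_muleDl ?lee_fin ?sqr_ge0//; last first.
    by rewrite -enorm_sqr sqr_ge0.
  over.
rewrite ge0_integralD//; first last.
- by apply: emeasurable_funM => //; apply/measurable_EFinP; exact: measurable_normal_pdf.
- by move=> s _; rewrite -EFinM lee_fin mulr_ge0 ?normal_pdf_ge0// -enorm_sqr sqr_ge0.
- apply: emeasurable_funM; apply/measurable_EFinP; last exact: measurable_normal_pdf.
  by apply: measurable_funX; apply: measurable_funD => //; exact: measurable_funM.
- by move=> s _; rewrite -EFinM lee_fin mulr_ge0 ?normal_pdf_ge0// sqr_ge0.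
rewrite normal_affine_sq ge0_integralZl//; first last.
- by rewrite lee_fin -enorm_sqr sqr_ge0.
- by move=> s _; rewrite lee_fin normal_pdf_ge0.
- by apply/measurable_EFinP; exact: measurable_normal_pdf.
rewrite integral_normal_pdf mule1 dot_cons_rV -EFinD; congr EFin; ring.
Qed.

(** The exponent [1/4] turns the density of variance 1 into a multiple of the density of variance 2.
    This moment dominates all functions of polynomial growth. *)
Lemma gauss_exp_sq d :
  \int[@gauss_rV R d 1]_x (expR (enorm x ^+ 2 / 4))%:E < +oo.
Proof.
have me : measurable_fun [set: borel_rV R d] (fun x : borel_rV R d => (expR (enorm x ^+ 2 / 4))%:E).
  apply/measurable_EFinP; apply: measurableT_comp => //; apply: measurable_funM => //.
  by apply: measurable_funX; apply: measurable_enorm; exact: measurable_id.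
rewrite (ge0_integral_gauss _ me); last by move=> x; rewrite lee_fin expR_ge0.
apply: (@le_lt_trans _ _ ((2 `^ (d%:R / 2))%:E * @gauss_rV R d 2 setT)); last first.
  by rewrite gauss_rV_setT// mule1 ltry.
rewrite /gauss_rV -ge0_integralZl//; first last.
- by move=> x _; rewrite lee_fin gauss_pdf_ge0.
- by apply/measurable_EFinP; exact: measurable_gauss_pdf.
apply: ge0_le_integral => //.
- by move=> x _; rewrite mule_ge0// lee_fin ?gauss_pdf_ge0// expR_ge0.
- by apply: emeasurable_funM => //; apply/measurable_EFinP; exact: measurable_gauss_pdf.
- by apply: emeasurable_funM => //; apply/measurable_EFinP; exact: measurable_gauss_pdf.
move=> x _; rewrite -!EFinM lee_fin /gauss_pdf mulrCA -expRD mulrA mulr1.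
rewrite (_ : 2 * pi * 2 = 2 * (2 * pi))%R; last by ring.
rewrite (@powRM _ 2 (2 * pi)) ?mulr_ge0 ?pi_ge0//.
rewrite mulrA -powRD; last by apply/implyP.
rewrite subrr powRr0 mul1r; apply: ler_wpM2l; first exact: powR_ge0.
by rewrite ler_expR; lra.
Qed.

End gauss_moments_rV.

(** * Functions with a Lipschitz gradient *)

Section C11.
Context {R : realType} {d : nat}.
Implicit Types (K L rho : R) (x y v : 'rV[R]_d) (f g : 'rV[R]_d -> R)
  (F G : 'rV[R]_d -> 'rV[R]_d).

(* A first-order Taylor expansion with quadratic remainder replaces
   differentiability: unlike the latter it is stable under averaging without
   any exchange of limits. *)
Definition C11 K f F : Prop :=
  [/\ 0 <= K,
      forall x y, `|f y - f x - dot (F x) (y - x)| <= K * enorm (y - x) ^+ 2,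
      forall x, enorm (F x) <= K,
      forall x y, enorm (F x - F y) <= K * enorm (x - y) &
      forall x y, `|f x - f y| <= K * enorm (x - y)].

Lemma C11_le K L f F : K <= L -> C11 K f F -> C11 L f F.
Proof.
move=> KL [K0 f1 f2 f3 f4]; split => //; first exact: le_trans KL.
- by move=> x y; rewrite (le_trans (f1 _ _))// ler_wpM2r// sqr_ge0.
- by move=> x; exact: le_trans (f2 _) KL.
- by move=> x y; rewrite (le_trans (f3 _ _))// ler_wpM2r// enorm_ge0.
- by move=> x y; rewrite (le_trans (f4 _ _))// ler_wpM2r// enorm_ge0.
Qed.

Lemma C11_cst (c : R) : C11 0 (fun=> c) (fun=> 0).
Proof.
by split => // *; rewrite ?dot0l ?subrr ?subr0 ?enorm0 ?normr0 ?mul0r.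
Qed.

(** The Lipschitz bound on the gradient is the one that needs the factor 4: it has four terms, each
    at most [K ^+ 2] times the distance. *)
Lemma C11_mul K f F g G :
  C11 K f F -> C11 K g G -> (forall x, `|f x| <= K) -> (forall x, `|g x| <= K) ->
  C11 (4 * K ^+ 2) (fun x => f x * g x) (fun x => g x *: F x + f x *: G x).
Proof.
move=> [K0 f1 f2 f3 f4] [_ g1 g2 g3 g4] fK gK.
have ab (a b a' b' : R) : `|a| <= a' -> `|b| <= b' -> `|a * b| <= a' * b'.
  by move=> *; rewrite normrM ler_pM.
have K2 : 0 <= K ^+ 2 by exact: sqr_ge0.
split => [|x y|x|x y|x y]; first by rewrite mulr_ge0.
- have -> : f y * g y - f x * g x - dot (g x *: F x + f x *: G x) (y - x) =
    g x * (f y - f x - dot (F x) (y - x)) + f x * (g y - g x - dot (G x) (y - x))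
    + (f y - f x) * (g y - g x) by rewrite dotDl !dotZl; ring.
  have := ab _ _ _ _ (gK x) (f1 x y); have := ab _ _ _ _ (fK x) (g1 x y).
  have := ab _ _ _ _ (f4 y x) (g4 y x).
  set A := _ * (f y - f x - _); set B := _ * (g y - g x - _); set C := _ * (_ - g x).
  move: (enorm (y - x)) => t h1 h2 h3.
  have := ler_normD (A + B) C; have := ler_normD A B.
  have : 0 <= K ^+ 2 * t ^+ 2 by rewrite mulr_ge0 ?sqr_ge0.
  lra.
- have := enormD (g x *: F x) (f x *: G x); rewrite !enormZ.
  have : `|g x| * enorm (F x) <= K * K by rewrite ler_pM ?enorm_ge0.
  have : `|f x| * enorm (G x) <= K * K by rewrite ler_pM ?enorm_ge0.
  lra.
- have -> : g x *: F x + f x *: G x - (g y *: F y + f y *: G y) =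
    ((g x - g y) *: F x + g y *: (F x - F y)) +
    ((f x - f y) *: G x + f y *: (G x - G y)).
    by rewrite !scalerBl !scalerBr opprD; apply/rowP => i; rewrite !mxE; ring.
  have h (a : R) v (a' v' : R) : `|a| <= a' -> enorm v <= v' -> enorm (a *: v) <= a' * v'.
    by move=> *; rewrite enormZ ler_pM ?enorm_ge0.
  have := h _ _ _ _ (g4 x y) (f2 x); have := h _ _ _ _ (gK y) (f3 x y).
  have := h _ _ _ _ (f4 x y) (g2 x); have := h _ _ _ _ (fK y) (g3 x y).
  set A := _ *: F x; set B := _ *: (F x - _); set C := _ *: G x; set D := _ *: (G x - _).
  have := enormD (A + B) (C + D); have := enormD A B; have := enormD C D.
  lra.
- have -> : f x * g x - f y * g y = f x * (g x - g y) + (f x - f y) * g y by ring.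
  have := ab _ _ _ _ (fK x) (g4 x y); have := ab _ _ _ _ (f4 x y) (gK y).
  have := ler_normD (f x * (g x - g y)) ((f x - f y) * g y).
  have : 0 <= K ^+ 2 * enorm (x - y) by rewrite mulr_ge0 ?enorm_ge0.
  lra.
Qed.

(** The first term of the constant comes from the remainder of [f], the second from squared or
    paired increments of [f] divided by three of its values. *)
Lemma C11_inv K rho f F : 0 < rho -> C11 K f F -> (forall x, rho <= f x) ->
  C11 (K / rho ^+ 2 + 2 * K ^+ 2 / rho ^+ 3) (fun x => (f x)^-1)
    (fun x => - (f x ^- 2) *: F x).
Proof.
move=> r0 [K0 f1 f2 f3 f4] fr.
have fp x : 0 < f x by exact: lt_le_trans (fr x).
have fn x : f x != 0 by rewrite gt_eqF.
have ri : 0 < rho^-1 by rewrite invr_gt0.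
have fir x : `|(f x)^-1| <= rho^-1 by rewrite gtr0_norm ?invr_gt0// lef_pV2 ?posrE.
pose s := rho^-1.
have -> : K / rho ^+ 2 + 2 * K ^+ 2 / rho ^+ 3 = K * s ^+ 2 + 2 * K ^+ 2 * s ^+ 3.
  by rewrite !exprVn.
have ab (a b a' b' : R) : `|a| <= a' -> `|b| <= b' -> `|a * b| <= a' * b'.
  by move=> *; rewrite normrM ler_pM.
have i2 x y : `|(f x)^-1 * (f y)^-1| <= s * s := ab _ _ _ _ (fir x) (fir y).
have i3 x y z : `|(f x)^-1 * (f y)^-1 * (f z)^-1| <= s * s * s.
  exact: ab (i2 x y) (fir z).
have s0 : 0 < s by [].
have k1 : 0 <= K * s ^+ 2 by rewrite mulr_ge0 ?sqr_ge0.
have k2 : 0 <= K ^+ 2 * s ^+ 3 by rewrite mulr_ge0 ?sqr_ge0// exprn_ge0// ltW.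
have di x y : (f x)^-1 - (f y)^-1 = - (f x - f y) * ((f x)^-1 * (f y)^-1).
  by field; rewrite !fn.
split => [|x y|x|x y|x y]; first by lra.
- have -> : (f y)^-1 - (f x)^-1 - dot (- f x ^- 2 *: F x) (y - x) =
    - ((f y - f x - dot (F x) (y - x)) * ((f x)^-1 * (f x)^-1)) +
    ((f y - f x) * (f y - f x)) * ((f x)^-1 * (f x)^-1 * (f y)^-1).
    by rewrite dotZl; move: (dot _ _) => D; field; rewrite !fn.
  have := ab _ _ _ _ (f1 x y) (i2 x x).
  have := ab _ _ _ _ (ab _ _ _ _ (f4 y x) (f4 y x)) (i3 x x y).
  set A := (_ - dot _ _) * _; set B := _ * (_ / f x / f y).
  have := ler_normD (- A) B; rewrite normrN; move: (enorm _) => t.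
  have : 0 <= K ^+ 2 * s ^+ 3 * t ^+ 2 by rewrite mulr_ge0 ?sqr_ge0.
  lra.
- rewrite enormZ normrN.
  have : `|f x ^- 2| <= s * s by rewrite -exprVn expr2.
  by move=> h; have := ler_pM (normr_ge0 _) (enorm_ge0 _) h (f2 x); lra.
- have -> : - f x ^- 2 *: F x - - f y ^- 2 *: F y =
     - ((f x)^-1 * (f x)^-1) *: (F x - F y) +
     ((f x - f y) * ((f x)^-1 * (f x)^-1 * (f y)^-1) +
      (f x - f y) * ((f x)^-1 * (f y)^-1 * (f y)^-1)) *: F y.
    by apply/rowP => i; rewrite !mxE; field; rewrite !fn.
  apply: le_trans (enormD _ _) _; rewrite !enormZ normrN.
  have h1 : `|(f x)^-1 * (f x)^-1| * enorm (F x - F y) <= s * s * (K * enorm (x - y)).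
    by apply: ler_pM; rewrite ?enorm_ge0.
  have h2 := ab _ _ _ _ (f4 x y) (i3 x x y).
  have h3 := ab _ _ _ _ (f4 x y) (i3 x y y).
  set A := (_ - f y) * _; set B := (_ - f y) * _.
  have h4 : `|A + B| * enorm (F y) <= 2 * (K * enorm (x - y) * (s * s * s)) * K.
    apply: ler_pM => //; first exact: enorm_ge0.
    rewrite (le_trans (ler_normD _ _))//; rewrite -/A in h2; rewrite -/B in h3; lra.
  lra.
- rewrite di -normrN mulNr opprK.
  have := ab _ _ _ _ (f4 x y) (i2 x y).
  have : 0 <= K ^+ 2 * s ^+ 3 * enorm (x - y) by rewrite mulr_ge0 ?enorm_ge0.
  lra.
Qed.

End C11.

(** * A cutoff function with Lipschitz derivative *)

Section cutoff.
Context {R : realType}.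
Implicit Types t s : R.

(** A step that vanishes for [t <= 0], tends to 1 at infinity and has a Lipschitz derivative
    [dcutoff]. Being rational in the positive part of [t], it admits purely algebraic estimates. *)
Definition cutoff t : R := 1 - (1 + Num.max t 0 ^+ 2)^-1.
Definition dcutoff t : R := 2 * Num.max t 0 / (1 + Num.max t 0 ^+ 2) ^+ 2.

Let pos t : R := Num.max t 0.

Let pos_ge0 t : 0 <= pos t. Proof. by rewrite le_max lexx orbT. Qed.

Let pos_lip t s : `|pos t - pos s| <= `|t - s|.
Proof.
have := ler_norm (t - s); have := ler_norm (s - t); rewrite distrC.
rewrite ler_norml /pos; case: (leP t 0) => ht; case: (leP s 0) => hs; lra.
Qed.

Let q_exp t s : `|pos s ^+ 2 - pos t ^+ 2 - 2 * pos t * (s - t)| <= (s - t) ^+ 2.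
Proof.
have := sqr_ge0 (s - t); have := sqr_ge0 s; have := sqr_ge0 t.
rewrite ler_norml /pos; case: (leP t 0) => ht; case: (leP s 0) => hs.
- lra.
- have : t * s <= 0 by rewrite mulr_le0_ge0// ltW.
  lra.
- have : t * s <= 0 by rewrite mulr_ge0_le0// ltW.
  lra.
- lra.
Qed.

Let r_le (a : R) : 0 < (1 + a ^+ 2)^-1 <= 1.
Proof.
have a2 : 0 <= a ^+ 2 by exact: sqr_ge0.
by rewrite invr_gt0 invf_le1 ?lerDl// ltr_pwDl// a2.
Qed.

Let ar_le (a : R) : 0 <= a -> 0 <= 2 * a * (1 + a ^+ 2)^-1 <= 1.
Proof.
move=> a0; have a2 : 0 < 1 + a ^+ 2 by have := sqr_ge0 a; lra.
rewrite divr_ge0 ?(ltW a2) ?mulr_ge0//= ler_pdivrMr// mul1r.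
have := sqr_ge0 (a - 1); lra.
Qed.

Lemma cutoff_ge0 t : 0 <= cutoff t.
Proof. by have /andP[_] := r_le (pos t); rewrite /cutoff /pos; lra. Qed.

Lemma cutoff_le1 t : cutoff t <= 1.
Proof. by have /andP[] := r_le (pos t); rewrite /cutoff /pos; lra. Qed.

Lemma cutoff_le0 t : t <= 0 -> cutoff t = 0.
Proof.
by move=> t0; rewrite /cutoff (_ : Num.max t 0 = 0) ?expr0n/= ?addr0 ?invr1 ?subrr//; apply/max_idPr.
Qed.

Lemma dcutoff_bound t : 0 <= dcutoff t <= 1.
Proof.
have /andP[h1 h2] := ar_le (pos_ge0 t); have /andP[h3 h4] := r_le (pos t).
rewrite /dcutoff -/(pos t) expr2 invfM mulrA.
by rewrite mulr_ge0 ?(ltW h3)//= mulr_ile1// ltW.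
Qed.

Lemma cutoff_exp t s : `|cutoff s - cutoff t - dcutoff t * (s - t)| <= 4 * (s - t) ^+ 2.
Proof.
rewrite /cutoff /dcutoff -!/(pos _).
have := q_exp t s; have := pos_lip s t.
have := pos_ge0 s; have := pos_ge0 t.
move: (pos t) (pos s) => a b a0 b0 hl hq.
have ha : 1 + a ^+ 2 != 0 by rewrite gt_eqF// ltr_pwDl ?sqr_ge0.
have hb : 1 + b ^+ 2 != 0 by rewrite gt_eqF// ltr_pwDl ?sqr_ge0.
have /andP[ra1 ra2] := r_le a; have /andP[rb1 rb2] := r_le b.
pose ra := (1 + a ^+ 2)^-1; pose rb := (1 + b ^+ 2)^-1.
(* The first term is the remainder of the squared positive part, the second the curvature of
   [u |-> 1 / (1 + u)]. The latter is controlled by [(a + b)^2 <= 2 (1 + a^2) (1 + b^2)]. *)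
have -> : 1 - (1 + b ^+ 2)^-1 - (1 - (1 + a ^+ 2)^-1)
    - 2 * a / (1 + a ^+ 2) ^+ 2 * (s - t) =
  (b ^+ 2 - a ^+ 2 - 2 * a * (s - t)) * ra ^+ 2
   - (b - a) ^+ 2 * ((a + b) ^+ 2 * (ra * rb)) * ra.
  by rewrite /ra /rb; field; rewrite ha hb.
have h1 : `|(b ^+ 2 - a ^+ 2 - 2 * a * (s - t)) * ra ^+ 2| <= (s - t) ^+ 2 * 1.
  by rewrite normrM ler_pM// ger0_norm ?sqr_ge0// expr_le1// ltW.
have h2 : (b - a) ^+ 2 <= (s - t) ^+ 2.
  by rewrite -(real_normK (num_real (b - a))) -(real_normK (num_real (s - t))) ler_pXn2r ?nnegrE.
have h3 : 0 <= (a + b) ^+ 2 * (ra * rb) <= 2.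
  rewrite mulr_ge0 ?sqr_ge0 ?(mulr_ge0 (ltW ra1) (ltW rb1))//=.
  rewrite /ra /rb -invfM ler_pdivrMr ?mulr_gt0//; try by rewrite ltr_pwDl ?sqr_ge0.
  have := sqr_ge0 (a - b); have : 0 <= a ^+ 2 * b ^+ 2 by rewrite mulr_ge0 ?sqr_ge0.
  lra.
have h4 : `|(b - a) ^+ 2 * ((a + b) ^+ 2 * (ra * rb)) * ra| <= (s - t) ^+ 2 * 2 * 1.
  have /andP[h31 h32] := h3.
  rewrite ger0_norm; last by rewrite mulr_ge0 ?(ltW ra1)// mulr_ge0 ?sqr_ge0.
  apply: ler_pM => //; [by rewrite mulr_ge0 ?sqr_ge0|exact: ltW|].
  by apply: ler_pM => //; exact: sqr_ge0.
apply: le_trans (ler_normB _ _) _.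
have := sqr_ge0 (s - t); lra.
Qed.

Lemma dcutoff_lip t s : `|dcutoff t - dcutoff s| <= 4 * `|t - s|.
Proof.
rewrite /dcutoff -!/(pos _).
have := pos_lip t s; have := pos_ge0 s; have := pos_ge0 t.
move: (pos t) (pos s) => a b a0 b0 hl.
have ha : 1 + a ^+ 2 != 0 by rewrite gt_eqF// ltr_pwDl ?sqr_ge0.
have hb : 1 + b ^+ 2 != 0 by rewrite gt_eqF// ltr_pwDl ?sqr_ge0.
have /andP[ra1 ra2] := r_le a; have /andP[rb1 rb2] := r_le b.
have /andP[pa1 pa2] := ar_le a0; have /andP[pb1 pb2] := ar_le b0.
pose ra := (1 + a ^+ 2)^-1; pose rb := (1 + b ^+ 2)^-1.
rewrite -/ra -/rb in ra1 ra2 rb1 rb2 pa1 pa2 pb1 pb2.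
have -> : 2 * a / (1 + a ^+ 2) ^+ 2 - 2 * b / (1 + b ^+ 2) ^+ 2 =
   (b - a) * (2 * a * ra * ((2 * a * ra) * rb + (2 * b * rb) * ra) / 2)
   + (a - b) * (2 * (1 - a * b) * (ra * rb) * rb).
  by rewrite /ra /rb; field; rewrite ha hb.
have h1 : 0 <= 2 * a * ra * ((2 * a * ra) * rb + (2 * b * rb) * ra) / 2 <= 1.
  move: pa1 pa2 pb1 pb2; move: (2 * a * ra) (2 * b * rb) => p q *.
  have u1 : 0 <= p * rb <= 1 by rewrite mulr_ge0 ?mulr_ile1 ?(ltW rb1).
  have u2 : 0 <= q * ra <= 1 by rewrite mulr_ge0 ?mulr_ile1 ?(ltW ra1).
  have /andP[u3 u4] : 0 <= (p * rb + q * ra) / 2 <= 1 by lra.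
  by rewrite -mulrA mulr_ge0//= mulr_ile1.
have h2 : `|2 * (1 - a * b) * (ra * rb) * rb| <= 2.
  rewrite normrM -[leRHS]mulr1 ler_pM// ?(gtr0_norm rb1)//.
  rewrite normrM (gtr0_norm (mulr_gt0 ra1 rb1)) /ra /rb -invfM.
  rewrite ler_pdivrMr ?mulr_gt0//; try by rewrite ltr_pwDl ?sqr_ge0.
  have : 0 <= a ^+ 2 * b ^+ 2 by rewrite mulr_ge0 ?sqr_ge0.
  have : 0 <= a * b by rewrite mulr_ge0.
  by rewrite ler_norml; have := sqr_ge0 (a - b); lra.
apply: le_trans (ler_normD _ _) _.
have : `|(b - a) * (2 * a * ra * ((2 * a * ra) * rb + (2 * b * rb) * ra) / 2)| <= `|t - s| * 1.
  by rewrite normrM ler_pM// ?(distrC b)// ger0_norm; lra.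
have : `|(a - b) * (2 * (1 - a * b) * (ra * rb) * rb)| <= `|t - s| * 2.
  by rewrite normrM ler_pM.
have := normr_ge0 (t - s); lra.
Qed.

Lemma cutoff_lip t s : `|cutoff t - cutoff s| <= `|t - s|.
Proof.
rewrite /cutoff -!/(pos _).
have := pos_lip t s; have := pos_ge0 s; have := pos_ge0 t.
move: (pos t) (pos s) => a b a0 b0 hl.
have ha : 1 + a ^+ 2 != 0 by rewrite gt_eqF// ltr_pwDl ?sqr_ge0.
have hb : 1 + b ^+ 2 != 0 by rewrite gt_eqF// ltr_pwDl ?sqr_ge0.
have /andP[ra1 ra2] := r_le a; have /andP[rb1 rb2] := r_le b.
have /andP[pa1 pa2] := ar_le a0; have /andP[pb1 pb2] := ar_le b0.
pose ra := (1 + a ^+ 2)^-1; pose rb := (1 + b ^+ 2)^-1.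
rewrite -/ra -/rb in ra1 ra2 rb1 rb2 pa1 pa2 pb1 pb2.
have -> : 1 - (1 + a ^+ 2)^-1 - (1 - (1 + b ^+ 2)^-1) =
   (a - b) * (((2 * a * ra) * rb + (2 * b * rb) * ra) / 2).
  by rewrite /ra /rb; field; rewrite ha hb.
have h1 : 0 <= ((2 * a * ra) * rb + (2 * b * rb) * ra) / 2 <= 1.
  move: pa1 pa2 pb1 pb2; move: (2 * a * ra) (2 * b * rb) => p q *.
  have u1 : 0 <= p * rb <= 1 by rewrite mulr_ge0 ?mulr_ile1 ?(ltW rb1).
  have u2 : 0 <= q * ra <= 1 by rewrite mulr_ge0 ?mulr_ile1 ?(ltW ra1).
  by lra.
rewrite normrM -[leRHS]mulr1 ler_pM// ger0_norm; lra.
Qed.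

(** The factor [1 + k ^+ 2] dominates both [|k|], for the first-order bounds, and [k ^+ 2], for the
    second-order ones. The 4 is that of [cutoff_exp] and [dcutoff_lip]. *)
Lemma C11_cutoff d (i : 'I_d) (k c : R) :
  C11 (4 * (1 + k ^+ 2)) (fun x : 'rV[R]_d => cutoff (k * x ord0 i + c))
    (fun x => (k * dcutoff (k * x ord0 i + c)) *: delta_mx ord0 i).
Proof.
have k1 : `|k| <= 1 + k ^+ 2.
  by rewrite ler_norml; have := sqr_ge0 (k - 1); have := sqr_ge0 (k + 1); lra.
have k2 : 0 <= k ^+ 2 by exact: sqr_ge0.
have nd : enorm (delta_mx ord0 i : 'rV[R]_d) = 1.
  by apply/eqP; rewrite -(@eqrXn2 _ 2) ?enorm_ge0// enorm_sqr dot_delta mxE !eqxx expr1n.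
have xi (x y : 'rV[R]_d) : `|x ord0 i - y ord0 i| <= enorm (x - y).
  by have := normr_coord_le (x - y) i; rewrite !mxE.
have e2 (x y : 'rV[R]_d) : (x ord0 i - y ord0 i) ^+ 2 <= enorm (x - y) ^+ 2.
  by rewrite -(real_normK (num_real (x ord0 i - _))) ler_pXn2r ?nnegrE ?enorm_ge0.
have df (x y : 'rV[R]_d) : k * x ord0 i + c - (k * y ord0 i + c) = k * (x ord0 i - y ord0 i).
  by ring.
split => [|x y|x|x y|x y]; first by lra.
- rewrite dotZl dot_delta !mxE -mulrA mulrCA -df.
  apply: le_trans (cutoff_exp _ _) _; rewrite df exprMn mulrA.
  by apply: ler_pM; [rewrite mulr_ge0|exact: sqr_ge0|lra|exact: e2].
- rewrite enormZ nd mulr1 normrM.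
  have /andP[h1 h2] := dcutoff_bound (k * x ord0 i + c).
  rewrite (ger0_norm h1); apply: le_trans (ler_wpM2l (normr_ge0 k) h2) _; lra.
- rewrite -scalerBl enormZ nd mulr1 -mulrBr normrM.
  apply: le_trans (ler_wpM2l (normr_ge0 k) (dcutoff_lip _ _)) _.
  rewrite df normrM.
  have -> : `|k| * (4 * (`|k| * `|x ord0 i - y ord0 i|)) = 4 * k ^+ 2 * `|x ord0 i - y ord0 i|.
    by rewrite -(real_normK (num_real k)); ring.
  by apply: ler_pM => //; lra.
- apply: le_trans (cutoff_lip _ _) _; rewrite df normrM.
  by apply: ler_pM => //; lra.
Qed.

End cutoff.

(** * Gaussian averages *)

Section gauss_expectation.
Context {R : realType} {d : nat}.
Implicit Types (x y v w a b q z : 'rV[R]_d) (p r K c : R) (F G : 'rV[R]_d -> R).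

Definition gE (F : 'rV[R]_d -> R) : R := (\int[@gauss_rV R d 1]_z F z)%R.

Definition gint (F : 'rV[R]_d -> R) : Prop :=
  (@gauss_rV R d 1).-integrable [set: borel_rV R d] (EFin \o (F : borel_rV R d -> R)).

(** Cubic growth is enough because the one-step weak expansion has remainders of degree at most
    three in the noise. *)
Lemma gint_growth (F : 'rV[R]_d -> R) K : measurable_fun [set: borel_rV R d] F ->
  (forall z, `|F z| <= K * (1 + enorm z) ^+ 3) -> gint F.
Proof.
move=> mF FK.
have me : measurable_fun [set: borel_rV R d]
    (fun x : borel_rV R d => (expR (enorm x ^+ 2 / 4))%:E).
  apply/measurable_EFinP; apply: measurableT_comp => //; apply: measurable_funM => //.
  by apply: measurable_funX; apply: measurable_enorm; exact: measurable_id.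
have ie : (@gauss_rV R d 1).-integrable [set: borel_rV R d]
    (fun x : borel_rV R d => (64 * `|K|)%:E * (expR (enorm x ^+ 2 / 4))%:E)%E.
  apply: integrableZl => //.
  apply/integrableP; split => //.
  rewrite (eq_integral (fun x : borel_rV R d => (expR (enorm x ^+ 2 / 4))%:E)).
    exact: gauss_exp_sq.
  by move=> x _; rewrite /= ger0_norm ?expR_ge0.
apply: (le_integrable measurableT _ _ ie); first exact/measurable_EFinP.
move=> z _; rewrite -EFinM /= lee_fin [leRHS]ger0_norm; last first.
  by rewrite mulr_ge0 ?expR_ge0// mulr_ge0.
apply: le_trans (FK z) _.
apply: (@le_trans _ _ (`|K| * (1 + enorm z) ^+ 3)).
  by rewrite ler_wpM2r ?ler_norm// exprn_ge0// addr_ge0 ?enorm_ge0.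
rewrite (mulrC 64) -mulrA ler_wpM2l//; move: (enorm_ge0 z); set t := enorm z => t0.
(* Taking cube roots, it remains to see [1 + t <= 4 exp (t^2 / 12)], which follows from
   [1 + u <= exp u]; hence [64 = 4 ^+ 3]. *)
rewrite (_ : t ^+ 2 / 4 = 3%:R * (t ^+ 2 / 12)); last by field.
rewrite expRM_natl (_ : 64 = 4 ^+ 3); last by rewrite -natrX.
rewrite -exprMn ler_pXn2r ?nnegrE ?mulr_ge0 ?expR_ge0//; last by rewrite addr_ge0.
have := expR_ge1Dx (t ^+ 2 / 12); have := sqr_ge0 (t - 3 / 2); lra.
Qed.

Lemma gint_cst r : gint (fun=> r).
Proof.
apply: (@gint_growth _ `|r|) => // z.
by rewrite ler_peMr// exprn_ege1// lerDl enorm_ge0.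
Qed.

Lemma gint_pow K : gint (fun z => K * (1 + enorm z) ^+ 3).
Proof.
apply: (@gint_growth _ `|K|).
  apply: measurable_funM => //; apply: measurable_funX; apply: measurable_funD => //.
  by apply: measurable_enorm; exact: measurable_id.
by move=> z; rewrite normrM (@ger0_norm _ (_ ^+ 3))// exprn_ge0// addr_ge0 ?enorm_ge0.
Qed.

Lemma gE_cst r : gE (fun=> r) = r.
Proof. by rewrite /gE /Rintegral integral_gauss_cst. Qed.

Lemma gED F G : gint F -> gint G -> gE (fun z => F z + G z) = gE F + gE G.
Proof. by move=> iF iG; rewrite /gE RintegralD. Qed.

Lemma gEB F G : gint F -> gint G -> gE (fun z => F z - G z) = gE F - gE G.
Proof. by move=> iF iG; rewrite /gE RintegralB. Qed.

Lemma gEZ r F : gint F -> gE (fun z => r * F z) = r * gE F.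
Proof. by move=> iF; rewrite /gE RintegralZl. Qed.

Lemma gintD F G : gint F -> gint G -> gint (fun z => F z + G z).
Proof. by move=> iF iG; exact: (integrableD measurableT iF iG). Qed.

Lemma gintB F G : gint F -> gint G -> gint (fun z => F z - G z).
Proof. by move=> iF iG; exact: (integrableB measurableT iF iG). Qed.

Lemma gintZ r F : gint F -> gint (fun z => r * F z).
Proof. by move=> iF; exact: (integrableZl measurableT r iF). Qed.

Lemma gint_sum (I : Type) (s : seq I) (F : I -> 'rV[R]_d -> R) :
  (forall i, gint (F i)) -> gint (fun z => \sum_(i <- s) F i z).
Proof.
move=> iF; elim: s => [|i s IH].
  by under eq_fun do rewrite big_nil; exact: gint_cst.
by under eq_fun do rewrite big_cons; exact: gintD.
Qed.

Lemma gE_sum (I : Type) (s : seq I) (F : I -> 'rV[R]_d -> R) :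
  (forall i, gint (F i)) ->
  gE (fun z => \sum_(i <- s) F i z) = \sum_(i <- s) gE (F i).
Proof.
move=> iF; elim: s => [|i s IH].
  by under eq_fun do rewrite big_nil; rewrite big_nil gE_cst.
under eq_fun do rewrite big_cons.
by rewrite big_cons gED ?IH//; exact: gint_sum.
Qed.

Lemma gE_le F G : gint F -> gint G -> (forall z, F z <= G z) -> gE F <= gE G.
Proof. by move=> iF iG FG; apply: le_Rintegral. Qed.

Lemma gE_norm_le F G : gint F -> gint G -> (forall z, `|F z| <= G z) -> `|gE F| <= gE G.
Proof.
move=> iF iG FG; rewrite ler_norml; apply/andP; split.
  rewrite -mulN1r -gEZ//; apply: gE_le => //; first exact: gintZ.
  by move=> z; have := FG z; rewrite mulN1r ler_norml => /andP[].
by apply: gE_le => // z; exact: le_trans (ler_norm _) (FG z).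
Qed.

Lemma enorm_pow3 z k : (k <= 3)%N -> enorm z ^+ k <= (1 + enorm z) ^+ 3.
Proof.
move=> k3; apply: (@le_trans _ _ ((1 + enorm z) ^+ k)).
  by rewrite lerXn2r ?nnegrE ?addr_ge0 ?enorm_ge0// lerDr.
by apply: ler_weXn2l; rewrite ?lerDl ?enorm_ge0.
Qed.

Lemma gint_dot a : gint (dot a).
Proof.
apply: (@gint_growth _ (enorm a)).
  by apply: measurable_dot; [exact: measurable_cst|exact: measurable_id].
move=> z; apply: le_trans (normr_dot_le _ _) _.
by rewrite ler_wpM2l ?enorm_ge0// -[leLHS]expr1 enorm_pow3.
Qed.

Lemma gint_dot2 a b : gint (fun z => dot a z * dot b z).
Proof.
apply: (@gint_growth _ (enorm a * enorm b)).
  by apply: measurable_funM; apply: measurable_dot; rewrite ?measurable_cst//; exact: measurable_id.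
move=> z; rewrite normrM.
apply: (@le_trans _ _ ((enorm a * enorm z) * (enorm b * enorm z))).
  by apply: ler_pM => //; exact: normr_dot_le.
rewrite mulrACA ler_wpM2l ?mulr_ge0 ?enorm_ge0// -expr2.
exact: enorm_pow3.
Qed.

Let gE_affine a r : gE (fun z => (r + dot a z) ^+ 2) = r ^+ 2 + dot a a.
Proof. by rewrite /gE /Rintegral gauss_affine_sq. Qed.

Let gE_dot_sq a : gE (fun z => dot a z * dot a z) = dot a a.
Proof.
transitivity (gE (fun z => (0 + dot a z) ^+ 2)); last first.
  by rewrite gE_affine expr0n add0r.
by congr gE; apply/funext => z; rewrite add0r expr2.
Qed.

(** Expanding [gE_affine] at [r = 1] leaves [2 * gE (dot a) = 0]: the mean is deduced from the
    second moments. *)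
Lemma gE_dot a : gE (dot a) = 0.
Proof.
have := gE_affine a 1.
rewrite (_ : (fun _ => _) = (fun z => (1 + 2 * dot a z) + dot a z * dot a z)); last first.
  by apply/funext => z; ring.
have i2 := gintZ 2 (gint_dot a).
rewrite gED; [|by apply: gintD => //; exact: gint_cst|exact: gint_dot2].
rewrite gED//; last exact: gint_cst.
rewrite gE_cst gEZ; last exact: gint_dot.
by rewrite gE_dot_sq; lra.
Qed.

Lemma gE_dot2 a b : gE (fun z => dot a z * dot b z) = dot a b.
Proof.
have := gE_dot_sq (a + b).
rewrite (_ : (fun _ => _) = (fun z => (dot a z * dot a z + 2 * (dot a z * dot b z)) + dot b z * dot b z)); last first.
  by apply/funext => z; rewrite !dotDl; ring.
have i := gint_dot2; have i2 := gintZ 2 (gint_dot2 a b).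
rewrite gED//; last exact: gintD.
rewrite gED// gEZ// !gE_dot_sq dotDl !dotDr (dotC b a); lra.
Qed.

Lemma gint_enorm2 : gint (fun z => enorm z ^+ 2).
Proof.
apply: (@gint_growth _ 1).
  by apply: measurable_funX; apply: measurable_enorm; exact: measurable_id.
by move=> z; rewrite mul1r ger0_norm ?sqr_ge0// enorm_pow3.
Qed.

Lemma gE_enorm2 : gE (fun z => enorm z ^+ 2) = d%:R.
Proof.
rewrite (_ : (fun _ => _) = (fun z => \sum_(i < d) dot (delta_mx ord0 i) z * dot (delta_mx ord0 i) z)).
  rewrite gE_sum => [|i]; last exact: gint_dot2.
  rewrite (eq_bigr (fun=> 1)); first by rewrite sumr_const card_ord.
  by move=> i _; rewrite gE_dot2 dot_delta mxE !eqxx.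
by apply/funext => z; rewrite enorm_sqr; apply: eq_bigr => i _; rewrite dot_delta.
Qed.

(** The moment that weighs every remainder of the weak expansion. It depends on [d], which is
    harmless as it never enters the final constant. The factor [1] keeps the shape of [gint_pow]. *)
Definition gmom : R := gE (fun z => 1 * (1 + enorm z) ^+ 3).

Lemma gmom_ge0 : 0 <= gmom.
Proof.
rewrite -(gE_cst 0); apply: gE_le; [exact: gint_cst|exact: gint_pow|].
by move=> z; rewrite mul1r exprn_ge0// addr_ge0 ?enorm_ge0.
Qed.

(** The linear term has mean zero and the rank-one quadratic term has mean [dot a b]. Integrability
    of [F] comes out of the same approximation, so the expansions below need not establish it
    separately. *)
Lemma gE_approx F p q a b r : measurable_fun [set: borel_rV R d] F ->
  (forall z, `|F z - (p + dot q z + dot a z * dot b z)| <= r * (1 + enorm z) ^+ 3) ->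
  gint F /\ `|gE F - (p + dot a b)| <= r * gmom.
Proof.
move=> mF Fr.
have iq := gint_dot q; have iab := gint_dot2 a b; have ic := gint_cst p.
have iG : gint (fun z => p + dot q z + dot a z * dot b z) by do 2 apply: gintD => //.
have iFG : gint (fun z => F z - (p + dot q z + dot a z * dot b z)).
  apply: (@gint_growth _ r) => //; apply: measurable_funB => //.
  by move/integrableP : iG => [/measurable_EFinP].
have iF : gint F.
  by have := gintD iFG iG; under [X in gint X -> _]eq_fun do rewrite subrK.
split => //.
have -> : p + dot a b = gE (fun z => p + dot q z + dot a z * dot b z).
  by rewrite gED//; [rewrite gED// gE_cst gE_dot gE_dot2 addr0|exact: gintD].
rewrite -gEB//.
rewrite /gmom -gEZ; last exact: gint_pow.
apply: gE_norm_le => //; last by move=> z; rewrite mul1r.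
by apply: gintZ; exact: gint_pow.
Qed.

End gauss_expectation.

Section gauss_average.
Context {R : realType} {d : nat}.
Implicit Types (x y v w z : 'rV[R]_d) (K c : R).

Definition gavg c (U : 'rV[R]_d -> R) x : R := gE (fun z => U (x + c *: z)).

Definition gavgV c (G : 'rV[R]_d -> 'rV[R]_d) x : 'rV[R]_d :=
  \row_i gE (fun z => G (x + c *: z) ord0 i).

Lemma measurable_shift c x :
  measurable_fun [set: borel_rV R d] (fun z : borel_rV R d => x + c *: (z : 'rV[R]_d) : borel_rV R d).
Proof.
apply: measurable_addV; first exact: measurable_cst.
by apply: measurable_scaleV; [exact: measurable_cst|exact: measurable_id].
Qed.

Lemma gint_lip K c x (U : 'rV[R]_d -> R) :
  (forall x y, `|U x - U y| <= K * enorm (x - y)) -> gint (fun z => U (x + c *: z)).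
Proof.
move=> UK; apply: (@gint_growth _ _ _ (`|U x| + `|K| * `|c|)).
  apply: (measurableT_comp (f := U : borel_rV R d -> R)); last exact: measurable_shift.
  by apply: continuous_measurable_rV; exact: lipschitz_continuous UK.
move=> z; have := UK (x + c *: z) x; rewrite [x + _]addrC addrK enormZ [_ + x]addrC => h.
have h0 : `|U (x + c *: z)| <= `|U x| + `|K| * `|c| * enorm z.
  have := ler_normD (U x) (U (x + c *: z) - U x); rewrite subrKC => h1.
  have : K * (`|c| * enorm z) <= `|K| * (`|c| * enorm z).
    by rewrite ler_wpM2r ?ler_norm// mulr_ge0 ?enorm_ge0.
  by lra.
apply: le_trans h0 _; rewrite mulrDl lerD//.
  by rewrite ler_peMr// exprn_ege1// lerDl enorm_ge0.
by rewrite ler_wpM2l ?mulr_ge0// -[leLHS]expr1 enorm_pow3.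
Qed.

Lemma gint_lipV K c x w (G : 'rV[R]_d -> 'rV[R]_d) :
  (forall x y, enorm (G x - G y) <= K * enorm (x - y)) ->
  gint (fun z => dot w (G (x + c *: z))).
Proof.
move=> GK; apply: (@gint_lip (enorm w * K) c x (fun z => dot w (G z))) => u v.
rewrite -dotBr; apply: le_trans (normr_dot_le _ _) _.
by rewrite -mulrA ler_wpM2l ?enorm_ge0.
Qed.

Lemma dot_gavgV K c x w (G : 'rV[R]_d -> 'rV[R]_d) :
  (forall x y, enorm (G x - G y) <= K * enorm (x - y)) ->
  dot w (gavgV c G x) = gE (fun z => dot w (G (x + c *: z))).
Proof.
move=> GK; rewrite /dot gE_sum => [|i].
  apply: eq_bigr => i _; rewrite mxE gEZ//.
  have := gint_lipV c x (delta_mx ord0 i) GK.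
  by under [X in gint X -> _]eq_fun do rewrite dot_delta.
have := gintZ (w ord0 i) (gint_lipV c x (delta_mx ord0 i) GK).
by under [X in gint X -> _]eq_fun do rewrite dot_delta.
Qed.

Lemma gavg_dist r (F G : 'rV[R]_d -> R) : gint F -> gint G -> (forall z : 'rV[R]_d, `|F z - G z| <= r) ->
  `|gE F - gE G| <= r.
Proof.
move=> iF iG h; rewrite -gEB// -[leRHS](@gE_cst _ d).
by apply: gE_norm_le => //; [exact: gintB|exact: gint_cst].
Qed.

(** The shift [c *: z] cancels in every difference, so each bound holds pointwise in [z] and
    survives averaging with the same [K], whatever [c] and [d]. *)
Lemma C11_gavg K c U G : C11 K U G -> C11 K (gavg c U) (gavgV c G).
Proof.
move=> [K0 u1 u2 u3 u4].
have iU x : gint (fun z => U (x + c *: z)) by exact: gint_lip u4.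
have iG x w : gint (fun z => dot w (G (x + c *: z))) by exact: gint_lipV u3.
have dG x w := dot_gavgV c x w u3.
have sh x y z : y + c *: z - (x + c *: z) = y - x.
  by rewrite opprD addrACA subrr addr0.
split => // [x y|x|x y|x y].
- rewrite dotC dG /gavg -gEB//; apply: gavg_dist => //; first exact: gintB.
  by move=> z; have := u1 (x + c *: z) (y + c *: z); rewrite sh dotC.
- apply: enorm_le_dot => // w; rewrite dG -[leRHS](@gE_cst _ d).
  apply: gE_le => //; first exact: gint_cst.
  move=> z; apply: le_trans (dot_le _ _) _.
  by rewrite mulrC ler_wpM2r ?enorm_ge0.
- apply: enorm_le_dot => [|w]; first by rewrite mulr_ge0 ?enorm_ge0.
  rewrite dotBr !dG -gEB// -[leRHS](@gE_cst _ d).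
  apply: gE_le => //; [exact: gintB|exact: gint_cst|].
  move=> z; rewrite -dotBr; apply: le_trans (dot_le _ _) _.
  rewrite mulrC ler_wpM2r ?enorm_ge0//.
  by have := u3 (x + c *: z) (y + c *: z); rewrite sh.
- by apply: gavg_dist => // z; have := u4 (x + c *: z) (y + c *: z); rewrite sh.
Qed.

Lemma gavg_ge r c U G K x : C11 K U G -> (forall y, r <= U y) -> r <= gavg c U x.
Proof.
move=> [_ _ _ _ u4] h; rewrite -(@gE_cst _ d r); apply: gE_le => //.
  exact: gint_cst.
exact: gint_lip u4.
Qed.

Lemma gavg_norm_le r c U G K x : C11 K U G -> (forall y, `|U y| <= r) -> `|gavg c U x| <= r.
Proof.
move=> [_ _ _ _ u4] h; rewrite -[leRHS](@gE_cst _ d); apply: gE_norm_le => //.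
  exact: gint_lip u4.
exact: gint_cst.
Qed.

End gauss_average.

(** * Gradients and Taylor expansions *)

Section derivatives.
Context {R : realType} {d : nat}.
Implicit Types (x y v w : 'rV[R]_d) (K s : R).

Lemma derive_of_expansion (f : 'rV[R]_d -> R) x a v K : 0 <= K ->
  (forall y, `|f y - f x - dot a (y - x)| <= K * enorm (y - x) ^+ 2) ->
  'D_v f x = dot a v.
Proof.
move=> K0 fK; apply/cvg_lim => //; apply/cvgrPdist_le => e e0.
have c0 : 0 < K * enorm v ^+ 2 + 1 by rewrite ltr_wpDl// mulr_ge0 ?sqr_ge0.
near=> h.
have hn0 : h != 0 by near: h; exact: nbhs_dnbhs_neq.
have he : `|h| <= e / (K * enorm v ^+ 2 + 1).
  near: h; apply: dnbhs0_le; exact: divr_gt0.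
rewrite /= -(ler_pM2l (_ : 0 < `|h|)) ?normr_gt0// -normrM mulrBr.
rewrite [h * (h^-1 *: _)]mulrA divff// mul1r distrC -dotZr.
have := fK (h *: v + x); rewrite addrK enormZ exprMn => H.
apply: le_trans H _.
rewrite mulrCA expr2 -mulrA ler_wpM2l//.
rewrite ler_pdivlMr// in he; have := normr_ge0 h; lra.
Unshelve. all: by end_near. Qed.

Lemma grad_of_expansion (f : 'rV[R]_d -> R) x a K : 0 <= K ->
  (forall y, `|f y - f x - dot a (y - x)| <= K * enorm (y - x) ^+ 2) ->
  grad f x = a.
Proof.
move=> K0 fK; apply/rowP => i.
by rewrite mxE (derive_of_expansion _ K0 fK) dotC dot_delta.
Qed.

Lemma derive_grad (f : 'rV[R]_d -> R) x v : differentiable f x ->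
  'D_v f x = dot (grad f x) v.
Proof.
move=> df; rewrite deriveE// [in LHS](row_sum_delta v) linear_sum/=.
by apply: eq_bigr => i _; rewrite linearZ/= mxE deriveE// mulrC.
Qed.

Lemma derive_grad_dot (F : 'rV[R]_d -> 'rV[R]_d) x v w : differentiable F x ->
  dot w ('D_v F x) = dot (\row_i dot w ('D_(delta_mx ord0 i) F x)) v.
Proof.
move=> df; rewrite deriveE// [in LHS](row_sum_delta v) linear_sum/= dot_sumr.
by apply: eq_bigr => i _; rewrite linearZ/= dotZr mxE deriveE// mulrC.
Qed.

Lemma is_derive_line (f : 'rV[R]_d -> R) x v s :
  derivable f (x + s *: v) v ->
  is_derive s (1 : R) (fun s : R => f (x + s *: v)) ('D_v f (x + s *: v)).
Proof.
have E : (fun h : R => h^-1 *: ((f \o shift (x + s *: v)) (h *: v) - f (x + s *: v))) =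
  (fun h : R => h^-1 *: (((fun s : R => f (x + s *: v)) \o shift s) (h *: (1 : R)) - f (x + s *: v))).
  apply/funext => h /=; congr (_ *: (f _ - _)).
  by rewrite scalerDl addrCA -scalerA scale1r.
by move=> df; apply: DeriveDef; [move: df; rewrite /derivable E|rewrite /derive E].
Qed.

Lemma is_derive_line_dot (F : 'rV[R]_d -> 'rV[R]_d) x v w s :
  derivable F (x + s *: v) v ->
  is_derive s (1 : R) (fun s : R => dot w (F (x + s *: v))) (dot w ('D_v F (x + s *: v))).
Proof.
move=> dF; have cd : continuous (dot w).
  apply: (@lipschitz_continuous _ _ _ (enorm w)) => y z.
  by rewrite -dotBr normr_dot_le.
have E : (fun h : R => dot w (h^-1 *: ((F \o shift (x + s *: v)) (h *: v) - F (x + s *: v)))) =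
  (fun h : R => h^-1 *: (((fun s : R => dot w (F (x + s *: v))) \o shift s) (h *: (1 : R)) - dot w (F (x + s *: v)))).
  apply/funext => h /=; rewrite dotZr dotBr; congr (_ * (dot w (F _) - _)).
  by rewrite scalerDl addrCA -scalerA scale1r.
have H : (fun h : R => dot w (h^-1 *: ((F \o shift (x + s *: v)) (h *: v) - F (x + s *: v))))
    @ 0^' --> dot w ('D_v F (x + s *: v)).
  by apply: continuous_cvg => //; exact: cd.
rewrite E in H; apply: DeriveDef; last exact: cvg_lim H.
by apply/cvg_ex; exists (dot w ('D_v F (x + s *: v))).
Qed.

(** The remainder comes from the mean value theorem along a segment; the bound on the gradient is
    inherited from the difference quotients. *)
Lemma C11_of_lipschitz_grad (f : 'rV[R]_d -> R) K : 0 <= K ->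
  (forall x, differentiable f x) ->
  (forall x y, `|f x - f y| <= K * enorm (x - y)) ->
  (forall x y, enorm (grad f x - grad f y) <= K * enorm (x - y)) ->
  C11 K f (grad f).
Proof.
move=> K0 df f4 f3; split => //.
- move=> x y; set v := y - x; have xv : x + v = y by rewrite /v subrKC.
  have D (s : R) : is_derive s (1 : R) (fun s : R => f (x + s *: v)) (dot (grad f (x + s *: v)) v).
    by rewrite -derive_grad//; apply: is_derive_line; exact: diff_derivable.
  have C : {within `[(0:R), 1], continuous (fun s : R => f (x + s *: v))}.
    apply: continuous_subspaceT => s; apply: differentiable_continuous.
    by apply/derivable1_diffP; have [] := D s.
  have [c /itvP c01] := @MVT _ _ _ 0 1 ltr01 (fun s _ => D s) C.
  rewrite scale0r addr0 scale1r subr0 mulr1 xv => ->.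
  rewrite -dotBl; apply: le_trans (normr_dot_le _ _) _.
  rewrite expr2 mulrA ler_wpM2r ?enorm_ge0//.
  apply: le_trans (f3 _ _) _; rewrite ler_wpM2l// [x + _]addrC addrK enormZ.
  by rewrite ler_piMl ?enorm_ge0// ger0_norm ?c01.
- move=> x; apply: enorm_le_dot => // w.
  rewrite dotC -derive_grad//.
  have [|w0] := eqVneq w 0.
    by move=> ->; rewrite enorm0 mulr0 derive_grad// dot0r.
  have H : (fun h : R => h^-1 *: ((f \o shift x) (h *: w) - f x)) @ 0^' --> 'D_w f x.
    exact: diff_derivable.
  apply: (@closed_cvg _ _ (0^') _ _ [set t : R | t <= K * enorm w] _ _ _ H).
    exact: closed_le.
  near=> h; rewrite /=.
  have hn0 : h != 0 by near: h; exact: nbhs_dnbhs_neq.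
  apply: le_trans (ler_norm _) _; rewrite normrM normfV.
  rewrite mulrC ler_pdivrMr ?normr_gt0//.
  by apply: le_trans (f4 _ _) _; rewrite addrK enormZ mulrA mulrAC.
Unshelve. all: by end_near. Qed.

(** The mean value theorem applied twice to [dot w \o F] along a segment. The first-order term is
    displayed as a fixed vector acting through [dot], because that is the form whose Gaussian mean
    vanishes. *)
Lemma expansion_of_D2 (F : 'rV[R]_d -> 'rV[R]_d) K w x v : 0 <= K -> C2_map F ->
  (forall x v, enorm (D2 F x v v) <= K * enorm v * enorm v) ->
  `|dot w (F (x + v)) - dot w (F x) - dot (\row_i dot w ('D_(delta_mx ord0 i) F x)) v|
    <= enorm w * K * enorm v ^+ 2.
Proof.
move=> K0 [[dF _] C1] bF.
have D1 (s : R) : is_derive s (1 : R) (fun s : R => dot w (F (x + s *: v))) (dot w ('D_v F (x + s *: v))).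
  by apply: is_derive_line_dot; exact: diff_derivable.
have D2 (s : R) : is_derive s (1 : R) (fun s : R => dot w ('D_v F (x + s *: v))) (dot w (D2 F (x + s *: v) v v)).
  by apply: is_derive_line_dot; apply: diff_derivable; have [h _] := C1 v; exact: h.
have C (f df : R -> R) (c : R) : (forall s, is_derive s (1 : R) f (df s)) ->
    {within `[(0:R), c], continuous f}.
  move=> h; apply: continuous_subspaceT => s; apply: differentiable_continuous.
  by apply/derivable1_diffP; have [] := h s.
rewrite -derive_grad_dot//.
have [c] := @MVT _ _ _ 0 1 ltr01 (fun s _ => D1 s) (C _ _ _ D1).
rewrite in_itv/= scale0r addr0 scale1r subr0 mulr1 => /andP[c0 c1] ->.
have [e] := @MVT _ _ _ 0 c c0 (fun s _ => D2 s) (C _ _ _ D2).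
rewrite in_itv/= scale0r addr0 subr0 => /andP[e0 ec] ->.
rewrite normrM (gtr0_norm c0).
have h : `|dot w (Defs.D2 F (x + e *: v) v v)| <= enorm w * (K * enorm v * enorm v).
  by apply: le_trans (normr_dot_le _ _) _; rewrite ler_wpM2l ?enorm_ge0.
have := ler_pM (normr_ge0 _) (ltW c0) h (ltW c1).
by congr (_ <= _); ring.
Qed.

(** Again the mean value theorem for [dot w \o f]. The derivative is relative to the half-open
    interval [[0, 1[], so two-sided derivability inside and continuity at the end points have to be
    recovered first. *)
Lemma time_lipschitz (f : R -> 'rV[R]_d) (df : R -> 'rV[R]_d) K (t t' : R) :
  0 <= t -> t < t' -> t' < 1 ->
  (forall t, 0 <= t < 1 -> is_time_derive f t (df t)) ->
  (forall s, t < s < t' -> enorm (df s) <= K) ->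
  enorm (f t' - f t) <= K * (t' - t).
Proof.
move=> t0 tt' t1 fd dfK.
have K0 : 0 <= K.
  by apply: le_trans (enorm_ge0 _) (dfK ((t + t') / 2) _); rewrite !midf_lt.
apply: enorm_le_dot => [|w]; first by rewrite mulr_ge0// subr_ge0 ltW.
have cd : continuous (dot w).
  apply: (@lipschitz_continuous _ _ _ (enorm w)) => y z.
  by rewrite -dotBr normr_dot_le.
(* The relative derivative in quantitative form, valid for [u] on either side of [s] as long as it
   lies in [[0, 1[]. Derivability and continuity are both drawn from it. *)
have E s e : 0 <= s < 1 -> 0 < e -> exists2 del, 0 < del & forall u, 0 <= u < 1 ->
    `|u - s| < del ->
    `|dot w (f u) - dot w (f s) - (u - s) * dot w (df s)| <= e * `|u - s|.
  move=> s01 e0; have H := fd s s01.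
  have Q : (fun u => dot w ((u - s)^-1 *: (f u - f s))) @ within `[0, 1[%classic s^'
      --> dot w (df s) by apply: continuous_cvg; [exact: cd|exact: H].
  have : \forall u \near s, u != s -> u \in `[0, 1[ ->
      `|dot w (df s) - dot w ((u - s)^-1 *: (f u - f s))| <= e.
    by move/cvgrPdist_le : Q => /(_ _ e0).
  move=> /nbhs_ballP[del /= del0 He].
  exists del => // u u01 us; have [->|us0] := eqVneq u s.
    by rewrite !subrr mul0r subrr normr0 mulr0.
  have us1 : u - s != 0 by rewrite subr_eq0.
  have := He u; rewrite /ball/= distrC in_itv/= => /(_ us us0 u01).
  rewrite dotZr dotBr -(ler_pM2l (_ : 0 < `|u - s|)) ?normr_gt0// -normrM mulrBr.
  by rewrite mulVKf// distrC [leRHS]mulrC.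
have D s : s \in `]t, t'[ -> is_derive s (1 : R) (fun s : R => dot w (f s)) (dot w (df s)).
  rewrite in_itv/= => /andP[ts st'].
  have s0 : 0 < s by exact: le_lt_trans ts.
  have s1 : s < 1 by exact: lt_trans t1.
  have s01' : 0 <= s < 1 by rewrite (ltW s0) s1.
  have Q : (fun h : R => h^-1 *: (((fun s : R => dot w (f s)) \o shift s) (h *: (1 : R)) - dot w (f s)))
      @ 0^' --> dot w (df s).
    apply/cvgrPdist_le => e e0; have [del del0 He] := E s e s01' e0.
    near=> h.
    have hn0 : h != 0 by near: h; exact: nbhs_dnbhs_neq.
    have h1 : `|h| < del by near: h; exact: dnbhs0_lt.
    have h2 : `|h| < s by near: h; exact: dnbhs0_lt.
    have h3 : `|h| < 1 - s by near: h; apply: dnbhs0_lt; rewrite subr_gt0.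
    have := He (s + h); rewrite [s + h]addrC addrK => /(_ _ h1) {}He.
    have hs : 0 <= h + s < 1.
      by move: h2 h3; rewrite !ltr_norml => /andP[? ?] /andP[? ?]; apply/andP; split; lra.
    have {}He := He hs; rewrite /= -(ler_pM2l (_ : 0 < `|h|)) ?normr_gt0// -normrM mulrBr.
    by rewrite [h *: 1]mulr1 [h * (_ *: _)]mulrA divff// mul1r distrC [leRHS]mulrC.
  apply: DeriveDef; last exact: cvg_lim Q.
  by apply/cvg_ex; exists (dot w (df s)).
have cts s : t <= s <= t' -> forall e, 0 < e -> exists2 del, 0 < del &
    forall u, 0 <= u < 1 -> `|u - s| < del -> `|dot w (f s) - dot w (f u)| <= e.
  move=> /andP[ts st'] e e0.
  have s01 : 0 <= s < 1 by rewrite (le_trans t0 ts) (le_lt_trans st' t1).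
  have [del del0 He] := E s 1 s01 ltr01.
  pose B := `|dot w (df s)| + 1.
  have B0 : 0 < B by rewrite ltr_wpDl.
  exists (Num.min del (e / B)); first by rewrite lt_min del0 divr_gt0.
  move=> u u01; rewrite lt_min => /andP[/(He _ u01) h1 h2]; rewrite distrC.
  rewrite ltr_pdivlMr// /B in h2.
  have := ler_normD (dot w (f u) - dot w (f s) - (u - s) * dot w (df s)) ((u - s) * dot w (df s)).
  rewrite subrK normrM; lra.
have C : {within `[t, t'], continuous (fun s : R => dot w (f s))}.
  apply/(continuous_within_itvP _ tt'); split.
  - move=> s st; apply: differentiable_continuous.
    by apply/derivable1_diffP; have [] := D s st.
  - apply/cvgrPdist_le => e e0.
    have [|del del0 He] := cts t _ e e0; first by rewrite lexx ltW.
    near=> u; have tu : t < u by near: u; exact: nbhs_right_gt.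
    have ut : u < t' by near: u; exact: nbhs_right_lt.
    apply: He; first by rewrite (le_trans t0 (ltW tu)) (lt_trans ut t1).
    rewrite gtr0_norm ?subr_gt0// ltrBlDl; near: u; apply: nbhs_right_lt.
    by rewrite ltrDl.
  - apply/cvgrPdist_le => e e0.
    have [|del del0 He] := cts t' _ e e0; first by rewrite lexx ltW.
    near=> u; have tu : t < u by near: u; exact: nbhs_left_gt.
    have ut : u < t' by near: u; exact: nbhs_left_lt.
    apply: He; first by rewrite (le_trans t0 (ltW tu)) (lt_trans ut t1).
    rewrite distrC gtr0_norm ?subr_gt0// ltrBlDl -ltrBlDr; near: u; apply: nbhs_left_gt.
    by rewrite ltrBlDr ltrDl.
have [c ctt'] := MVT tt' D C; rewrite -dotBr => ->.
rewrite [leRHS]mulrAC ler_wpM2r ?subr_ge0 ?(ltW tt')//.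
apply: le_trans (dot_le _ _) _; rewrite mulrC ler_wpM2r ?enorm_ge0// dfK//.
Unshelve. all: by end_near. Qed.

End derivatives.

(** * The exact and the Monte Carlo drift *)

Section drift.
Context {R : realType} {d : nat}.
Implicit Types (x y v w : 'rV[R]_d).

Lemma quotient_dist (L rho b1 b2 : R) (a1 a2 : 'rV[R]_d) : 0 < rho -> rho <= b1 ->
  rho <= b2 -> enorm a2 <= L ->
  enorm (b1^-1 *: a1 - b2^-1 *: a2) <= enorm (a1 - a2) / rho + L * `|b1 - b2| / rho ^+ 2.
Proof.
move=> r0 r1 r2 La.
have b10 : 0 < b1 by exact: lt_le_trans r1.
have b20 : 0 < b2 by exact: lt_le_trans r2.
have -> : b1^-1 *: a1 - b2^-1 *: a2 =
    b1^-1 *: (a1 - a2) + ((b2 - b1) * (b1^-1 * b2^-1)) *: a2.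
  by apply/rowP => i; rewrite !mxE; field; rewrite !gt_eqF.
have i1 : b1^-1 <= rho^-1 by rewrite lef_pV2.
have i2 : b2^-1 <= rho^-1 by rewrite lef_pV2.
apply: le_trans (enormD _ _) _; rewrite !enormZ normrM distrC.
rewrite [`|b1^-1|]gtr0_norm ?invr_gt0// [`|_ * b2^-1|]gtr0_norm ?mulr_gt0 ?invr_gt0//.
apply: lerD; first by rewrite mulrC ler_wpM2l ?enorm_ge0.
rewrite -[leLHS]mulrA [leRHS](_ : _ = `|b1 - b2| * ((rho^-1 * rho^-1) * L)); last by rewrite expr2 invfM; ring.
rewrite ler_wpM2l//; apply: ler_pM; rewrite ?enorm_ge0//.
  by rewrite mulr_ge0 ?invr_ge0 ?ltW.
by apply: ler_pM; rewrite ?invr_ge0 ?(ltW b10) ?(ltW b20).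
Qed.

(** Applying [ln a <= a - 1] to the ratio [u y / u x] and to its inverse bounds the logarithm on
    both sides, up to [(u y - u x)^2 / (u x * u y)]. *)
Lemma ln_expansion (u : 'rV[R]_d -> R) (G : 'rV[R]_d -> 'rV[R]_d) L rho x y :
  0 < rho -> C11 L u G -> (forall z, rho <= u z) ->
  `|ln (u y) - ln (u x) - dot ((u x)^-1 *: G x) (y - x)| <=
  (L ^+ 2 / rho ^+ 2 + L / rho) * enorm (y - x) ^+ 2.
Proof.
move=> rho0 [L0 u1 _ _ u4] ur.
have up z : 0 < u z by exact: lt_le_trans (ur z).
have lnu a : 0 < a -> ln a <= a - 1.
  by move=> a0; have := expR_ge1Dx (ln a); rewrite lnK ?posrE//; lra.
rewrite dotZl.
have -> : ln (u y) - ln (u x) - (u x)^-1 * dot (G x) (y - x) =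
  (ln (u y) - ln (u x) - (u y - u x) / u x) + (u x)^-1 * (u y - u x - dot (G x) (y - x)) by ring.
apply: le_trans (ler_normD _ _) _; rewrite [leRHS]mulrDl; apply: lerD; last first.
  rewrite normrM [leLHS]mulrC [leRHS]mulrAC; apply: ler_pM => //.
  by rewrite gtr0_norm ?invr_gt0// lef_pV2 ?posrE.
apply: (@le_trans _ _ ((u y - u x) ^+ 2 / (u x * u y))).
  rewrite -ln_div ?posrE//.
  have h1 : ln (u y / u x) <= u y / u x - 1 by apply: lnu; rewrite divr_gt0.
  have h2 : - ln (u y / u x) <= u x / u y - 1.
    by rewrite -lnV ?posrE ?divr_gt0// invf_div; apply: lnu; rewrite divr_gt0.
  have e1 : (u y - u x) / u x = u y / u x - 1 by field; rewrite gt_eqF.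
  have e2 : (u y - u x) ^+ 2 / (u x * u y) = u y / u x + u x / u y - 2.
    by field; rewrite !gt_eqF.
  rewrite e1 e2 ler_norml; lra.
have -> : L ^+ 2 / rho ^+ 2 * enorm (y - x) ^+ 2 = (L * enorm (y - x)) ^+ 2 * (rho ^+ 2)^-1.
  by rewrite exprMn; ring.
apply: ler_pM; rewrite ?sqr_ge0 ?invr_ge0 ?mulr_ge0 ?(ltW (up _))//.
  rewrite -(real_normK (num_real (u y - u x))) ler_pXn2r ?nnegrE ?mulr_ge0 ?enorm_ge0//.
rewrite lef_pV2 ?posrE ?mulr_gt0 ?exprn_gt0// expr2.
by apply: ler_pM => //; exact: ltW.
Qed.

Context (beta : R) (V : 'rV[R]_d -> R) (Lg rho : R).
Hypotheses (Lg0 : 0 < Lg) (rho0 : 0 < rho) (beta0 : 0 < beta).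
Hypothesis B : assumptionB beta V Lg rho.

Let g := g_beta beta V.

Lemma C11_g_beta : C11 Lg g (grad g).
Proof. by case: B => b1 b2 b3 b4; apply: C11_of_lipschitz_grad => //; exact: ltW. Qed.

Definition drift_lip : R := beta * (Lg / rho + Lg ^+ 2 / rho ^+ 2).
Definition drift_bound : R := beta * (Lg / rho).

Lemma drift_lip_ge0 : 0 <= drift_lip.
Proof.
rewrite mulr_ge0 ?(ltW beta0)// addr_ge0// divr_ge0 ?sqr_ge0 ?exprn_ge0 ?ltW//.
Qed.

Lemma drift_bound_ge0 : 0 <= drift_bound.
Proof. by rewrite mulr_ge0 ?(ltW beta0)// divr_ge0 ?ltW. Qed.

(** Standard deviation, per coordinate, of the noise [Num.sqrt beta *: (W 1 - W t)] still to come.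
    At [t = 1] it vanishes and [gavg] becomes the identity. *)
Definition noise t : R := Num.sqrt ((1 - t) * beta).

Lemma heat_g_ge c x : rho <= gavg c g x.
Proof. by case: B => *; exact: gavg_ge C11_g_beta _. Qed.

Lemma f_betaE x t : f_beta beta V x t =
  beta *: ((gavg (noise t) g x)^-1 *: gavgV (noise t) (grad g) x).
Proof.
rewrite /f_beta; congr (_ *: _).
(* [heat] and [gavg] agree by computation. The gradient of the logarithm is then read off its
   quadratic expansion, which determines the linear coefficient. *)
change (heat beta (1 - t) (g_beta beta V)) with (gavg (noise t) g).
apply: (@grad_of_expansion _ _ _ _ _ (Lg ^+ 2 / rho ^+ 2 + Lg / rho)).
  by rewrite addr_ge0// divr_ge0 ?exprn_ge0 ?ltW.
move=> y; apply: (ln_expansion x y rho0 (C11_gavg (noise t) C11_g_beta)) => z.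
exact: heat_g_ge.
Qed.

Lemma f_beta_bound x t : enorm (f_beta beta V x t) <= drift_bound.
Proof.
have [_ _ u2 _ _] := C11_gavg (noise t) C11_g_beta.
rewrite f_betaE !enormZ (gtr0_norm beta0) ler_wpM2l ?(ltW beta0)//.
rewrite mulrC; apply: ler_pM; rewrite ?enorm_ge0//.
rewrite gtr0_norm ?invr_gt0 ?lef_pV2 ?posrE ?heat_g_ge//;
  exact: lt_le_trans (heat_g_ge _ _).
Qed.

Lemma f_beta_lip x y t :
  enorm (f_beta beta V x t - f_beta beta V y t) <= drift_lip * enorm (x - y).
Proof.
have [_ _ u2 u3 u4] := C11_gavg (noise t) C11_g_beta.
rewrite !f_betaE -scalerBr enormZ (gtr0_norm beta0) -mulrA ler_wpM2l ?(ltW beta0)//.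
apply: le_trans (quotient_dist _ rho0 (heat_g_ge _ _) (heat_g_ge _ _) (u2 _)) _.
rewrite mulrDl; apply: lerD.
  by rewrite mulrAC ler_wpM2r ?invr_ge0 ?(ltW rho0).
rewrite [leRHS]mulrAC ler_wpM2r ?invr_ge0 ?sqr_ge0// expr2 -mulrA ler_wpM2l ?(ltW Lg0)//.
Qed.

Section monte_carlo.
Context (M : nat).
Hypothesis M0 : (0 < M)%N.
Implicit Types z : 'I_M -> 'rV[R]_d.

Definition mc_mean (c : R) z x : R := M%:R^-1 * \sum_(j < M) g (x + c *: z j).
Definition mc_grad (c : R) z x : 'rV[R]_d :=
  M%:R^-1 *: \sum_(j < M) grad g (x + c *: z j).

Let MR : 0 < M%:R :> R. Proof. by rewrite ltr0n. Qed.

Lemma mc_driftE z x t : mc_drift beta V z x t =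
  beta *: ((mc_mean (noise t) z x)^-1 *: mc_grad (noise t) z x).
Proof. by rewrite /mc_drift /mc_mean /mc_grad !scalerA; congr (_ *: _); ring. Qed.

Lemma mc_mean_ge c z x : rho <= mc_mean c z x.
Proof.
case: B => _ _ _ gr.
rewrite /mc_mean mulrC ler_pdivlMr// mulr_natr -[X in _ *+ X]card_ord -sumr_const.
by apply: ler_sum => j _; exact: gr.
Qed.

Let mc_avg (F : 'I_M -> R) K : (forall j, F j <= K) -> M%:R^-1 * \sum_j F j <= K.
Proof.
move=> FK; rewrite mulrC ler_pdivrMr// mulr_natr -[X in _ *+ X]card_ord -sumr_const.
by apply: ler_sum => j _; exact: FK.
Qed.

Lemma mc_grad_bound c z x : enorm (mc_grad c z x) <= Lg.
Proof.
have [_ _ u2 _ _] := C11_g_beta.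
rewrite enormZ gtr0_norm ?invr_gt0//.
apply: le_trans (_ : M%:R^-1 * \sum_j enorm (grad g (x + c *: z j)) <= _).
  by rewrite ler_wpM2l ?invr_ge0 ?(ltW MR)// enorm_sum.
by apply: mc_avg => j; exact: u2.
Qed.

Let sh x y v : x + v - (y + v) = x - y.
Proof. by rewrite opprD addrACA subrr addr0. Qed.

(** The constant is deterministic: it holds for every realisation [z] of the samples, so
    correlations between the scheme and the reused samples do not affect the stability of the
    scheme. *)
Lemma mc_drift_lip z x y t :
  enorm (mc_drift beta V z x t - mc_drift beta V z y t) <= drift_lip * enorm (x - y).
Proof.
have [_ _ u2 u3 u4] := C11_g_beta; set c := noise t.
rewrite !mc_driftE -scalerBr enormZ (gtr0_norm beta0) -mulrA ler_wpM2l ?(ltW beta0)//.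
apply: le_trans (quotient_dist _ rho0 (mc_mean_ge _ _ _) (mc_mean_ge _ _ _) (mc_grad_bound _ _ _)) _.
rewrite mulrDl; apply: lerD.
  rewrite [leRHS]mulrAC ler_wpM2r ?invr_ge0 ?(ltW rho0)//.
  rewrite -scalerBr -sumrB enormZ gtr0_norm ?invr_gt0//.
  apply: le_trans (_ : M%:R^-1 * \sum_j enorm (grad g (x + c *: z j) - grad g (y + c *: z j)) <= _).
    by rewrite ler_wpM2l ?invr_ge0 ?(ltW MR)// enorm_sum.
  by apply: mc_avg => j; have := u3 (x + c *: z j) (y + c *: z j); rewrite sh.
rewrite [leRHS]mulrAC ler_wpM2r ?invr_ge0 ?sqr_ge0// expr2 -mulrA ler_wpM2l ?(ltW Lg0)//.
rewrite -mulrBr -sumrB normrM gtr0_norm ?invr_gt0//.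
apply: le_trans (_ : M%:R^-1 * \sum_j `|g (x + c *: z j) - g (y + c *: z j)| <= _).
  by rewrite ler_wpM2l ?invr_ge0 ?(ltW MR)// ler_norm_sum.
by apply: mc_avg => j; have := u4 (x + c *: z j) (y + c *: z j); rewrite sh.
Qed.

Lemma mc_drift_bound z x t : enorm (mc_drift beta V z x t) <= drift_bound.
Proof.
rewrite mc_driftE enormZ [enorm (_^-1 *: mc_grad _ _ _)]enormZ (gtr0_norm beta0) ler_wpM2l ?(ltW beta0)//.
rewrite mulrC; apply: ler_pM; rewrite ?enorm_ge0 ?mc_grad_bound//.
rewrite gtr0_norm ?invr_gt0 ?lef_pV2 ?posrE ?mc_mean_ge//;
  exact: lt_le_trans (mc_mean_ge _ _ _).
Qed.

(** The exact numerator is the one that is bounded in [quotient_dist]; what remains are deviations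
    of two empirical means from their expectations, which have small variance. *)
Lemma mc_drift_error z x t :
  enorm (mc_drift beta V z x t - f_beta beta V x t) <=
  beta * (enorm (mc_grad (noise t) z x - gavgV (noise t) (grad g) x) / rho +
          Lg * `|mc_mean (noise t) z x - gavg (noise t) g x| / rho ^+ 2).
Proof.
have [_ _ u2 _ _] := C11_gavg (noise t) C11_g_beta.
rewrite f_betaE mc_driftE -scalerBr enormZ (gtr0_norm beta0) ler_wpM2l ?(ltW beta0)//.
exact: quotient_dist rho0 (mc_mean_ge _ _ _) (heat_g_ge _ _) (u2 _).
Qed.

End monte_carlo.
End drift.

(** * Independence *)

Section bounded_random_variables.
Context {R : realType} {dT : measure_display} {T : measurableType dT}.
Implicit Types X Y : T -> R.

(** An algebra of random variables on which expectation is linear with no further check of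
    integrability. *)
Definition bmeas X : Prop :=
  measurable_fun setT X /\ exists K : R, forall w, `|X w| <= K.

Lemma bmeas_cst (c : R) : bmeas (fun=> c).
Proof. by split; [exact: measurable_cst|exists `|c|]. Qed.

Lemma bmeasD X Y : bmeas X -> bmeas Y -> bmeas (fun w => X w + Y w).
Proof.
move=> [mX [K hK]] [mY [L hL]]; split; first exact: measurable_funD.
by exists (K + L) => w; rewrite (le_trans (ler_normD _ _))// lerD.
Qed.

Lemma bmeasM X Y : bmeas X -> bmeas Y -> bmeas (fun w => X w * Y w).
Proof.
move=> [mX [K hK]] [mY [L hL]]; split; first exact: measurable_funM.
by exists (K * L) => w; rewrite normrM ler_pM.
Qed.

Lemma bmeasZ (c : R) X : bmeas X -> bmeas (fun w => c * X w).
Proof. by move=> bX; apply: bmeasM => //; exact: bmeas_cst. Qed.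

Lemma bmeasB X Y : bmeas X -> bmeas Y -> bmeas (fun w => X w - Y w).
Proof.
move=> [mX [K hK]] [mY [L hL]]; split; first exact: measurable_funB.
by exists (K + L) => w; rewrite (le_trans (ler_normB _ _))// lerD.
Qed.

Lemma bmeas_sum (I : Type) (s : seq I) (X : I -> T -> R) :
  (forall i, bmeas (X i)) -> bmeas (fun w => \sum_(i <- s) X i w).
Proof.
move=> bX; elim: s => [|i s IH].
  by under eq_fun do rewrite big_nil; exact: bmeas_cst.
by under eq_fun do rewrite big_cons; exact: bmeasD.
Qed.

Variable P : probability T R.

Lemma bmeas_integrable X : bmeas X -> P.-integrable setT (EFin \o X).
Proof.
move=> [mX [K hK]].
have iK : P.-integrable setT (EFin \o cst K).
  exact: finite_measure_integrable_cst.
apply: (le_integrable measurableT _ _ iK); first exact/measurable_EFinP.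
by move=> w _; rewrite /= lee_fin (le_trans (hK w))// ler_norm.
Qed.

Definition EP X : R := (\int[P]_w X w)%R.

Lemma EP_cst (c : R) : EP (fun=> c) = c.
Proof. by rewrite /EP /Rintegral integral_cst// [X in (_ * X)%E]probability_setT mule1. Qed.

Lemma EPD X Y : bmeas X -> bmeas Y -> EP (fun w => X w + Y w) = EP X + EP Y.
Proof. by move=> bX bY; rewrite /EP RintegralD//; exact: bmeas_integrable. Qed.

Lemma EPB X Y : bmeas X -> bmeas Y -> EP (fun w => X w - Y w) = EP X - EP Y.
Proof. by move=> bX bY; rewrite /EP RintegralB//; exact: bmeas_integrable. Qed.

Lemma EPZ (c : R) X : bmeas X -> EP (fun w => c * X w) = c * EP X.
Proof. by move=> bX; rewrite /EP RintegralZl//; exact: bmeas_integrable. Qed.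

Lemma EP_sum (I : Type) (s : seq I) (X : I -> T -> R) : (forall i, bmeas (X i)) ->
  EP (fun w => \sum_(i <- s) X i w) = \sum_(i <- s) EP (X i).
Proof.
move=> bX; elim: s => [|i s IH].
  by under eq_fun do rewrite big_nil; rewrite big_nil EP_cst.
under eq_fun do rewrite big_cons.
by rewrite big_cons EPD ?IH//; exact: bmeas_sum.
Qed.

Lemma EP_le X Y : bmeas X -> bmeas Y -> (forall w, X w <= Y w) -> EP X <= EP Y.
Proof. by move=> bX bY XY; apply: le_Rintegral => //; exact: bmeas_integrable. Qed.

Lemma EP_norm_le X (r : R) : bmeas X -> (forall w, `|X w| <= r) -> `|EP X| <= r.
Proof.
move=> bX Xr; rewrite ler_norml; apply/andP; split.
  rewrite -[leLHS]EP_cst; apply: EP_le => //; first exact: bmeas_cst.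
  by move=> w; have := Xr w; rewrite ler_norml => /andP[].
rewrite -[leRHS]EP_cst; apply: EP_le => //; first exact: bmeas_cst.
by move=> w; exact: le_trans (ler_norm _) (Xr w).
Qed.

Lemma EP_EFin X : bmeas X -> (\int[P]_w (X w)%:E)%E = (EP X)%:E.
Proof.
by move=> bX; rewrite /EP /Rintegral fineK//; exact: integrable_fin_num (bmeas_integrable bX).
Qed.

End bounded_random_variables.

Section independence.
Context {R : realType} {dO : measure_display} {Omega : measurableType dO}
  (P : probability Omega R).

Definition indep2 {d1 d2 : measure_display} {T1 : measurableType d1}
    {T2 : measurableType d2} (X : Omega -> T1) (Y : Omega -> T2) : Prop :=
  forall A B, measurable A -> measurable B ->
  P (X @^-1` A `&` Y @^-1` B) = (P (X @^-1` A) * P (Y @^-1` B))%E.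

Section freezing.
Context {d1 d2 : measure_display} {T1 : measurableType d1} {T2 : measurableType d2}.
Variables (X : Omega -> T1) (Y : Omega -> T2).
Hypotheses (mX : measurable_fun setT X) (mY : measurable_fun setT Y).
Hypothesis XY : indep2 X Y.

(** The joint law of independent variables is the product of their laws, so Tonelli's theorem
    applies. This takes the place of conditioning on [X]. *)
Lemma ge0_freezing (F : T1 * T2 -> \bar R) : measurable_fun setT F ->
  (forall p, 0 <= F p)%E ->
  (\int[P]_w F (X w, Y w) = \int[P]_w \int[P]_v F (X w, Y v))%E.
Proof.
move=> mF F0.
pose mx := isMeasurableFun.Build _ _ _ _ _ mX.
pose X' : {mfun Omega >-> T1} := HB.pack X mx.
pose my := isMeasurableFun.Build _ _ _ _ _ mY.
pose Y' : {mfun Omega >-> T2} := HB.pack Y my.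
have mXY : measurable_fun setT (fun w => (X w, Y w)) by exact: measurable_fun_pair.
pose m' := pushforward_measure P mXY.
have E := @product_measure_unique _ _ _ _ _ (distribution P X') (distribution P Y') m'.
transitivity (\int[m']_p F p)%E.
  by rewrite /m' /= ge0_integral_pushforward//.
transitivity (\int[(distribution P X' \x distribution P Y')%E]_p F p)%E.
  apply: eq_measure_integral => A mA _; apply/esym/E => //.
rewrite fubini_tonelli1//.
rewrite ge0_integral_distribution//; first last.
- by move=> x; exact: integral_ge0.
- exact: (measurable_fun_fubini_tonelli_F (m2 := distribution P Y') F).
apply: eq_integral => w _; rewrite /= /fubini_F ge0_integral_distribution//.
by apply: measurableT_comp mF _; exact: pair1_measurable.
Qed.

Lemma bmeas_freezing_inner (F : T1 * T2 -> R) : bmeas F ->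
  bmeas (fun x => EP P (fun v => F (x, Y v))).
Proof.
move=> [mF [K hK]].
have bF x : bmeas (fun v => F (x, Y v)).
  split; last by exists K => v.
  by apply: (measurableT_comp mF); exact: measurable_fun_pair.
split; last by exists K => x; exact: EP_norm_le.
pose my := isMeasurableFun.Build _ _ _ _ _ mY.
pose Y' : {mfun Omega >-> T2} := HB.pack Y my.
(* Adding the bound [K] makes the integrand nonnegative, as Tonelli's theorem requires; it is
   removed at the end. *)
have mFK : measurable_fun setT (fun p => (F p + K)%:E).
  by apply/measurable_EFinP; exact: measurable_funD.
have FK0 p : (0 <= (F p + K)%:E)%E.
  by rewrite lee_fin; have := hK p; rewrite ler_norml => /andP[]; lra.
have := measurable_fun_fubini_tonelli_F (m2 := distribution P Y') _ mFK FK0.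
rewrite (_ : fubini_F _ _ = (fun x => (EP P (fun v => F (x, Y v)) + K)%:E)).
  move=> /measurable_EFinP m.
  have := measurable_funB m (measurable_cst K).
  by apply: eq_measurable_fun => x _ /=; rewrite addrK.
apply/funext => x; rewrite /fubini_F ge0_integral_distribution//; last first.
  by apply: (measurableT_comp mFK); exact: pair1_measurable.
rewrite /= (EP_EFin P (bmeasD (bF x) (bmeas_cst K))).
by rewrite EPD ?EP_cst//; exact: bmeas_cst.
Qed.

Lemma freezing (F : T1 * T2 -> R) : bmeas F ->
  EP P (fun w => F (X w, Y w)) = EP P (fun w => EP P (fun v => F (X w, Y v))).
Proof.
move=> bF; have [mF [K hK]] := bF.
have mFK : measurable_fun setT (fun p => (F p + K)%:E).
  by apply/measurable_EFinP; exact: measurable_funD.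
have FK0 p : (0 <= (F p + K)%:E)%E.
  by rewrite lee_fin; have := hK p; rewrite ler_norml => /andP[]; lra.
have bF1 : bmeas (fun w => F (X w, Y w)).
  split; last by exists K.
  by apply: (measurableT_comp mF); exact: measurable_fun_pair.
have bF2 x : bmeas (fun v => F (x, Y v)).
  split; last by exists K => v.
  by apply: (measurableT_comp mF); exact: measurable_fun_pair.
have bF3 : bmeas (fun w => EP P (fun v => F (X w, Y v))).
  have [mi [L hL]] := bmeas_freezing_inner bF.
  by split; [exact: (measurableT_comp mi mX)|exists L => w].
have := ge0_freezing mFK FK0.
under [X in _ = X -> _]eq_integral => w _.
  rewrite (EP_EFin P (bmeasD (bF2 (X w)) (bmeas_cst K))).
  rewrite EPD ?EP_cst//; last exact: bmeas_cst.
  over.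
rewrite !EP_EFin; [|exact: bmeasD (bmeas_cst K)|exact: bmeasD (bmeas_cst K)].
rewrite !EPD//; [|exact: bmeas_cst|exact: bmeas_cst].
by move=> [] /addIr.
Qed.

End freezing.

(** The finite measures [A |-> P (A & B)] and [A |-> P B * P A] agree on the pi-system [G], hence on
    the sigma-algebra it generates. *)
Lemma indep_sigma (G : set (set Omega)) (B : set Omega) : G `<=` measurable ->
  setI_closed G -> G setT -> measurable B ->
  (forall A, G A -> P (A `&` B) = (P A * P B)%E) ->
  forall A, <<s G >> A -> P (A `&` B) = (P A * P B)%E.
Proof.
move=> Gm GI GT mB GB A sA.
have PB : P B = (fine (P B))%:E by rewrite fineK// fin_num_measure.
pose m1 : {measure set Omega -> \bar R} := mrestr P mB.
have pB0 : 0 <= fine (P B) by rewrite fine_ge0.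
pose m2 : {measure set Omega -> \bar R} := mscale (NngNum pB0) P.
have cov : \bigcup_(k in [set: nat]) (fun=> [set: Omega]) k = setT.
  by apply/seteqP; split => // w _; exists 0%N.
have m12 C : G C -> m1 C = m2 C.
  move=> GC; rewrite [LHS]GB// muleC.
  by rewrite [X in (X * _)%E]PB.
have m1f (k : nat) : (m1 [set: Omega] < +oo)%E.
  by rewrite /m1/= /mrestr setTI PB ltry.
have E : m1 A = m2 A.
  exact: (@g_sigma_algebra_measure_unique _ _ _ G Gm (fun=> setT) (fun=> GT) cov m1 m2 GI m12 m1f A sA).
by rewrite muleC PB; exact: E.
Qed.

End independence.

(** * Adaptedness to a finite sequence of independent variables *)

Section past.
Context {R : realType} {dO : measure_display} {Omega : measurableType dO}
  (P : probability Omega R) {d : nat} (X : nat -> Omega -> borel_rV R d).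

(** The pi-system of rectangles in the first [k] variables, on which mutual independence can be
    applied directly. *)
Definition past (k : nat) : set (set Omega) :=
  [set E | exists A : nat -> set (borel_rV R d), (forall i, measurable (A i)) /\
     E = \bigcap_(i in [set i | (i < k)%N]) (X i @^-1` A i)].

(** [Omega] with the coarser sigma-algebra of the first [k] variables: a map is adapted when it is
    measurable from [pastT k], so the usual measurability lemmas prove adaptedness. *)
Definition pastT (k : nat) := g_sigma_algebraType (past k).

Lemma measurable_past k i : (i < k)%N -> measurable_fun setT (X i : pastT k -> borel_rV R d).
Proof.
move=> ik _ A mA; rewrite setTI; apply: sub_sigma_algebra.
exists (fun j => if j == i then A else setT); split.
  by move=> j; case: ifP.
apply/seteqP; split => w /= h; last by have := h i ik; rewrite /= eqxx.
by move=> j _ /=; case: eqP => // ->.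
Qed.

Variable n : nat.
Hypothesis mX : forall i, (i < n)%N -> measurable_fun setT (X i).
Hypothesis Xind : mutually_independent P (fun i : 'I_n => X i).

Lemma past_sub_measurable k : (k <= n)%N -> past k `<=` measurable.
Proof.
move=> kn E [A [mA ->]]; apply: bigcap_measurableType => i /= ik.
rewrite -[X in measurable X]setTI; apply: mX => //; exact: leq_trans kn.
Qed.

Lemma measurable_of_past dT (T : measurableType dT) k (S : Omega -> T) : (k <= n)%N ->
  measurable_fun setT (S : pastT k -> T) -> measurable_fun setT S.
Proof.
move=> kn mS _ A mA.
have : <<s past k >> (setT `&` S @^-1` A) by exact: (mS measurableT A mA).
apply: smallest_sub; first exact: sigma_algebra_measurable.
exact: past_sub_measurable.
Qed.

Lemma indep_past dT (T : measurableType dT) k (S : Omega -> T) : (k < n)%N ->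
  measurable_fun setT (S : pastT k -> T) -> indep2 P S (X k).
Proof.
move=> kn mS B C mB mC.
have sSB : <<s past k >> (S @^-1` B).
  by rewrite -[X in <<s _ >> X]setTI; exact: (mS measurableT B mB).
apply: (indep_sigma (past_sub_measurable (ltnW kn))) sSB.
- move=> _ _ [A [mA ->]] [A' [mA' ->]].
  exists (fun i => A i `&` A' i); split; first by move=> i; exact: measurableI.
  by rewrite -bigcapI; apply: eq_bigcapr => i _; rewrite preimage_setI.
- exists (fun=> setT); split => //.
  by apply/seteqP; split => // w _ i _.
- by rewrite -[X in measurable X]setTI; apply: mX.
- move=> E [A [mA ->]].
  pose kk := Ordinal kn.
  pose A' (i : 'I_n) := if i == kk then C else A i.
  have mA' i : measurable (A' i) by rewrite /A'; case: ifP.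
  (* Mutual independence is used for the indices up to [k] and for those below [k]; the first
     product is the second times the factor of index [k]. *)
  have h1 := Xind [set i : 'I_n | (i <= k)%N]%SET mA'.
  have h2 := Xind [set i : 'I_n | (i < k)%N]%SET (fun i => mA i).
  have e1 : \bigcap_(i in [set i | (i < k)%N]) (X i @^-1` A i) =
     \bigcap_(i in [set` [set i : 'I_n | (i < k)%N]%SET]) (X i @^-1` A i).
    apply/seteqP; split => w h.
      by move=> i /=; rewrite inE => ik; apply: h.
    by move=> i /= ik; apply: (h (Ordinal (ltn_trans ik kn))); rewrite /= inE.
  have e2 : \bigcap_(i in [set i | (i < k)%N]) (X i @^-1` A i) `&` X k @^-1` C =
     \bigcap_(i in [set` [set i : 'I_n | (i <= k)%N]%SET]) (X i @^-1` A' i).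
    apply/seteqP; split => w.
      move=> [h hk] i /=; rewrite inE leq_eqVlt /A' => /orP[/eqP ik|ik].
        by rewrite (_ : i = kk) ?eqxx//; apply: val_inj.
      rewrite (_ : (i == kk) = false); first exact: h.
      by apply/negbTE; rewrite neq_ltn; apply/orP; left.
    move=> h; split; last by have := h kk; rewrite /= inE leqnn /A' eqxx; exact.
    move=> i /= ik; have := h (Ordinal (ltn_trans ik kn)); rewrite /= inE ltnW// => /(_ isT).
    rewrite /A' (_ : (_ == kk) = false)//.
    by apply/negbTE; rewrite neq_ltn; apply/orP; left.
  rewrite e2 e1 h1 h2 (bigD1 kk)/=; last by rewrite inE.
  rewrite [RHS]muleC; congr (_ * _)%E; first by rewrite /A' eqxx.
  apply: eq_big => i; first by rewrite !inE [RHS]ltn_neqAle andbC.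
  by move=> /andP[_ ik]; rewrite /A' (negbTE ik).
Qed.

End past.

(** No integrability is assumed: both integrals are the same difference of the integrals of the
    positive and negative parts. *)
Lemma eq_integral_of_ge0 {R : realType} {d1 d2 d3 : measure_display}
    {T1 : measurableType d1} {T2 : measurableType d2} {T3 : measurableType d3}
    (m1 : {measure set T1 -> \bar R}) (m2 : {measure set T2 -> \bar R})
    (Y : T1 -> T3) (Z : T2 -> T3) :
  (forall G : T3 -> \bar R, measurable_fun setT G -> (forall x, 0 <= G x)%E ->
    (\int[m1]_w G (Y w) = \int[m2]_w G (Z w))%E) ->
  forall F : T3 -> \bar R, measurable_fun setT F ->
    (\int[m1]_w F (Y w) = \int[m2]_w F (Z w))%E.
Proof.
move=> H F mF.
have E1 := H _ (measurable_funepos mF) (funepos_ge0 F).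
have E2 := H _ (measurable_funeneg mF) (funeneg_ge0 F).
rewrite (integralE m1) (integralE m2).
rewrite (_ : (fun w => F (Y w)) = F \o Y)// (_ : (fun w => F (Z w)) = F \o Z)//.
by rewrite (funepos_comp F Y) (funeneg_comp F Y) (funepos_comp F Z) (funeneg_comp F Z) E1 E2.
Qed.

Section gaussian_law.
Context {R : realType} {dO : measure_display} {Omega : measurableType dO}
  (P : probability Omega R) {d : nat}.

Lemma law_ge0 (Y : Omega -> borel_rV R d) (s : R) (F : borel_rV R d -> \bar R) :
  measurable_fun setT Y -> 0 < s -> has_law P Y (@gauss_rV R d s) ->
  measurable_fun setT F -> (forall x, 0 <= F x)%E ->
  (\int[P]_w F (Y w) = \int[@gauss_rV R d 1]_z F (Num.sqrt s *: (z : 'rV[R]_d)))%E.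
Proof.
move=> mY s0 YL mF F0.
have ss : Num.sqrt s != 0 by rewrite gt_eqF// sqrtr_gt0.
rewrite (gauss_rV_scale ss (b := 1))// sqr_sqrtr ?(ltW s0)// mulr1.
transitivity (\int[pushforward P Y]_y F y)%E; first by rewrite ge0_integral_pushforward.
by apply: (@eq_measure_integral _ _ _ _ (@gauss_rV R d s) (pushforward_measure P mY)) => A mA _; exact: YL.
Qed.

Lemma law_gE (Y : Omega -> borel_rV R d) (s : R) (F : 'rV[R]_d -> R) :
  measurable_fun setT Y -> 0 < s -> has_law P Y (@gauss_rV R d s) ->
  measurable_fun [set: borel_rV R d] F ->
  EP P (fun w => F (Y w)) = gE (fun z => F (Num.sqrt s *: z)).
Proof.
move=> mY s0 YL mF; rewrite /EP /gE /Rintegral; congr fine.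
have mF' : measurable_fun [set: borel_rV R d] (EFin \o F) by exact/measurable_EFinP.
apply: (eq_integral_of_ge0 (m1 := P) (m2 := @gauss_rV R d 1) (Y := Y)
  (Z := fun z : borel_rV R d => Num.sqrt s *: (z : 'rV[R]_d) : borel_rV R d) _ mF').
by move=> G mG G0; exact: law_ge0.
Qed.

End gaussian_law.

(** * Strong convergence of the Euler scheme *)

Section euler.
Context {R : realType} {d : nat}.

Fixpoint euler (beta : R) (b : 'rV[R]_d -> R -> 'rV[R]_d) (N : nat)
    (w : R -> 'rV[R]_d) (n : nat) : 'rV[R]_d :=
  match n with
  | 0%N => 0
  | k.+1 =>
      let y := euler beta b N w k in
      y + N%:R^-1 *: b y (k%:R / N%:R)
        + Num.sqrt beta *: (w (k.+1%:R / N%:R) - w (k%:R / N%:R))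
  end.

End euler.

Section brownian.
Context {R : realType} {dO : measure_display} {Omega : measurableType dO}
  (P : probability Omega R) {d : nat} (W : R -> Omega -> borel_rV R d).
Hypothesis BW : brownian_motion P W.

Definition inc (N i : nat) : Omega -> borel_rV R d :=
  increment W (i%:R / N%:R) (i.+1%:R / N%:R).

Let frac01 N i : (0 < N)%N -> (i <= N)%N -> 0 <= (i%:R / N%:R : R) <= 1.
Proof.
by move=> N0 iN; rewrite divr_ge0// ler_pdivrMr ?ltr0n// mul1r ler_nat iN.
Qed.

Lemma measurable_increment s t : 0 <= s <= 1 -> 0 <= t <= 1 ->
  measurable_fun setT (increment W s t).
Proof.
case: BW => mW _ _ _ _ s01 t01.
by apply: measurable_subV; exact: mW.
Qed.

Lemma measurable_inc N i : (0 < N)%N -> (i < N)%N -> measurable_fun setT (inc N i).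
Proof. by move=> N0 iN; apply: measurable_increment; apply: frac01 => //; exact: ltnW. Qed.

Lemma inc_law N i : (0 < N)%N -> (i < N)%N -> has_law P (inc N i) (@gauss_rV R d N%:R^-1).
Proof.
case: BW => _ _ lW _ _ N0 iN; have N0' : 0 < N%:R :> R by rewrite ltr0n.
have := lW (i%:R / N%:R) (i.+1%:R / N%:R).
have -> : i.+1%:R / N%:R - i%:R / N%:R = N%:R^-1 :> R.
  by rewrite -mulrBl -natrB// subSnn mul1r.
have /andP[-> _] := frac01 N0 (ltnW iN); have /andP[_ ->] := frac01 N0 iN.
by rewrite ltr_pM2r ?invr_gt0// ltr_nat leqnn; apply.
Qed.

Lemma inc_indep N : (0 < N)%N -> mutually_independent P (fun i : 'I_N => inc N i).
Proof.
case: BW => _ _ _ iW _ N0; apply: (iW N (fun i => i%:R / N%:R)).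
- by rewrite mul0r.
- by rewrite divff// pnatr_eq0 -lt0n.
- by move=> i _; rewrite ler_pM2r ?invr_gt0 ?ltr0n// ler_nat.
Qed.

Lemma inc_double N i w : (0 < N)%N ->
  inc N i w = (inc N.*2 i.*2 w : 'rV[R]_d) + inc N.*2 i.*2.+1 w :> 'rV[R]_d.
Proof.
move=> N0; have E j : j.*2%:R / N.*2%:R = j%:R / N%:R :> R.
  by rewrite -!muln2 !natrM -mulf_div divff ?mulr1// pnatr_eq0.
by rewrite /inc /increment -doubleS !E [RHS]addrC subrKA.
Qed.

(** Stated for an arbitrary source [T], so that one proof covers measurability for the full
    sigma-algebra, for the past of either grid, and for the sigma-algebra generated by [W]. *)
Lemma measurable_euler dT (T : measurableType dT) beta (b : 'rV[R]_d -> R -> 'rV[R]_d)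
    (N n : nat) (X : nat -> T -> borel_rV R d) (w : T -> R -> 'rV[R]_d) :
  (forall t, measurable_fun setT (b^~ t : borel_rV R d -> borel_rV R d)) ->
  (forall i t, (i < n)%N -> X i t = w t (i.+1%:R / N%:R) - w t (i%:R / N%:R)) ->
  (forall i, (i < n)%N -> measurable_fun setT (X i)) ->
  measurable_fun setT (fun t => euler beta b N (w t) n : borel_rV R d).
Proof.
move=> mb; elim: n => [|n IH] XE mX; first exact: measurable_cst.
have {}IH : measurable_fun setT (fun t => euler beta b N (w t) n : borel_rV R d).
  by apply: IH => [i t ni|i ni]; [apply: XE|apply: mX]; exact: ltnW.
apply: measurable_addV.
  apply: measurable_addV => //; apply: measurable_scaleV => //.
  exact: measurableT_comp (mb _) IH.
apply: measurable_scaleV; first exact: measurable_cst.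
by apply: eq_measurable_fun (mX n (leqnn _)) => t _; rewrite XE.
Qed.

Lemma euler_past beta (b : 'rV[R]_d -> R -> 'rV[R]_d) N n k :
  (forall t, measurable_fun setT (b^~ t : borel_rV R d -> borel_rV R d)) ->
  (n <= k)%N ->
  measurable_fun setT
    ((fun w => euler beta b N (W^~ w) n) : pastT (inc N) k -> borel_rV R d).
Proof.
move=> mb nk; apply: (@measurable_euler _ (pastT (inc N) k) beta b N n (inc N)) => //.
by move=> i ni; apply: measurable_past; exact: leq_trans nk.
Qed.

(** Each coarse increment is the sum of two fine ones, hence the coarse scheme is adapted to the
    fine grid too. *)
Lemma euler_past_double beta (b : 'rV[R]_d -> R -> 'rV[R]_d) N n k : (0 < N)%N ->
  (forall t, measurable_fun setT (b^~ t : borel_rV R d -> borel_rV R d)) ->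
  (n.*2 <= k)%N ->
  measurable_fun setT
    ((fun w => euler beta b N (W^~ w) n) : pastT (inc N.*2) k -> borel_rV R d).
Proof.
move=> N0 mb nk; apply: (@measurable_euler _ (pastT (inc N.*2) k) beta b N n (inc N)) => //.
move=> i ni; have h : (i.*2.+1 < k)%N.
  by apply: leq_trans nk; rewrite -doubleS leq_double.
have -> : inc N i = (fun w => (inc N.*2 i.*2 w : 'rV[R]_d) + inc N.*2 i.*2.+1 w).
  by apply/funext => w; exact: inc_double.
apply: (@measurable_addV R d _ (pastT (inc N.*2) k)); apply: measurable_past => //.
exact: ltnW.
Qed.

Lemma measurable_euler_W beta (b : 'rV[R]_d -> R -> 'rV[R]_d) N n : (0 < N)%N -> (n <= N)%N ->
  (forall t, measurable_fun setT (b^~ t : borel_rV R d -> borel_rV R d)) ->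
  measurable_fun setT (fun w => euler beta b N (W^~ w) n : borel_rV R d).
Proof.
move=> N0 nN mb; apply: (@measurable_euler _ Omega beta b N n (inc N)) => //.
by move=> i ni; apply: measurable_inc => //; exact: leq_trans nN.
Qed.

End brownian.

(** The rates vary with [k] because the weights [tau] are not of the order of the step near time 1;
    only their sum is controlled. *)
Lemma gronwall {R : realType} (x a c : nat -> R) (n : nat) : x 0%N <= 0 ->
  (forall k, (k < n)%N -> 0 <= a k) -> (forall k, (k < n)%N -> 0 <= c k) ->
  (forall k, (k < n)%N -> x k.+1 <= expR (a k) * x k + c k) ->
  x n <= expR (\sum_(k < n) a k) * \sum_(k < n) c k.
Proof.
move=> x0 a0 c0 xS; elim: n a0 c0 xS => [|n IH] a0 c0 xS.
  by rewrite !big_ord0 mulr0.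
have {}IH : x n <= expR (\sum_(k < n) a k) * \sum_(k < n) c k.
  by apply: IH => k kn; [apply: a0|apply: c0|apply: xS]; exact: ltnW.
apply: le_trans (xS n (leqnn _)) _; rewrite !big_ord_recr/= expRD.
have h1 := ler_wpM2l (expR_ge0 (a n)) IH.
have s0 : 0 <= \sum_(k < n) a k by apply: sumr_ge0 => k _; apply: a0; apply: leq_trans (ltn_ord k) _.
have h2 : 1 <= expR (\sum_(k < n) a k) * expR (a n).
  by rewrite -expRD -expR0 ler_expR addr_ge0 ?a0.
have h3 := ler_wpM2r (c0 n (leqnn _)) h2.
lra.
Qed.

Lemma enorm_sqrD {R : realType} {d : nat} (x y : 'rV[R]_d) :
  enorm (x + y) ^+ 2 = enorm x ^+ 2 + 2 * dot x y + enorm y ^+ 2.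
Proof. by rewrite !enorm_sqr dotDl !dotDr (dotC y x); ring. Qed.

(** * Effect of halving the step, for a general drift *)

Section drift_hypotheses.
Context {R : realType} {d : nat}.
Hypothesis d0 : (0 < d)%N.
Variables (beta : R) (b : 'rV[R]_d -> R -> 'rV[R]_d) (B L K kap : R).
Hypotheses (beta0 : 0 < beta) (B0 : 0 <= B) (L0 : 0 <= L) (K0 : 0 <= K) (kap0 : 0 <= kap).
Hypothesis bB : forall x t, enorm (b x t) <= B.
Hypothesis bL : forall x y t, enorm (b x t - b y t) <= L * enorm (x - y).
Hypothesis bK : forall t, 0 <= t <= 1 -> forall w x, exists q, forall v,
  `|dot w (b (x + v) t) - dot w (b x t) - dot q v| <= enorm w * K * enorm v ^+ 2.
Hypothesis bT : forall x t t', 0 <= t -> t < t' -> t' < 1 ->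
  enorm (b x t' - b x t) <= kap * Num.sqrt d%:R * (t' - t) / Num.sqrt (1 - t').

Let dR : 1 <= d%:R :> R. Proof. by rewrite ler1n. Qed.

Lemma measurable_drift t : measurable_fun setT (b^~ t : borel_rV R d -> borel_rV R d).
Proof.
apply: continuous_measurable_vec; apply: (@lipschitz_continuous_vec _ _ _ L) => x y.
exact: bL.
Qed.

(* With [x] Gaussian of covariance [s], [disp] is centred up to [O(s d)] (the
   term linear in [x] has mean zero) and [O(sqrt (s d))] in root mean
   square; this is why the scheme with additive noise is strongly of order one. *)
Let disp (s t : R) (y x : 'rV[R]_d) : 'rV[R]_d :=
  b (y + s *: b y t + Num.sqrt beta *: x) t - b y t.

(** Bound on the bias of [disp]. The first term is the displacement by the drift; the second is the
    curvature bound [K] times the mean square [beta * s * d] of the noise. *)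
Let rhoc (s : R) : R := L * s * B + K * beta * s * d%:R.

Let disp_le s t y x : 0 <= s ->
  enorm (disp s t y x) <= L * (s * B + Num.sqrt beta * enorm x).
Proof.
move=> s0; apply: le_trans (bL _ _ _) _; rewrite ler_wpM2l//.
have -> : y + s *: b y t + Num.sqrt beta *: x - y = s *: b y t + Num.sqrt beta *: x.
  by apply/rowP => i; rewrite !mxE; ring.
apply: le_trans (enormD _ _) _.
by rewrite !enormZ (ger0_norm s0) (ger0_norm (sqrtr_ge0 _)) lerD2r ler_wpM2l.
Qed.

Let measurable_disp s t y : measurable_fun [set: borel_rV R d] (disp s t y : borel_rV R d -> borel_rV R d).
Proof.
apply: measurable_subV; last exact: measurable_cst.
apply: (measurableT_comp (measurable_drift t)); apply: measurable_addV.
  exact: measurable_cst.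
by apply: measurable_scaleV; [exact: measurable_cst|exact: measurable_id].
Qed.

(** The expansion is made at the noise-free position [u], so that the noise is the whole increment
    and its linear contribution averages to zero. *)
Let gE_disp s t y a : 0 <= s -> 0 <= t <= 1 ->
  gint (fun z => dot a (disp s t y (Num.sqrt s *: z))) /\
  gE (fun z => dot a (disp s t y (Num.sqrt s *: z))) <= enorm a * rhoc s.
Proof.
move=> s0 t01.
set u := y + s *: b y t; have [q qP] := bK t01 a u.
pose c := Num.sqrt beta * Num.sqrt s.
have c2 : c ^+ 2 = beta * s by rewrite exprMn !sqr_sqrtr// ltW.
have m : measurable_fun [set: borel_rV R d]
    (fun z : borel_rV R d => dot a (disp s t y (Num.sqrt s *: (z : 'rV[R]_d)))).
  apply: measurable_dot; first exact: measurable_cst.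
  apply: (measurableT_comp (measurable_disp s t y)).
  by apply: measurable_scaleV; [exact: measurable_cst|exact: measurable_id].
have Dq z : `|dot a (disp s t y (Num.sqrt s *: z)) - c * dot q z| <=
    enorm a * (L * s * B) + enorm a * (K * beta * s) * enorm z ^+ 2.
  have -> : dot a (disp s t y (Num.sqrt s *: z)) - c * dot q z =
      dot a (b u t - b y t) +
      (dot a (b (u + c *: z) t) - dot a (b u t) - dot q (c *: z)).
    by rewrite /disp -/u scalerA -/c !dotBr dotZr; ring.
  apply: le_trans (ler_normD _ _) _; apply: lerD.
    apply: le_trans (normr_dot_le _ _) _; rewrite ler_wpM2l ?enorm_ge0//.
    apply: le_trans (bL _ _ _) _; rewrite /u addrC addKr enormZ (ger0_norm s0).
    by rewrite -mulrA ler_wpM2l// ler_wpM2l.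
  apply: le_trans (qP _) _; rewrite enormZ exprMn (real_normK (num_real c)) c2.
  by move: (enorm a) (enorm z) => A Z; lra.
have iq := gint_dot q; have i2 := @gint_enorm2 R d.
have i3 := gintZ (enorm a * (K * beta * s)) i2.
have icst := @gint_cst R d (enorm a * (L * s * B)).
have ib := gintD icst i3.
have iD : gint (fun z => dot a (disp s t y (Num.sqrt s *: z)) - c * dot q z).
  apply: (@gint_growth _ _ _ (enorm a * (L * s * B) + enorm a * (K * beta * s))).
    apply: measurable_funB => //; apply: measurable_funM => //.
    by apply: measurable_dot; [exact: measurable_cst|exact: measurable_id].
  move=> z; apply: le_trans (Dq z) _; rewrite mulrDl lerD//.
    rewrite ler_peMr ?mulr_ge0 ?enorm_ge0//.
    by rewrite exprn_ege1// lerDl enorm_ge0.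
  by rewrite ler_wpM2l ?mulr_ge0 ?enorm_ge0 ?(ltW beta0)// enorm_pow3.
have iDD : gint (fun z => dot a (disp s t y (Num.sqrt s *: z))).
  have := gintD iD (gintZ c iq).
  by under [X in gint X -> _]eq_fun do rewrite subrK.
split => //.
have -> : gE (fun z => dot a (disp s t y (Num.sqrt s *: z))) =
    gE (fun z => dot a (disp s t y (Num.sqrt s *: z)) - c * dot q z).
  by rewrite gEB ?gEZ ?gE_dot ?mulr0 ?subr0//; exact: gintZ.
apply: (@le_trans _ _ (gE (fun z => enorm a * (L * s * B) + enorm a * (K * beta * s) * enorm z ^+ 2))).
  by apply: gE_le => // z; exact: le_trans (ler_norm _) (Dq z).
by rewrite gED// gE_cst gEZ// gE_enorm2 /rhoc; lra.
Qed.

Let gE_disp2 s t y : 0 <= s ->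
  gint (fun z => enorm (disp s t y (Num.sqrt s *: z)) ^+ 2) /\
  gE (fun z => enorm (disp s t y (Num.sqrt s *: z)) ^+ 2) <=
  L ^+ 2 * (2 * s ^+ 2 * B ^+ 2 + 2 * beta * s * d%:R).
Proof.
move=> s0; pose c1 := L ^+ 2 * (2 * s ^+ 2 * B ^+ 2); pose c2 := L ^+ 2 * (2 * beta * s).
have c10 : 0 <= c1 by rewrite !mulr_ge0 ?sqr_ge0.
have c20 : 0 <= c2 by rewrite !mulr_ge0 ?sqr_ge0// ltW.
have m : measurable_fun [set: borel_rV R d]
    (fun z : borel_rV R d => enorm (disp s t y (Num.sqrt s *: (z : 'rV[R]_d))) ^+ 2).
  apply: measurable_funX; apply: measurable_enorm.
  apply: (measurableT_comp (measurable_disp s t y)).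
  by apply: measurable_scaleV; [exact: measurable_cst|exact: measurable_id].
have D z : enorm (disp s t y (Num.sqrt s *: z)) ^+ 2 <= c1 + c2 * enorm z ^+ 2.
  have := disp_le t y (Num.sqrt s *: z) s0; rewrite enormZ (ger0_norm (sqrtr_ge0 s)) => h.
  have : enorm (disp s t y (Num.sqrt s *: z)) ^+ 2 <=
      (L * (s * B + Num.sqrt beta * (Num.sqrt s * enorm z))) ^+ 2.
    by rewrite ler_pXn2r ?nnegrE ?enorm_ge0// (le_trans (enorm_ge0 _) h).
  move=> /le_trans; apply.
  have e1 : (Num.sqrt beta * (Num.sqrt s * enorm z)) ^+ 2 = beta * s * enorm z ^+ 2.
    by rewrite !exprMn (sqr_sqrtr (ltW beta0)) (sqr_sqrtr s0) mulrA.
  move: e1; move: (Num.sqrt beta * _) => v e1.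
  have h2 : (s * B + v) ^+ 2 <= 2 * (s * B) ^+ 2 + 2 * v ^+ 2.
    by have := sqr_ge0 (s * B - v); lra.
  rewrite exprMn; apply: le_trans (ler_wpM2l (sqr_ge0 L) h2) _.
  by rewrite e1 /c1 /c2; lra.
have ib := gintD (@gint_cst R d c1) (gintZ c2 (@gint_enorm2 R d)).
have iD : gint (fun z => enorm (disp s t y (Num.sqrt s *: z)) ^+ 2).
  apply: (@gint_growth _ _ _ (c1 + c2)) => // z.
  rewrite ger0_norm ?sqr_ge0//; apply: le_trans (D z) _; rewrite mulrDl lerD//.
    by rewrite ler_peMr// exprn_ege1// lerDl enorm_ge0.
  by rewrite ler_wpM2l// enorm_pow3.
split => //; apply: le_trans (gE_le iD ib D) _.
rewrite gED ?gE_cst ?gEZ ?gE_enorm2; [by rewrite /c1 /c2; lra|exact: gint_enorm2|exact: gint_cst|].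
by apply: gintZ; exact: gint_enorm2.
Qed.

(** Only the bias of [disp] meets [a] in the cross term: [2 s |a| rhoc <= s |a|^2 + s rhoc^2]. The
    fluctuation, of mean square [O (s d)], carries the factor [s^2]. Both contributions are
    [O (s^3 d^2)], so summed over the grid they leave [O (s^2 d^2)]. *)
Let inner_bound s t y a : 0 <= s -> 0 <= t <= 1 ->
  gE (fun z => enorm (a + s *: disp s t y (Num.sqrt s *: z)) ^+ 2) <=
  (1 + s) * enorm a ^+ 2 + s * rhoc s ^+ 2 +
  s ^+ 2 * (L ^+ 2 * (2 * s ^+ 2 * B ^+ 2 + 2 * beta * s * d%:R)).
Proof.
move=> s0 t01.
have [i1 h1] := gE_disp y a s0 t01; have [i2 h2] := gE_disp2 t y s0.
rewrite (_ : (fun z => _) = (fun z => (enorm a ^+ 2 + (2 * s) * dot a (disp s t y (Num.sqrt s *: z)))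
   + s ^+ 2 * enorm (disp s t y (Num.sqrt s *: z)) ^+ 2)); last first.
  apply/funext => z; rewrite enorm_sqrD dotZr enormZ exprMn (real_normK (num_real s)).
  by move: (dot _ _) (enorm (disp _ _ _ _)) (enorm a) => p q u; ring.
have ia := @gint_cst R d (enorm a ^+ 2).
have i3 := gintZ (2 * s) i1; have i4 := gintD ia i3; have i5 := gintZ (s ^+ 2) i2.
rewrite (gED i4 i5) (gED ia i3) (gEZ _ i1) (gEZ _ i2) gE_cst.
have := ler_wpM2l (sqr_ge0 s) h2; have s20 : 0 <= 2 * s by lra.
have := ler_wpM2l s20 h1.
have : 0 <= s * (enorm a - rhoc s) ^+ 2 by rewrite mulr_ge0 ?sqr_ge0.
move: (gE _) (gE _) => g1 g2; lra.
Qed.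

Section doubling.
Context {dO : measure_display} {Omega : measurableType dO}
  (P : probability Omega R) (W : R -> Omega -> borel_rV R d).
Hypothesis BW : brownian_motion P W.
Variable N : nat.
Hypothesis N0 : (0 < N)%N.

Let s : R := N.*2%:R^-1.
Let time n : R := n%:R / N%:R.
Let y n w : 'rV[R]_d := euler beta b N.*2 (W^~ w) n.*2.
Let Y n w : 'rV[R]_d := euler beta b N (W^~ w) n.
Let X n w : 'rV[R]_d := inc W N.*2 n.*2 w.
(** One coarse step of the difference splits into three parts: [a], known at its start; the change
    [disp] of the drift over the first half step, due to the motion in space; and [r], the change of
    the drift in time at the fine midpoint [ymid]. *)
Let a n w : 'rV[R]_d := (y n w - Y n w) + (2 * s) *: (b (y n w) (time n) - b (Y n w) (time n)).
Let ymid n w : 'rV[R]_d := y n w + s *: b (y n w) (time n) + Num.sqrt beta *: X n w.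
Let r n w : 'rV[R]_d := s *: (b (ymid n w) (time n + s) - b (ymid n w) (time n)).
(* The time derivative of the drift blows up like [(1 - t)^(-1/2)], hence the
   weights [tau], which telescope. *)
Let tau n : R := Num.sqrt (1 - time n) - Num.sqrt (1 - time n.+1).

Let NR : 0 < N%:R :> R. Proof. by rewrite ltr0n. Qed.
Let s0 : 0 < s. Proof. by rewrite invr_gt0 ltr0n double_gt0. Qed.
Let s2 : 2 * s = N%:R^-1.
Proof. by rewrite /s -muln2 natrM; field; rewrite gt_eqF. Qed.
Let s1 : s <= 1.
Proof. by rewrite invf_le1 ?ltr0n ?ler1n double_gt0. Qed.

Let timeS n : time n.+1 = time n + 2 * s.
Proof. by rewrite /time -natr1 mulrDl mul1r s2. Qed.

Let time_double n : n.*2%:R / N.*2%:R = time n.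
Proof. by rewrite /time -!muln2 !natrM -mulf_div divff ?mulr1// pnatr_eq0. Qed.

Let time_odd n : n.*2.+1%:R / N.*2%:R = time n + s.
Proof. by rewrite -natr1 mulrDl mul1r time_double. Qed.

Let time01 n : (n <= N)%N -> 0 <= time n <= 1.
Proof. by move=> nN; rewrite divr_ge0 ?ler0n//= ler_pdivrMr// mul1r ler_nat. Qed.

Let stepE n w : y n.+1 w - Y n.+1 w = a n w + s *: disp s (time n) (y n w) (X n w) + r n w.
Proof.
have YE : Y n.+1 w = Y n w + (2 * s) *: b (Y n w) (time n) +
    Num.sqrt beta *: (X n w + (W (time n.+1) w - W (time n + s) w)).
  rewrite /Y /= s2 -/(Y n w) -/(time n) -/(time n.+1); congr (_ + _ *: _).
  by rewrite /X /inc /increment time_double time_odd [RHS]addrC subrKA.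
have yE : y n.+1 w = ymid n w + s *: b (ymid n w) (time n + s) +
    Num.sqrt beta *: (W (time n.+1) w - W (time n + s) w).
  rewrite /y doubleS [LHS]/= -/(y n w) -/s time_double time_odd.
  rewrite -[in X in _ = X](time_double n.+1) doubleS /ymid /X /inc /increment.
  by rewrite time_double time_odd.
rewrite YE yE /a /disp /r -/(ymid n w) /ymid.
move: (b _ _) => b1; move: (b _ _) => b2.
by apply/rowP => i; rewrite !mxE; ring.
Qed.

Let a_le n w : enorm (a n w) <= (1 + 2 * s * L) * enorm (y n w - Y n w).
Proof.
apply: le_trans (enormD _ _) _; rewrite [leRHS]mulrDl mul1r lerD2l enormZ gtr0_norm.
  by rewrite -mulrA ler_wpM2l ?bL// mulr_ge0// ltW.
by rewrite mulr_gt0.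
Qed.

Let tau_ge0 n : (n < N)%N -> 0 <= tau n.
Proof.
by move=> nN; rewrite subr_ge0 ler_wsqrtr// timeS; have := s0; lra.
Qed.

Let tau_le1 n : (n < N)%N -> tau n <= 1.
Proof.
move=> nN; have /andP[t0 _] := time01 (ltnW nN).
have : Num.sqrt (1 - time n) <= 1 by rewrite -[leRHS]sqrtr1 ler_wsqrtr//; lra.
by have := sqrtr_ge0 (1 - time n.+1); rewrite /tau; lra.
Qed.

Let r_le n w : (n < N)%N -> enorm (r n w) <= s * (kap * Num.sqrt d%:R) * tau n.
Proof.
move=> nN; rewrite enormZ (gtr0_norm s0) -mulrA ler_wpM2l ?(ltW s0)//.
have /andP[t0 _] := time01 (ltnW nN); have /andP[_ t1] := time01 nN.
rewrite timeS in t1; have s0' := s0.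
(* Only the midpoint [time n + s] enters, and it stays below 1 even in the last step, where
   [time n.+1 = 1]. *)
apply: le_trans (bT _ t0 _ _) _; [lra|lra|].
rewrite -mulrA ler_wpM2l ?mulr_ge0 ?sqrtr_ge0// addrAC subrr add0r.
rewrite /tau timeS.
have p2 : Num.sqrt (1 - time n) ^+ 2 = 1 - time n by rewrite sqr_sqrtr; lra.
have q2 : Num.sqrt (1 - (time n + 2 * s)) ^+ 2 = 1 - (time n + 2 * s) by rewrite sqr_sqrtr; lra.
have m2 : Num.sqrt (1 - (time n + s)) ^+ 2 = 1 - (time n + s) by rewrite sqr_sqrtr; lra.
have m0 : 0 < Num.sqrt (1 - (time n + s)) by rewrite sqrtr_gt0; lra.
have qp : Num.sqrt (1 - (time n + 2 * s)) <= Num.sqrt (1 - time n) by rewrite ler_wsqrtr//; lra.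
move: (sqrtr_ge0 (1 - time n)) (sqrtr_ge0 (1 - (time n + 2 * s))) p2 q2 m2 m0 qp.
move: (Num.sqrt (1 - time n)) (Num.sqrt (1 - (time n + 2 * s))) (Num.sqrt (1 - (time n + s))) => p q m p0 q0 p2 q2 m2 m0 qp.
rewrite ler_pdivrMr//.
(* [p^2 - q^2 = 2 s], and by concavity of the square root [m] is at least the mean of [p] and [q];
   so [s / m <= p - q], the telescoping weight. *)
have -> : s = (p - q) * ((p + q) / 2).
  have : p ^+ 2 - q ^+ 2 = 2 * s by rewrite p2 q2; ring.
  lra.
rewrite ler_wpM2l ?subr_ge0//.
have : (p + q) / 2 <= m.
  rewrite -(@ler_pXn2r _ 2)// ?nnegrE ?divr_ge0 ?addr_ge0// ?(ltW m0)//.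
  by have := sqr_ge0 (p - q); lra.
by [].
Qed.

Let bounded_diff n : exists C, forall w, enorm (y n w - Y n w) <= C.
Proof.
elim: n => [|n [C CP]]; first by exists 0 => w; rewrite subr0 enorm0.
exists ((1 + 2 * s * L) * C + s * (B + B) + s * (B + B)) => w; rewrite stepE.
apply: le_trans (enormD _ _) _; apply: lerD; last first.
  rewrite enormZ (gtr0_norm s0) ler_wpM2l ?(ltW s0)//.
  by rewrite (le_trans (enormB _ _))// lerD.
apply: le_trans (enormD _ _) _; apply: lerD; last first.
  rewrite enormZ (gtr0_norm s0) ler_wpM2l ?(ltW s0)//.
  by rewrite (le_trans (enormB _ _))// lerD.
apply: le_trans (a_le n w) _; rewrite ler_wpM2l// addr_ge0// !mulr_ge0// ltW//.
Qed.

Let my n : (n <= N)%N -> measurable_fun setT (y n : Omega -> borel_rV R d).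
Proof.
move=> nN; apply: (measurable_euler_W BW).
- by rewrite double_gt0.
- by rewrite leq_double.
- exact: measurable_drift.
Qed.

Let mY n : (n <= N)%N -> measurable_fun setT (Y n : Omega -> borel_rV R d).
Proof. by move=> nN; apply: (measurable_euler_W BW) => //; exact: measurable_drift. Qed.

Lemma bmeas_diff n : (n <= N)%N ->
  bmeas (fun w => enorm (euler beta b N.*2 (W^~ w) n.*2 - euler beta b N (W^~ w) n) ^+ 2).
Proof.
move=> nN; split.
  apply: measurable_funX; apply: measurable_enorm.
  exact: (measurable_subV (my nN) (mY nN)).
have [C CP] := bounded_diff n; exists (C ^+ 2) => w.
have C0 : 0 <= C := le_trans (enorm_ge0 _) (CP w).
by rewrite ger0_norm ?sqr_ge0// ler_pXn2r ?nnegrE ?enorm_ge0//; exact: CP.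
Qed.

Let mean_step n : (n < N)%N ->
  bmeas (fun w => enorm (a n w + s *: disp s (time n) (y n w) (X n w)) ^+ 2) /\
  EP P (fun w => enorm (a n w + s *: disp s (time n) (y n w) (X n w)) ^+ 2) <=
  (1 + s) * ((1 + 2 * s * L) ^+ 2 * EP P (fun w => enorm (y n w - Y n w) ^+ 2))
  + s * rhoc s ^+ 2 + s ^+ 2 * (L ^+ 2 * (2 * s ^+ 2 * B ^+ 2 + 2 * beta * s * d%:R)).
Proof.
move=> nN; have nN' := ltnW nN.
have n2 : (n.*2 < N.*2)%N by rewrite ltn_double.
have N20 : (0 < N.*2)%N by rewrite double_gt0.
have mX := measurable_inc BW N20 n2.
have pm i : (i < N.*2)%N -> measurable_fun setT (inc W N.*2 i) by exact: (measurable_inc BW).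
have md := measurable_drift.
have yP : measurable_fun setT (y n : pastT (inc W N.*2) n.*2 -> borel_rV R d).
  exact: euler_past.
have YP : measurable_fun setT (Y n : pastT (inc W N.*2) n.*2 -> borel_rV R d).
  exact: euler_past_double.
have bm (Z : pastT (inc W N.*2) n.*2 -> borel_rV R d) : measurable_fun setT Z ->
    measurable_fun setT (fun w => b (Z w) (time n) : borel_rV R d).
  by move=> mZ; exact: measurableT_comp (md (time n)) mZ.
have aP : measurable_fun setT (a n : pastT (inc W N.*2) n.*2 -> borel_rV R d).
  apply: measurable_addV; first exact: measurable_subV.
  apply: measurable_scaleV; first exact: measurable_cst.
  by apply: measurable_subV; exact: bm.
have SP : measurable_fun setT ((fun w => (y n w : borel_rV R d, a n w : borel_rV R d))
    : pastT (inc W N.*2) n.*2 -> (borel_rV R d * borel_rV R d)%type).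
  exact: measurable_fun_pair.
(* The fine increment [X n] is independent of all that is computed up to coarse time [n], so it is
   averaged with [y n] and [a n] frozen. *)
have SX := indep_past pm (inc_indep BW N20) n2 SP.
have mS := measurable_of_past pm (ltnW n2) SP.
pose F (p : (borel_rV R d * borel_rV R d) * borel_rV R d) : R :=
  enorm ((p.1.2 : 'rV[R]_d) + s *: disp s (time n) p.1.1 p.2) ^+ 2.
have mF : measurable_fun setT F.
  have m1 : measurable_fun setT (fun p : (borel_rV R d * borel_rV R d) * borel_rV R d => p.1.1).
    exact: measurableT_comp measurable_fst measurable_fst.
  have m2 : measurable_fun setT (fun p : (borel_rV R d * borel_rV R d) * borel_rV R d => p.1.2).
    exact: measurableT_comp measurable_snd measurable_fst.
  have mb : measurable_fun setT (fun p : (borel_rV R d * borel_rV R d) * borel_rV R d =>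
      b p.1.1 (time n) : borel_rV R d) by exact: measurableT_comp (md (time n)) m1.
  apply: measurable_funX; apply: measurable_enorm; apply: measurable_addV => //.
  apply: measurable_scaleV; first exact: measurable_cst.
  apply: measurable_subV => //.
  apply: (measurableT_comp (md (time n))); apply: measurable_addV.
    by apply: measurable_addV => //; apply: measurable_scaleV => //; exact: measurable_cst.
  by apply: measurable_scaleV; [exact: measurable_cst|exact: measurable_snd].
have F0 p : (0 <= (F p)%:E)%E by rewrite lee_fin sqr_ge0.
have mF' : measurable_fun setT (EFin \o F) by exact/measurable_EFinP.
have := ge0_freezing mS mX SX mF' F0; rewrite /= => E.
have bFS : bmeas (fun w => F ((y n w, a n w), X n w)).
  split; first by apply: (measurableT_comp mF); exact: measurable_fun_pair.
  have [C CP] := bounded_diff n.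
  exists (((1 + 2 * s * L) * C + s * (B + B)) ^+ 2) => w.
  rewrite ger0_norm ?sqr_ge0//; apply: lerXn2r; rewrite ?nnegrE ?enorm_ge0//.
    rewrite addr_ge0 ?mulr_ge0 ?addr_ge0 ?(ltW s0)//.
      by rewrite !mulr_ge0 ?(ltW s0).
    exact: le_trans (enorm_ge0 _) (CP w).
  apply: le_trans (enormD _ _) _; apply: lerD.
    apply: le_trans (a_le n w) _; rewrite ler_wpM2l// addr_ge0// !mulr_ge0//.
    exact: ltW.
  rewrite enormZ (gtr0_norm s0) ler_wpM2l ?(ltW s0)//.
  by rewrite (le_trans (enormB _ _))// lerD.
split; first exact: bFS.
rewrite -lee_fin -(EP_EFin P bFS) E.
have be := bmeas_diff nN'.
pose c := s * rhoc s ^+ 2 + s ^+ 2 * (L ^+ 2 * (2 * s ^+ 2 * B ^+ 2 + 2 * beta * s * d%:R)).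
pose k := (1 + s) * (1 + 2 * s * L) ^+ 2.
have bG : bmeas (fun w => k * enorm (y n w - Y n w) ^+ 2 + c).
  by apply: bmeasD; [exact: bmeasZ|exact: bmeas_cst].
apply: (@le_trans _ _ (\int[P]_w (k * enorm (y n w - Y n w) ^+ 2 + c)%:E)%E); last first.
  rewrite (EP_EFin P bG) lee_fin EPD ?EPZ ?EP_cst//; [|exact: bmeasZ|exact: bmeas_cst].
  by rewrite /c /k !mulrA addrA.
have inner yy aa : (\int[P]_v (F ((yy, aa), X n v))%:E <=
    ((1 + s) * enorm (aa : 'rV[R]_d) ^+ 2 + c)%:E)%E.
  have mFF : measurable_fun setT (fun x : borel_rV R d => F ((yy, aa), x)).
    by apply: (measurableT_comp mF); exact: pair1_measurable.
  have bF : bmeas (fun v => F ((yy, aa), X n v)).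
    split; first exact: (measurableT_comp mFF mX).
    exists ((enorm (aa : 'rV[R]_d) + s * (B + B)) ^+ 2) => w.
    rewrite ger0_norm ?sqr_ge0//; apply: lerXn2r; rewrite ?nnegrE ?enorm_ge0//.
      by rewrite addr_ge0 ?enorm_ge0// mulr_ge0 ?(ltW s0)// addr_ge0.
    apply: le_trans (enormD _ _) _; apply: lerD => //.
    rewrite enormZ (gtr0_norm s0) ler_wpM2l ?(ltW s0)//.
    by rewrite (le_trans (enormB _ _))// lerD.
  rewrite (EP_EFin P bF) lee_fin.
  rewrite (law_gE (F := fun x => F ((yy, aa), x)) mX s0 (inc_law BW N20 n2) mFF).
  have := inner_bound yy aa (ltW s0) (time01 nN').
  by rewrite /c addrA.
apply: ge0_le_integral => //.
- by move=> w _; apply: integral_ge0 => v _.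
- have mFpack : measurable_fun setT (fun x => (\int[P]_v (F (x, X n v))%:E)%E).
    pose mx := isMeasurableFun.Build _ _ _ _ _ mX.
    pose X' : {mfun Omega >-> borel_rV R d} := HB.pack (inc W N.*2 n.*2) mx.
    have := measurable_fun_fubini_tonelli_F (m2 := distribution P X') _ mF' F0.
    apply: eq_measurable_fun => x _; rewrite /fubini_F ge0_integral_distribution//.
      by apply: (measurableT_comp mF'); exact: pair1_measurable.
    by move=> y0; exact: F0.
  exact: (measurableT_comp mFpack mS).
- by apply/measurable_EFinP; case: bG.
move=> w _; apply: le_trans (inner _ _) _; rewrite lee_fin lerD2r /k -mulrA.
rewrite ler_wpM2l ?addr_ge0 ?(ltW s0)// -exprMn; apply: lerXn2r; rewrite ?nnegrE ?enorm_ge0//.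
  by rewrite mulr_ge0 ?enorm_ge0// addr_ge0// !mulr_ge0// ltW.
Qed.

(** In the exponent, 1 is the sum of the [tau] and 1/2 that of the [N] copies of [s]. The second
    factor is the sum of the [ga] divided by [(s d)^2]. *)
Definition strong_C : R :=
  expR (1 + (1 + 4 * L) / 2) *
  ((L * B + K * beta) ^+ 2 + L ^+ 2 * (2 * B ^+ 2 + 2 * beta) + 2 * kap ^+ 2).

Lemma strong_doubling :
  EP P (fun w => enorm (euler beta b N.*2 (W^~ w) N.*2 - euler beta b N (W^~ w) N) ^+ 2)
  <= strong_C * (d%:R / N%:R) ^+ 2.
Proof.
pose x n := EP P (fun w => enorm (y n w - Y n w) ^+ 2).
pose C1 := (L * B + K * beta) ^+ 2 + L ^+ 2 * (2 * B ^+ 2 + 2 * beta).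
have C10 : 0 <= C1.
  by rewrite addr_ge0 ?sqr_ge0// mulr_ge0 ?sqr_ge0// addr_ge0 ?mulr_ge0 ?sqr_ge0// ltW.
pose D := (s * d%:R) ^+ 2.
have D0 : 0 <= D by exact: sqr_ge0.
pose al n := tau n + (s + 4 * s * L).
pose ga n := D * (2 * C1 * s + 2 * kap ^+ 2 * tau n).
have step n : (n < N)%N -> x n.+1 <= expR (al n) * x n + ga n.
  move=> nN; have t0 := tau_ge0 nN; have t1 := tau_le1 nN.
  pose U w := enorm (a n w + s *: disp s (time n) (y n w) (X n w)) ^+ 2.
  pose R0 := s * (kap * Num.sqrt d%:R).
  have R00 : 0 <= R0 by rewrite mulr_ge0 ?(ltW s0)// mulr_ge0 ?sqrtr_ge0.
  have bx := bmeas_diff (ltnW nN); have bx1 := bmeas_diff nN.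
  have [bU h2] := mean_step nN; rewrite -/(U) -/(x n) in bU h2.
  (* Young's inequality weighted by [tau n]: since [|r|] is at most [R0 * tau n], the cross term is
     at most [tau n * (|u|^2 + R0^2)]. The factors [1 + tau n] multiply up to at most [exp 1] over
     the whole grid. *)
  have h1 : x n.+1 <= (1 + tau n) * EP P U + 2 * R0 ^+ 2 * tau n.
    have -> : (1 + tau n) * EP P U + 2 * R0 ^+ 2 * tau n =
        EP P (fun w => (1 + tau n) * U w + 2 * R0 ^+ 2 * tau n).
      rewrite (EPD P (bmeasZ (1 + tau n) bU) (bmeas_cst (2 * R0 ^+ 2 * tau n))).
      by rewrite EPZ// EP_cst.
    apply: EP_le => //; first by apply: bmeasD; [exact: bmeasZ|exact: bmeas_cst].
    move=> w; rewrite stepE enorm_sqrD /U.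
    have := r_le w nN; have := dot_le (a n w + s *: disp s (time n) (y n w) (X n w)) (r n w).
    have := enorm_ge0 (r n w); have := enorm_ge0 (a n w + s *: disp s (time n) (y n w) (X n w)).
    rewrite -/R0; move: (enorm _) (enorm (r n w)) (dot _ _) => u v p u0 v0 h3 h4.
    have h5 : u * v <= u * (R0 * tau n) by rewrite ler_wpM2l.
    have h6 : v ^+ 2 <= (R0 * tau n) ^+ 2 by rewrite lerXn2r ?nnegrE ?(mulr_ge0 R00 t0).
    have h7 : 0 <= tau n * (u - R0) ^+ 2 by rewrite mulr_ge0 ?sqr_ge0.
    have h8 : 0 <= R0 ^+ 2 * (tau n * (1 - tau n)).
      by rewrite (mulr_ge0 (sqr_ge0 _))// mulr_ge0// subr_ge0.
    lra.
  have x0 : 0 <= x n.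
    by rewrite -(EP_cst P 0); apply: EP_le => //; [exact: bmeas_cst|move=> w; exact: sqr_ge0].
  have s0' := s0; have s1' := s1; have dR' := dR.
  have t2 : 0 <= 1 + tau n by exact: addr_ge0.
  have s3 : 0 <= 1 + s by apply: addr_ge0 => //; exact: ltW.
  have e1 : (1 + tau n) * (1 + s) * (1 + 2 * s * L) ^+ 2 <= expR (al n).
    rewrite /al (_ : tau n + (s + 4 * s * L) = tau n + s + 2%:R * (2 * s * L)); last by ring.
    rewrite (expRD (tau n + s)) (expRD (tau n)) expRM_natl; apply: ler_pM.
    - exact: mulr_ge0.
    - exact: sqr_ge0.
    - by apply: ler_pM => //; exact: expR_ge1Dx.
    - rewrite lerXn2r ?nnegrE ?expR_ge0 ?expR_ge1Dx// addr_ge0// !mulr_ge0//.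
      exact: ltW.
  have e2 : s * rhoc s ^+ 2 + s ^+ 2 * (L ^+ 2 * (2 * s ^+ 2 * B ^+ 2 + 2 * beta * s * d%:R))
      <= D * C1 * s.
    have f1 : rhoc s ^+ 2 <= D * (L * B + K * beta) ^+ 2.
      rewrite /D -exprMn; apply: lerXn2r; rewrite ?nnegrE.
      - by rewrite /rhoc addr_ge0// !mulr_ge0 ?(ltW s0) ?(ltW beta0).
      - by rewrite !mulr_ge0 ?(ltW s0)// addr_ge0 ?mulr_ge0// ltW.
      - rewrite /rhoc; have : 0 <= s * (L * B) * (d%:R - 1).
          by rewrite !mulr_ge0 ?(ltW s0)// subr_ge0.
        lra.
    have f2 : s ^+ 2 * (2 * s ^+ 2 * B ^+ 2 + 2 * beta * s * d%:R) <= D * (2 * B ^+ 2 + 2 * beta) * s.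
      have g1 : 0 <= B ^+ 2 * s ^+ 3 * (d%:R ^+ 2 - s).
        rewrite !mulr_ge0 ?sqr_ge0 ?exprn_ge0 ?(ltW s0)// subr_ge0.
        by apply: le_trans s1 _; rewrite exprn_ege1.
      have g2 : 0 <= beta * s ^+ 3 * (d%:R * (d%:R - 1)).
        by rewrite !mulr_ge0 ?exprn_ge0 ?(ltW s0) ?(ltW beta0)// subr_ge0.
      by rewrite /D; lra.
    have := ler_wpM2l (ltW s0) f1; have := ler_wpM2l (sqr_ge0 L) f2.
    by rewrite /C1; lra.
  have e3 : 2 * R0 ^+ 2 * tau n <= D * (2 * kap ^+ 2 * tau n).
    rewrite /R0 !exprMn sqr_sqrtr ?ler0n// /D.
    have : 0 <= s ^+ 2 * kap ^+ 2 * tau n * (d%:R * (d%:R - 1)).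
      apply: mulr_ge0; last by rewrite mulr_ge0 ?ler0n ?subr_ge0.
      by apply: mulr_ge0 => //; apply: mulr_ge0; exact: sqr_ge0.
    lra.
  have dc0 : 0 <= D * C1 * s by apply: mulr_ge0; [exact: mulr_ge0|exact: ltW].
  have := ler_wpM2l t2 h2; have := ler_wpM2r x0 e1; have := ler_wpM2l t2 e2.
  have : 0 <= D * C1 * s * (1 - tau n) by rewrite mulr_ge0// subr_ge0.
  rewrite /ga; move: e3 h1; lra.
have : x N <= expR (\sum_(k < N) al k) * \sum_(k < N) ga k.
  apply: gronwall => //.
  - rewrite /x (_ : (fun w => _) = fun=> 0) ?EP_cst//.
    by apply/funext => w; rewrite subr0 enorm0 expr0n.
  - move=> k kN; rewrite addr_ge0 ?tau_ge0// addr_ge0 ?(ltW s0)//.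
    by rewrite !mulr_ge0 ?(ltW s0).
  - move=> k kN; rewrite mulr_ge0// addr_ge0 ?mulr_ge0 ?sqr_ge0 ?(ltW s0)//.
    exact: tau_ge0.
have sumtau : \sum_(k < N) tau k = 1.
  rewrite (eq_bigr (fun k : 'I_N => - (Num.sqrt (1 - time k.+1) - Num.sqrt (1 - time k)))).
    rewrite sumrN -(big_mkord xpredT (fun k => Num.sqrt (1 - time k.+1) - Num.sqrt (1 - time k))).
    rewrite telescope_sumr// /time mul0r subr0 sqrtr1 divff ?gt_eqF// subrr sqrtr0.
    by rewrite sub0r opprK.
  by move=> k _; rewrite opprB.
have sums : \sum_(k < N) s = 1 / 2.
  rewrite sumr_const card_ord -mulr_natr; have := s2; move/(congr1 (fun u => u * N%:R)).
  by rewrite mulVf ?gt_eqF//; lra.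
have -> : \sum_(k < N) al k = 1 + (1 + 4 * L) / 2.
  rewrite big_split/= sumtau (eq_bigr (fun=> s * (1 + 4 * L))).
    by rewrite -mulr_suml sums; lra.
  by move=> k _; ring.
have -> : \sum_(k < N) ga k = D * (C1 + 2 * kap ^+ 2).
  rewrite -mulr_sumr big_split/= -mulr_sumr sums -mulr_sumr sumtau.
  by congr (_ * _); lra.
move=> /le_trans; apply; rewrite /strong_C -mulrA ler_wpM2l ?expR_ge0//.
rewrite mulrC ler_wpM2l//.
  by rewrite addr_ge0// mulr_ge0 ?sqr_ge0.
rewrite lerXn2r ?nnegrE ?mulr_ge0 ?invr_ge0 ?ler0n ?(ltW s0)//.
rewrite mulrC ler_wpM2l ?ler0n// -s2; have := s0; lra.
Qed.

End doubling.
End drift_hypotheses.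

(** * Weak convergence of the Euler scheme *)

Section one_step.
Context {R : realType} {d : nat}.
Variables (beta rho K : R).
Hypotheses (beta0 : 0 < beta) (rho0 : 0 < rho).

Let m := @gmom R d.
Let sb := Num.sqrt beta.
Let Fb := beta * (K / rho).

(** Collects the remainders [s1] to [s4] of the next proof; the last three are divided by the mean
    of [U], hence by [rho]. *)
Definition weak_C : R :=
  K * (Fb ^+ 2 + sb * Fb) * m +
  (beta * K ^+ 2 * sb * m + K ^+ 2 * sb ^+ 3 * m ^+ 2 + 2 * K ^+ 2 * sb ^+ 3 * m) / rho.

(** A one-step change of measure. Under Gaussian noise of variance [beta * q^2] the covariance of
    [U] and [v] is [beta * q^2] times the product of their gradients, to leading order. Divided by
    the mean of [U], it is the effect on [v] of a displacement by [q^2 *: f]. *)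
Lemma weak_one_step (U v : 'rV[R]_d -> R) (GU Gv : 'rV[R]_d -> 'rV[R]_d) (q : R) x
  (c := sb * q) (f := beta *: ((gavg c U x)^-1 *: gavgV c GU x)) :
  C11 K U GU -> C11 K v Gv -> (forall y, rho <= U y) -> 0 <= q <= 1 ->
  `|gavg c v (x + q ^+ 2 *: f) - gavg c (fun y => v y * U y) x / gavg c U x|
    <= weak_C * q ^+ 3.
Proof.
move=> CU Cv Ur /andP[q0 q1]; set h := q ^+ 2.
have [K0 u1 u2 u3 u4] := CU; have [_ v1 v2 v3 v4] := Cv.
have ur : rho <= gavg c U x by exact: gavg_ge CU Ur.
have [_ _ gu2 _ _] := C11_gavg c CU.
have up : 0 < gavg c U x by exact: lt_le_trans ur.
have sb0 : 0 <= sb by exact: sqrtr_ge0.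
have sb2 : sb ^+ 2 = beta by rewrite sqr_sqrtr// ltW.
have c0 : 0 <= c by exact: mulr_ge0.
have h0 : 0 <= h by exact: sqr_ge0.
have fB : enorm f <= Fb.
  rewrite /f !enormZ (gtr0_norm beta0) ler_wpM2l ?(ltW beta0)// mulrC.
  apply: ler_pM; rewrite ?enorm_ge0//.
  by rewrite gtr0_norm ?invr_gt0// lef_pV2.
have Fb0 : 0 <= Fb := le_trans (enorm_ge0 _) fB.
have m0 : 0 <= m := gmom_ge0.
have mU := continuous_measurable_rV (lipschitz_continuous u4).
have mv := continuous_measurable_rV (lipschitz_continuous v4).
have msh := measurable_shift c.
have mUs y : measurable_fun [set: borel_rV R d] (fun z : borel_rV R d => U (y + c *: (z : 'rV[R]_d))).
  by apply: (measurableT_comp (f := U : borel_rV R d -> R)); [exact: mU|exact: msh].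
have mvs y : measurable_fun [set: borel_rV R d] (fun z : borel_rV R d => v (y + c *: (z : 'rV[R]_d))).
  by apply: (measurableT_comp (f := v : borel_rV R d -> R)); [exact: mv|exact: msh].
have pw (r t : R) k (z : 'rV[R]_d) : (k <= 3)%N -> 0 <= r -> t <= r * enorm z ^+ k ->
    t <= r * (1 + enorm z) ^+ 3.
  by move=> k3 r0 /le_trans; apply; rewrite ler_wpM2l// enorm_pow3.
have cz z : enorm (c *: z) = c * enorm z by rewrite enormZ ger0_norm.
have shK (y w : 'rV[R]_d) : y + w - y = w by rewrite addrC addKr.
have dU z : `|U (x + c *: z) - U x| <= K * c * enorm z.
  by have := u4 (x + c *: z) x; rewrite shK cz mulrA.
have dv z : `|v (x + c *: z) - v x| <= K * c * enorm z.
  by have := v4 (x + c *: z) x; rewrite shK cz mulrA.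
have eU z : `|U (x + c *: z) - (U x + dot (c *: GU x) z + dot 0 z * dot 0 z)| <= K * c ^+ 2 * enorm z ^+ 2.
  have := u1 x (x + c *: z); rewrite shK cz exprMn dotZr dotZl !dot0l mulr0 addr0 mulrA.
  by rewrite opprD addrA.
have ev z : `|v (x + c *: z) - v x - dot (c *: Gv x) z| <= K * c ^+ 2 * enorm z ^+ 2.
  by have := v1 x (x + c *: z); rewrite shK cz exprMn dotZr dotZl mulrA.
pose F1 z := v (x + h *: f + c *: z) - v (x + c *: z).
have m1 : measurable_fun [set: borel_rV R d] F1 by exact: measurable_funB.
pose r1 := K * (h ^+ 2 * Fb ^+ 2 + c * h * Fb).
have a1 z : `|F1 z - (h * dot (Gv x) f + dot 0 z + dot 0 z * dot 0 z)| <= r1 * (1 + enorm z) ^+ 3.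
  rewrite !dot0l mulr0 !addr0.
  have -> : F1 z - h * dot (Gv x) f =
    (v (x + c *: z + h *: f) - v (x + c *: z) - dot (Gv (x + c *: z)) (h *: f))
    + dot (Gv (x + c *: z) - Gv x) (h *: f).
    by rewrite /F1 -!addrA [h *: f + _]addrC dotBl !dotZr; ring.
  have hf : enorm (h *: f) <= h * Fb by rewrite enormZ ger0_norm// ler_wpM2l.
  have b1 := v1 (x + c *: z) (x + c *: z + h *: f); rewrite shK in b1.
  have b2 := normr_dot_le (Gv (x + c *: z) - Gv x) (h *: f).
  have b3 := v3 (x + c *: z) x; rewrite shK cz in b3.
  have b4 : enorm (h *: f) ^+ 2 <= (h * Fb) ^+ 2.
    by rewrite lerXn2r ?nnegrE ?enorm_ge0// (mulr_ge0 h0 Fb0).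
  have b5 := ler_pM (enorm_ge0 _) (enorm_ge0 _) b3 hf.
  have b6 := ler_wpM2l K0 b4.
  have z0 := enorm_ge0 z.
  have b7 : 0 <= K * (h ^+ 2 * Fb ^+ 2) := mulr_ge0 K0 (mulr_ge0 (sqr_ge0 h) (sqr_ge0 Fb)).
  have b8 : 0 <= K * (c * h * Fb) := mulr_ge0 K0 (mulr_ge0 (mulr_ge0 c0 h0) Fb0).
  have p0 := @enorm_pow3 R d z 0 isT; have p1 := @enorm_pow3 R d z 1 isT.
  rewrite expr0 in p0; rewrite expr1 in p1.
  have b9 := ler_wpM2l b7 p0; have b10 := ler_wpM2l b8 p1.
  apply: le_trans (ler_normD _ _) _; rewrite /r1.
  rewrite exprMn in b6; move: (_ ^+ 3) b9 b10 => Z b9 b10; lra.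
have [i1 e1] := gE_approx m1 a1.
have rK2 : 0 <= K * c ^+ 2 := mulr_ge0 K0 (sqr_ge0 c).
have [i2 e2] := gE_approx (mUs x) (fun z => pw _ _ 2 z isT rK2 (eU z)).
have rK1 : 0 <= K * c := mulr_ge0 K0 c0.
have a3 z : `|v (x + c *: z) - (v x + dot 0 z + dot 0 z * dot 0 z)| <= K * c * (1 + enorm z) ^+ 3.
  by rewrite !dot0l mulr0 !addr0; apply: (pw _ _ 1) => //; rewrite expr1.
have [i3 e3] := gE_approx (mvs x) a3.
(* Product of the fluctuations around the values at [x]. Its mean is the covariance, up to the
   product of the two deviations of the means from these values. *)
pose F5 z := (U (x + c *: z) - U x) * (v (x + c *: z) - v x).
have m5 : measurable_fun [set: borel_rV R d] F5.
  by apply: measurable_funM; apply: measurable_funB.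
have a5 z : `|F5 z - (0 + dot 0 z + dot (c *: GU x) z * dot (c *: Gv x) z)| <=
    2 * K ^+ 2 * c ^+ 3 * (1 + enorm z) ^+ 3.
  apply: (pw _ _ 3) => //.
    by apply: mulr_ge0; [apply: mulr_ge0 => //; exact: sqr_ge0|exact: exprn_ge0].
  rewrite dot0l !add0r.
  have -> : F5 z - dot (c *: GU x) z * dot (c *: Gv x) z =
    (U (x + c *: z) - (U x + dot (c *: GU x) z + dot 0 z * dot 0 z)) * (v (x + c *: z) - v x) +
    dot (c *: GU x) z * (v (x + c *: z) - v x - dot (c *: Gv x) z).
    by rewrite /F5 !dot0l; ring.
  have b1 : `|dot (c *: GU x) z| <= K * c * enorm z.
    apply: le_trans (normr_dot_le _ _) _; rewrite ler_wpM2r ?enorm_ge0// cz.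
    by rewrite mulrC ler_wpM2r.
  apply: le_trans (ler_normD _ _) _; rewrite !normrM.
  have := ler_pM (normr_ge0 _) (normr_ge0 _) (eU z) (dv z).
  have := ler_pM (normr_ge0 _) (normr_ge0 _) b1 (ev z).
  move: (_ * `|v (x + c *: z) - v x|) (`|dot (c *: GU x) z| * _) => A B'; lra.
have [i5 e5] := gE_approx m5 a5.
(* The drift contains the averaged gradient of [U], the covariance the gradient at [x]. The gap is
   of order [c] and gets multiplied by [h]. *)
have e6 : `|dot (Gv x) (gavgV c GU x) - dot (Gv x) (GU x)| <= K ^+ 2 * c * m.
  rewrite (dot_gavgV c x (Gv x) u3).
  have mG : measurable_fun [set: borel_rV R d]
      (fun z : borel_rV R d => dot (Gv x) (GU (x + c *: (z : 'rV[R]_d)))).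
    apply: measurable_dot; first exact: measurable_cst.
    apply: (measurableT_comp (f := GU : borel_rV R d -> borel_rV R d)); last exact: msh.
    exact: continuous_measurable_vec (lipschitz_continuous_vec u3).
  have a6 z : `|dot (Gv x) (GU (x + c *: z)) - (dot (Gv x) (GU x) + dot 0 z + dot 0 z * dot 0 z)|
      <= K ^+ 2 * c * (1 + enorm z) ^+ 3.
    rewrite !dot0l mulr0 !addr0; apply: (pw _ _ 1) => //; first exact: mulr_ge0 (sqr_ge0 K) c0.
    rewrite expr1 -dotBr; apply: le_trans (normr_dot_le _ _) _.
    have := u3 (x + c *: z) x; rewrite shK cz => b.
    by apply: le_trans (ler_pM (enorm_ge0 _) (enorm_ge0 _) (v2 x) b) _; rewrite le_eqVlt (_ : _ == _)//; apply/eqP; ring.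
  by have [_] := gE_approx mG a6; rewrite dot0l addr0.
rewrite dot0l addr0 in e1; rewrite dot0l addr0 in e2; rewrite dot0l addr0 in e3.
rewrite add0r dotZl dotZr in e5.
have ih : gint (fun z => v (x + h *: f + c *: z)) by exact: gint_lip v4.
have E1 : gE F1 = gavg c v (x + h *: f) - gavg c v x by rewrite /F1 gEB.
have E5 : gE F5 = gavg c (fun y => v y * U y) x - U x * gavg c v x - v x * gavg c U x + U x * v x.
  have -> : gavg c (fun y => v y * U y) x =
      gE (fun z => (F5 z + U x * v (x + c *: z)) + (v x * U (x + c *: z) + - (U x * v x))).
    by congr gE; apply/funext => z; rewrite /F5; ring.
  have j3 := gintZ (U x) i3; have j2 := gintZ (v x) i2; have jc := @gint_cst R d (- (U x * v x)).
  rewrite (gED (gintD i5 j3) (gintD j2 jc)) (gED i5 j3) (gED j2 jc) gE_cst (gEZ _ i3) (gEZ _ i2).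
  by rewrite /gavg; ring.
have uf : gavg c U x * dot (Gv x) f = beta * dot (Gv x) (gavgV c GU x).
  by rewrite /f !dotZr; field; rewrite gt_eqF.
rewrite -/(gavg c U x) in e2; rewrite -/(gavg c v x) in e3.
clear ih i1 i2 i3 i5 a1 a3 a5 m1 m5 pw eU ev dU dv mUs mvs.
rewrite (dotC (Gv x) (GU x)) in e6.
move: E1 E5 e1 e2 e3 e5 e6 uf up ur {gu2}; rewrite -/m.
move: (gE F1) (gE F5) (gavg c v (x + h *: f)) (gavg c v x) (gavg c U x)
  (gavg c (fun y => v y * U y) x) (dot (Gv x) (gavgV c GU x)) (dot (GU x) (Gv x)) (dot (Gv x) f).
move=> g1 g5 w1 w0 u uv dbG dab dbf.
move=> E1 E5 e1 e2 e3 e5 e6 uf up ur.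
have -> : w1 - uv / u = (u * w1 - uv) / u by field; rewrite gt_eqF.
rewrite normrM normfV (gtr0_norm up) ler_pdivrMr//.
have c2 : c ^+ 2 = beta * h by rewrite /c exprMn sb2.
(* The leading terms cancel by [uf]. There remain the errors of the drift displacement, of the
   gradient of [U], of the means, and of the covariance, each of order [q ^+ 3]. *)
have -> : u * w1 - uv = u * (g1 - h * dbf) + h * beta * (dbG - dab) + (u - U x) * (w0 - v x)
    - (g5 - c * (c * dab)).
  have -> : u * (g1 - h * dbf) = u * g1 - h * (beta * dbG) by rewrite -uf; ring.
  have -> : c * (c * dab) = beta * h * dab by rewrite mulrA -expr2 c2.
  by rewrite E1 E5; ring.
have q3 : q ^+ 4 <= q ^+ 3 by rewrite ler_wiXn2l.
have s1 : `|g1 - h * dbf| <= K * (Fb ^+ 2 + sb * Fb) * m * q ^+ 3.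
  apply: le_trans e1 _; rewrite /r1 [leRHS]mulrAC; apply: ler_wpM2r => //.
  rewrite -[leRHS]mulrA; apply: ler_wpM2l => //.
  rewrite [leRHS]mulrDl; apply: lerD.
    by rewrite /h -exprM mulrC; apply: ler_wpM2l => //; exact: sqr_ge0.
  by rewrite /c /h le_eqVlt (_ : _ == _)//; apply/eqP; ring.
have s2 : `|h * beta * (dbG - dab)| <= beta * K ^+ 2 * sb * m * q ^+ 3.
  rewrite normrM ger0_norm; last exact: mulr_ge0 h0 (ltW beta0).
  apply: le_trans (ler_wpM2l (mulr_ge0 h0 (ltW beta0)) e6) _.
  by rewrite /c /h le_eqVlt (_ : _ == _)//; apply/eqP; ring.
have s3 : `|(u - U x) * (w0 - v x)| <= K ^+ 2 * sb ^+ 3 * m ^+ 2 * q ^+ 3.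
  rewrite normrM; apply: le_trans (ler_pM (normr_ge0 _) (normr_ge0 _) e2 e3) _.
  by rewrite /c le_eqVlt (_ : _ == _)//; apply/eqP; ring.
have s4 : `|g5 - c * (c * dab)| <= 2 * K ^+ 2 * sb ^+ 3 * m * q ^+ 3.
  apply: le_trans e5 _.
  by rewrite /c le_eqVlt (_ : _ == _)//; apply/eqP; ring.
set T := (beta * K ^+ 2 * sb * m + K ^+ 2 * sb ^+ 3 * m ^+ 2 + 2 * K ^+ 2 * sb ^+ 3 * m).
have T0 : 0 <= T.
  have k2 := sqr_ge0 K; have s03 : 0 <= sb ^+ 3 := exprn_ge0 3 sb0.
  apply: addr_ge0; first apply: addr_ge0.
  - exact: mulr_ge0 (mulr_ge0 (mulr_ge0 (ltW beta0) k2) sb0) m0.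
  - exact: mulr_ge0 (mulr_ge0 k2 s03) (sqr_ge0 m).
  - exact: mulr_ge0 (mulr_ge0 (mulr_ge0 (ler0n R 2) k2) s03) m0.
have T1 : T <= T / rho * u.
  by rewrite -mulrA ler_peMr// mulrC ler_pdivlMr// mul1r.
apply: (@le_trans _ _ (u * `|g1 - h * dbf| + T * q ^+ 3)).
  apply: le_trans (ler_normB _ _) _; apply: le_trans (lerD (ler_normD _ _) (lexx _)) _.
  apply: le_trans (lerD (lerD (ler_normD _ _) (lexx _)) (lexx _)) _.
  apply: le_trans (lerD (lerD (lerD (lexx _) s2) s3) s4) _.
  rewrite [`|u * _|]normrM (gtr0_norm up) -2![leLHS]addrA; apply: lerD => //.
  by rewrite /T le_eqVlt (_ : _ == _)//; apply/eqP; ring.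
have h1 := ler_wpM2l (ltW up) s1.
have h2 := ler_wpM2r (exprn_ge0 3 q0) T1.
apply: le_trans (lerD h1 h2) _.
suff -> : weak_C * q ^+ 3 * u =
    u * (K * (Fb ^+ 2 + sb * Fb) * m * q ^+ 3) + T / rho * u * q ^+ 3 by [].
by rewrite /weak_C /T -/m -/sb -/Fb; ring.
Qed.

End one_step.

Lemma gintE {R : realType} d (F : 'rV[R]_d -> R) : gint F ->
  (gE F)%:E = (\int[@gauss_rV R d 1]_z (F z)%:E)%E.
Proof. by move=> iF; rewrite /gE /Rintegral fineK//; exact: integrable_fin_num iF. Qed.

Lemma C11_measurable {R : realType} d K (U : 'rV[R]_d -> R) G :
  C11 K U G -> measurable_fun [set: borel_rV R d] U.
Proof.
by move=> [_ _ _ _ u4]; apply: continuous_measurable_rV; exact: lipschitz_continuous u4.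
Qed.

Lemma C11_gint {R : realType} d K c x (U : 'rV[R]_d -> R) G :
  C11 K U G -> gint (fun z => U (x + c *: z)).
Proof. by move=> [_ _ _ _ u4]; exact: gint_lip u4. Qed.

Lemma gavg0 {R : realType} d (U : 'rV[R]_d -> R) : gavg 0 U = U.
Proof.
apply/funext => x; rewrite -[RHS](@gE_cst _ d); congr gE.
by apply/funext => z; rewrite scale0r addr0.
Qed.

Lemma noiseE {R : realType} (beta : R) t : 0 <= 1 - t ->
  noise beta t = Num.sqrt beta * Num.sqrt (1 - t).
Proof. by move=> t1; rewrite /noise sqrtrM// mulrC. Qed.

Section semigroup.
Context {R : realType} {dO : measure_display} {Omega : measurableType dO}
  (P : probability Omega R) {d : nat} (W : R -> Omega -> borel_rV R d).
Hypothesis BW : brownian_motion P W.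
Variable (beta : R).
Let sb := Num.sqrt beta.

Lemma increments_indep2 s t u : 0 <= s -> s <= t -> t <= u -> u <= 1 ->
  indep2 P (increment W s t) (increment W t u).
Proof.
move=> s0 st tu u1 A B mA mB; case: BW => _ _ _ /(_ 2%N (nth u [:: s; t; u])) iW _.
have {}iW := iW s0 u1 _.
have h : mutually_independent P
    (fun i : 'I_2 => increment W (nth u [:: s; t; u] i) (nth u [:: s; t; u] i.+1)).
  by apply: iW => -[|[|]].
have := h [set: 'I_2]%SET (fun i => if i == ord0 then A else B).
rewrite (eq_bigl predT) => [|i]; last by rewrite inE.
rewrite big_ord_recl big_ord1/= => <-; last by move=> i; case: ifP.
congr (P _); apply/seteqP; split => [w [Aw Bw] i _ /=|w H].
  by case: (unliftP ord0 i) => [j ->|->] //=; rewrite (ord1 j).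
by split; [have := H ord0|have := H (lift ord0 ord0)]; apply => /=; rewrite inE.
Qed.

(* The heat semigroup property, read off the increments of the Brownian motion. *)
Lemma gavg_semigroup N n K (U : 'rV[R]_d -> R) (G : 'rV[R]_d -> 'rV[R]_d) x : (n < N)%N -> C11 K U G -> (forall y, 0 <= U y) ->
  gavg (noise beta (n%:R / N%:R)) U x =
  gavg (sb * Num.sqrt N%:R^-1) (gavg (noise beta (n.+1%:R / N%:R)) U) x.
Proof.
move=> nN CU U0.
have N0 : 0 < N%:R :> R by rewrite ltr0n (leq_ltn_trans _ nN).
set t := n%:R / N%:R; set t' := n.+1%:R / N%:R.
have tt' : t' - t = N%:R^-1 by rewrite /t /t' -mulrBl -natrB// subSnn mul1r.
have t0 : 0 <= t by rewrite divr_ge0.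
have ltt' : t < t' by rewrite -subr_gt0 tt' invr_gt0.
have t'1 : t' <= 1 by rewrite ler_pdivrMr// mul1r ler_nat.
(* In the last step the increment from [t'] to 1 is degenerate and [brownian_motion] assigns it no
   Gaussian law; but then the outer noise is zero and [gavg 0] is the identity. *)
have [t'E|t'N] := eqVneq t' 1.
  rewrite [noise beta t']/noise t'E subrr mul0r sqrtr0 gavg0 noiseE ?subr_ge0.
    by rewrite -tt' t'E.
  by rewrite -t'E ltW.
have {}t'N : t' < 1 by rewrite lt_neqAle t'N.
have t1 : t < 1 by exact: lt_trans t'N.
case: BW => mW _ lW _ _.
have t'0 : 0 <= t' := le_trans t0 (ltW ltt').
have mWt : measurable_fun setT (W t) by apply: mW; rewrite t0 ltW.
have mWt' : measurable_fun setT (W t') by apply: mW; rewrite t'0 ltW.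
have mW1 : measurable_fun setT (W 1) by apply: mW; rewrite ler01 lexx.
have m1 : measurable_fun setT (increment W t t') by exact: measurable_subV.
have m2 : measurable_fun setT (increment W t' 1) by exact: measurable_subV.
have m : measurable_fun setT (increment W t 1) by exact: measurable_subV.
have mU := C11_measurable CU.
have mU' := C11_measurable (C11_gavg (noise beta t') CU).
have msc dT (T : measurableType dT) (f : T -> borel_rV R d) : measurable_fun setT f ->
    measurable_fun setT (fun w => x + sb *: (f w : 'rV[R]_d) : borel_rV R d).
  move=> mf; apply: measurable_addV; first exact: measurable_cst.
  by apply: measurable_scaleV => //; exact: measurable_cst.
have mUsc (U1 : borel_rV R d -> R) dT (T : measurableType dT) (f : T -> borel_rV R d) :
    measurable_fun setT U1 -> measurable_fun setT f ->
    measurable_fun setT (fun w => (U1 (x + sb *: (f w : 'rV[R]_d)))%:E).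
  move=> mU1 mf; apply/measurable_EFinP; apply: (measurableT_comp (f := U1)) => //.
  exact: msc.
have mid (U1 : borel_rV R d -> R) : measurable_fun setT U1 ->
    measurable_fun [set: borel_rV R d] (fun y => (U1 (x + sb *: (y : 'rV[R]_d)))%:E).
  by move=> mU1; apply: (mUsc U1 _ _ (fun y => y)) => //; exact: measurable_id.
apply/EFin_inj; rewrite /gavg !gintE; last 2 first.
- exact: (C11_gint _ _ (C11_gavg _ CU)).
- exact: C11_gint CU.
rewrite (noiseE _ (_ : 0 <= 1 - t)); last by rewrite subr_ge0 ltW.
have := law_ge0 (F := fun y => (U (x + sb *: (y : 'rV[R]_d)))%:E) m _ (lW _ _ t0 t1 (lexx 1)).
rewrite subr_gt0 => /(_ t1 (mid U mU)) E1.
under eq_integral do rewrite -scalerA.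
rewrite -E1 => [|y]; last by rewrite lee_fin.
pose F2 (p : borel_rV R d * borel_rV R d) :=
  (U (x + sb *: ((p.1 : 'rV[R]_d) + (p.2 : 'rV[R]_d))))%:E.
transitivity (\int[P]_w F2 (increment W t t' w, increment W t' 1 w))%E.
  by apply: eq_integral => w _; rewrite /F2/= /increment [_ - W t w + _]addrC subrKA.
have mF2 : measurable_fun setT F2.
  apply: (mUsc U _ _ (fun p : borel_rV R d * borel_rV R d => (p.1 : 'rV[R]_d) + (p.2 : 'rV[R]_d)) mU).
  by apply: measurable_addV.
rewrite (ge0_freezing m1 m2 (increments_indep2 t0 (ltW ltt') t'1 (lexx 1)) mF2); last first.
  by move=> p; rewrite lee_fin.
have inner w : (\int[P]_v F2 (increment W t t' w, increment W t' 1 v) =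
    (gavg (noise beta t') U (x + sb *: (increment W t t' w : 'rV[R]_d)))%:E)%E.
  have := law_ge0 (F := fun y => F2 (increment W t t' w, y)) m2 _ (lW _ _ t'0 t'N (lexx 1)).
  rewrite subr_gt0 => ->//; last 2 first.
  - by apply: (measurableT_comp mF2); exact: measurable_fun_pair.
  - by move=> y; rewrite lee_fin.
  rewrite /gavg gintE; last exact: C11_gint CU.
  apply: eq_integral => z _; rewrite /F2/= noiseE ?subr_ge0//.
  by rewrite scalerDr addrA scalerA.
under eq_integral do rewrite inner.
have gU0 y : (0 <= (gavg (noise beta t') U y)%:E)%E by rewrite lee_fin; apply: (gavg_ge _ _ CU).
have th : 0 < t' - t by rewrite subr_gt0.
rewrite (law_ge0 m1 th (lW _ _ t0 ltt' t'1) (mid _ mU') (fun y => gU0 _)).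
by apply: eq_integral => z _; rewrite scalerA tt'.
Qed.

End semigroup.

Section weak_convergence.
Context {R : realType} {d : nat} (beta : R) (V : 'rV[R]_d -> R) (Lg rho : R).
Hypotheses (Lg0 : 0 < Lg) (rho0 : 0 < rho) (beta0 : 0 < beta).
Hypothesis B : assumptionB beta V Lg rho.
Context {dO : measure_display} {Omega : measurableType dO}
  (P : probability Omega R) (W : R -> Omega -> borel_rV R d).
Hypothesis BW : brownian_motion P W.
Variables (psi : 'rV[R]_d -> R) (K0 : R) (G0 : 'rV[R]_d -> 'rV[R]_d).
Hypotheses (Cpsi : C11 K0 psi G0) (psi01 : forall x, 0 <= psi x <= 1).

Let g := g_beta beta V.
Let sb := Num.sqrt beta.
Let v (c : R) (x : 'rV[R]_d) : R := gavg c psi x * (gavg c g x)^-1.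

Let Cg := C11_g_beta Lg0 B.

Let g_ge x : rho <= g x. Proof. by case: B. Qed.

Let g_ge0 x : 0 <= g x. Proof. exact: le_trans (ltW rho0) (g_ge x). Qed.

Let psi_ge0 x : 0 <= psi x. Proof. by have /andP[] := psi01 x. Qed.

Let gavg_g_gt0 c x : 0 < gavg c g x.
Proof. exact: lt_le_trans rho0 (heat_g_ge Lg0 B c x). Qed.

Let gavg_psi_le c x : `|gavg c psi x| <= 1.
Proof.
by apply: gavg_norm_le Cpsi _ => y; have /andP[? ?] := psi01 y; rewrite ger0_norm.
Qed.

Let v_bound c x : `|v c x| <= rho^-1.
Proof.
rewrite normrM normfV (gtr0_norm (gavg_g_gt0 c x)) -[leRHS]mul1r; apply: ler_pM => //.
  by rewrite invr_ge0 ltW.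
by rewrite lef_pV2 ?posrE// (heat_g_ge Lg0 B).
Qed.

(** One constant for all noise levels [c], which makes the one-step error uniform along the grid and
    in [N]. It also dominates [Lg], so that it serves for the averages of [g] as well. *)
Let C11_v : exists K, Lg <= K /\ forall c, exists Gv, C11 K (v c) Gv.
Proof.
pose Ki := Lg / rho ^+ 2 + 2 * Lg ^+ 2 / rho ^+ 3.
have Ki0 : 0 <= Ki by rewrite addr_ge0// divr_ge0 ?mulr_ge0 ?exprn_ge0 ?ltW.
have ri0 : 0 <= rho^-1 by rewrite invr_ge0 ltW.
have K00 : 0 <= K0 by case: Cpsi.
pose K1 := K0 + Ki + rho^-1 + 1.
have K1sq : 0 <= 4 * K1 ^+ 2 by rewrite mulr_ge0 ?sqr_ge0.
exists (4 * K1 ^+ 2 + Lg); split => [|c]; first by rewrite lerDr.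
have Ci := C11_inv rho0 (C11_gavg c Cg) (fun x => heat_g_ge Lg0 B c x).
have e1 : K0 <= K1 by rewrite /K1; lra.
have e2 : Ki <= K1 by rewrite /K1; lra.
have e3 : 1 <= K1 by rewrite /K1; lra.
have e4 : rho^-1 <= K1 by rewrite /K1; lra.
eexists; apply: (C11_le _ (C11_mul (C11_le e1 (C11_gavg c Cpsi)) (C11_le e2 Ci) _ _)).
- by rewrite lerDl ltW.
- by move=> x; exact: le_trans (gavg_psi_le c x) e3.
- move=> x; apply: le_trans e4; rewrite normfV (gtr0_norm (gavg_g_gt0 c x)) lef_pV2 ?posrE//.
  exact: heat_g_ge Lg0 B c x.
Qed.

Let Y N n w : borel_rV R d := euler beta (f_beta beta V) N (W^~ w) n.

Let c_ N n := noise beta (n%:R / N%:R).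

(* [v] is the backward evolution of [psi / g] under the drifted diffusion, by
   Doob's transform with [gavg _ g]; one Euler step of length [1 / N] changes
   [v] by [O(N^(-3/2))] in mean. *)
Lemma weak_euler : exists2 K : R, 0 <= K & forall N, (0 < N)%N ->
  `|EP P (fun w => psi (Y N N w) / g (Y N N w)) - v (noise beta 0) 0|
    <= K * Num.sqrt N%:R^-1.
Proof.
have [K [LK Cv]] := C11_v.
have mf := measurable_drift (f_beta_lip Lg0 rho0 beta0 B).
exists `|weak_C beta rho K (d := d)| => // N N0.
set q := Num.sqrt N%:R^-1.
have NR0 : 0 < N%:R :> R by rewrite ltr0n.
have q2 : q ^+ 2 = N%:R^-1 by rewrite sqr_sqrtr// invr_ge0 ltW.
have q01 : 0 <= q <= 1.
  rewrite sqrtr_ge0/= -(@ler_pXn2r _ 2) ?nnegrE ?sqrtr_ge0// expr1n q2.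
  by rewrite invf_le1// ler1n.
have mv c : measurable_fun [set: borel_rV R d] (v c).
  by have [Gv Cvc] := Cv c; exact: C11_measurable Cvc.
have mY n : (n <= N)%N -> measurable_fun setT (Y N n).
  by move=> nN; exact: (measurable_euler_W BW beta N0 nN mf).
have bv n c : (n <= N)%N -> bmeas (fun w => v c (Y N n w)).
  move=> nN; split; last by exists rho^-1.
  exact: (measurableT_comp (mv c) (mY n nN)).
have step n : (n < N)%N ->
    `|EP P (fun w => v (c_ N n.+1) (Y N n.+1 w)) - EP P (fun w => v (c_ N n) (Y N n w))|
      <= weak_C beta rho K (d := d) * q ^+ 3.
  move=> nN.
  pose U := gavg (c_ N n.+1) g; pose GU := gavgV (c_ N n.+1) (grad g).
  have CU : C11 K U GU by exact: C11_le LK (C11_gavg _ Cg).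
  have [Gv Cvn] := Cv (c_ N n.+1).
  have sgU x : gavg (c_ N n) g x = gavg (sb * q) U x.
    exact: (gavg_semigroup BW beta x nN Cg g_ge0).
  (* The semigroup law passes to the gradients, because a quadratic expansion determines its linear
     coefficient. *)
  have sgV x : gavgV (c_ N n) (grad g) x = gavgV (sb * q) GU x.
    have [_ h1 _ _ _] := C11_gavg (c_ N n) Cg.
    have [_ h2 _ _ _] := C11_gavg (sb * q) (C11_gavg (c_ N n.+1) Cg).
    rewrite -(grad_of_expansion (ltW Lg0) (h1 x)) -(grad_of_expansion (ltW Lg0) (h2 x)).
    by congr (grad _ x); apply/funext => y; exact: sgU.
  pose F (p : borel_rV R d * borel_rV R d) := v (c_ N n.+1)
    ((p.1 : 'rV[R]_d) + N%:R^-1 *: f_beta beta V p.1 (n%:R / N%:R) + sb *: (p.2 : 'rV[R]_d)).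
  have bF : bmeas F.
    split; last by exists rho^-1 => p; exact: v_bound.
    apply: (measurableT_comp (f := v (c_ N n.+1) : borel_rV R d -> R)) => //.
    apply: measurable_addV; last by apply: measurable_scaleV => //; exact: measurable_cst.
    apply: measurable_addV => //; apply: measurable_scaleV; first exact: measurable_cst.
    exact: (measurableT_comp (mf _) measurable_fst).
  have {}mY := mY n (ltnW nN).
  have mI := measurable_inc BW N0 nN.
  have YI : indep2 P (Y N n) (inc W N n).
    apply: (indep_past (fun i iN => measurable_inc BW N0 iN) (inc_indep BW N0) nN).
    by apply: euler_past; [exact: mf|exact: leqnn].
  have E1 : EP P (fun w => v (c_ N n.+1) (Y N n.+1 w)) =
      EP P (fun w => gavg (sb * q) (v (c_ N n.+1))
        ((Y N n w : 'rV[R]_d) + q ^+ 2 *: f_beta beta V (Y N n w) (n%:R / N%:R))).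
    rewrite -[LHS]/(EP P (fun w => F (Y N n w, inc W N n w))) (freezing mY mI YI bF).
    congr (EP P); apply/funext => w.
    have mFy : measurable_fun [set: borel_rV R d] (fun y => F (Y N n w, y)).
      by case: bF => mF _; apply: (measurableT_comp mF); exact: measurable_fun_pair.
    have hN : 0 < N%:R^-1 :> R by rewrite invr_gt0.
    transitivity (gE (fun z => F (Y N n w, Num.sqrt N%:R^-1 *: z))).
      exact: (law_gE mI hN (inc_law BW N0 nN) mFy).
    suff -> : (fun z => F (Y N n w, Num.sqrt N%:R^-1 *: z)) =
        (fun z => v (c_ N n.+1) ((Y N n w : 'rV[R]_d) +
          q ^+ 2 *: f_beta beta V (Y N n w) (n%:R / N%:R) + (sb * q) *: z)) by [].
    by rewrite q2; apply/funext => z; rewrite /F (scalerA sb).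
  have bE : bmeas (fun w => gavg (sb * q) (v (c_ N n.+1))
        ((Y N n w : 'rV[R]_d) + q ^+ 2 *: f_beta beta V (Y N n w) (n%:R / N%:R))).
    split; last by exists rho^-1 => w; apply: gavg_norm_le Cvn _ => y; exact: v_bound.
    apply: (measurableT_comp (f := gavg (sb * q) (v (c_ N n.+1)) : borel_rV R d -> R)).
      exact: C11_measurable (C11_gavg _ Cvn).
    apply: measurable_addV => //; apply: measurable_scaleV; first exact: measurable_cst.
    exact: (measurableT_comp (mf _) mY).
  have b2 := bv n (c_ N n) (ltnW nN).
  have E2 := etrans (congr1 (fun r => r - EP P (fun w => v (c_ N n) (Y N n w))) E1)
    (esym (EPB P bE b2)).
  apply: (eq_ind_r (fun r => `|r| <= _) _ E2).
  apply: EP_norm_le => [|w]; first exact: bmeasB bE b2.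
  (* Multiplying [v] by [U] restores the average of [psi], so numerator and denominator both follow
     the heat semigroup. *)
  have vE x : v (c_ N n) x =
      gavg (sb * q) (fun y => v (c_ N n.+1) y * U y) x / gavg (sb * q) U x.
    rewrite {1}/v sgU (gavg_semigroup BW beta _ nN Cpsi psi_ge0) -/(c_ N n.+1).
    congr (gavg _ _ x / _); apply/funext => y.
    by rewrite /v -mulrA mulVf ?mulr1// gt_eqF.
  have fE x : f_beta beta V x (n%:R / N%:R) =
      beta *: ((gavg (sb * q) U x)^-1 *: gavgV (sb * q) GU x).
    by rewrite (f_betaE Lg0 rho0 B) sgU sgV.
  rewrite vE fE; apply: (weak_one_step beta0 rho0 _ CU Cvn) => // y.
  exact: heat_g_ge Lg0 B _ y.
have tele (e : nat -> R) (a b r : R) : e N = a -> e 0%N = b ->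
    (forall n, (n < N)%N -> `|e n.+1 - e n| <= r) -> `|a - b| <= N%:R * r.
  move=> <- <- er; elim: {-2}N (leqnn N) => [_|n IH nN]; first by rewrite subrr normr0 mul0r.
  rewrite -(subrKA (e n)); apply: le_trans (ler_normD _ _) _.
  by rewrite -natr1 mulrDl mul1r addrC; apply: lerD; [exact: IH (ltnW nN)|exact: er].
have cN : c_ N N = 0 by rewrite /c_ /noise divff ?gt_eqF// subrr mul0r sqrtr0.
have -> : `|weak_C beta rho K (d := d)| * q = N%:R * (`|weak_C beta rho K (d := d)| * q ^+ 3).
  by rewrite exprS q2; field; rewrite gt_eqF.
apply: (tele (fun n => EP P (fun w => v (c_ N n) (Y N n w)))) => [||n nN].
- congr (EP P); apply/funext => w; rewrite /v cN.
  by rewrite !gavg0.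
- have c0 : c_ N 0 = noise beta 0 by rewrite /c_ mul0r.
  by rewrite c0; exact: (EP_cst P (v (noise beta 0) 0)).
- by apply: le_trans (step n nN) _; rewrite ler_wpM2r ?exprn_ge0 ?sqrtr_ge0// ler_norm.
Qed.

End weak_convergence.

(** * Law of the limit of the Euler schemes *)

(** Peeling off the first term with [(p + q)^2 <= 2 p^2 + 2 q^2] doubles the weight of all later
    terms. Increments with mean square of order [4 ^ (- k)] can afford the weights [2 ^ k]. *)
Lemma sum_sq_le {R : realType} (a : nat -> R) n :
  (\sum_(k < n) a k) ^+ 2 <= 2 * \sum_(k < n) 2 ^+ k * a k ^+ 2.
Proof.
elim: n a => [|n IH] a; first by rewrite !big_ord0 expr0n/= mulr0.
rewrite !big_ord_recl/= expr0 mul1r.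
have -> : \sum_(i < n) 2 ^+ (bump 0 i) * a (bump 0 i) ^+ 2 =
    2 * \sum_(i < n) 2 ^+ i * a i.+1 ^+ 2.
  by rewrite mulr_sumr; apply: eq_bigr => i _; rewrite /bump/= add1n exprS mulrA.
have := IH (fun k => a k.+1); set S := \sum_(i < n) a i.+1.
set T := \sum_(i < n) 2 ^+ i * a i.+1 ^+ 2 => h.
have := sqr_ge0 (a 0%N - S); lra.
Qed.

Lemma enorm_telescope_sq {R : realType} d (x : nat -> 'rV[R]_d) n :
  enorm (x n - x 0%N) ^+ 2 <= 2 * \sum_(k < n) 2 ^+ k * enorm (x k.+1 - x k) ^+ 2.
Proof.
apply: le_trans (sum_sq_le (fun k => enorm (x k.+1 - x k)) n).
have -> : x n - x 0%N = \sum_(k < n) (x k.+1 - x k).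
  elim: n => [|n IH]; first by rewrite big_ord0 subrr.
  by rewrite big_ord_recr/= -IH addrC subrKA.
by rewrite lerXn2r ?nnegrE ?enorm_ge0 ?sumr_ge0 ?enorm_sum// => *; exact: enorm_ge0.
Qed.

Lemma cvg_enorm_sqr {R : realType} d (x : nat -> 'rV[R]_d) (y z : 'rV[R]_d) :
  (forall i, x n ord0 i @[n --> \oo] --> y ord0 i) ->
  enorm (x n - z) ^+ 2 @[n --> \oo] --> enorm (y - z) ^+ 2.
Proof.
move=> xy; rewrite enorm_sqr; under eq_fun do rewrite enorm_sqr.
rewrite /dot; apply: cvg_big => [|i _]; first exact: add_continuous.
rewrite !mxE; under eq_fun do rewrite !mxE.
by apply: cvgM; apply: cvgB => //; exact: cvg_cst.
Qed.

Lemma cvg_of_sum_sq {R : realType} (x : nat -> R) (s : R) :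
  (forall n, \sum_(k < n) 2 ^+ k * (x k.+1 - x k) ^+ 2 <= s) -> cvgn x.
Proof.
move=> xs; pose u := telescope x.
have cu : cvgn (series (fun k => `|u k|)).
  apply: nondecreasing_is_cvgn.
    by move=> m n mn; apply: nondecreasing_series => // k _ _; rewrite normr_ge0.
  (* A partial sum [S] satisfies [S^2 <= 2 s], and [2 S <= 1 + S^2]. *)
  exists (1 + s) => _ [n _ <-]; rewrite /series/= big_mkord.
  have /= h := sum_sq_le (fun k => `|u k|) n.
  have e : \sum_(k < n) 2 ^+ k * `|u k| ^+ 2 <= s.
    by apply: le_trans (xs n); apply: ler_sum => k _; rewrite real_normK ?num_real.
  have := sqr_ge0 (\sum_(k < n) `|u k| - 1); lra.
have := normed_cvg cu.
have -> : x = (fun n => x 0%N + series u n) by apply/funext => n; exact: eq_sum_telescope.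
by move=> c; apply: is_cvgD => //; exact: is_cvg_cst.
Qed.

(** * Almost sure and mean-square limit of a geometrically convergent sequence *)

Section strong_limit.
Context {R : realType} {dO : measure_display} {Omega : measurableType dO}
  (P : probability Omega R) {d : nat} (X : nat -> Omega -> borel_rV R d) (C : R).
Hypothesis mX : forall k, measurable_fun setT (X k).
Hypothesis XC : forall k,
  (\int[P]_w (enorm ((X k.+1 w : 'rV[R]_d) - (X k w : 'rV[R]_d)) ^+ 2)%:E <= (C / 4 ^+ k)%:E)%E.

Let a k w := enorm ((X k.+1 w : 'rV[R]_d) - (X k w : 'rV[R]_d)) ^+ 2.
Let G w := (\sum_(0 <= k <oo) (2 ^+ k * a k w)%:E)%E.
Let E : set Omega := [set w | (G w < +oo)%E].

Let a_ge0 k w : 0 <= a k w. Proof. exact: sqr_ge0. Qed.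

Let term_ge0 k w : (0 <= (2 ^+ k * a k w)%:E)%E.
Proof. by rewrite lee_fin mulr_ge0// exprn_ge0. Qed.

Let ma k : measurable_fun setT (a k).
Proof. by apply: measurable_funX; apply: measurable_enorm; exact: measurable_subV. Qed.

Let mterm k : measurable_fun setT (fun w => (2 ^+ k * a k w)%:E).
Proof. by apply/measurable_EFinP; apply: measurable_funM. Qed.

Let mG : measurable_fun setT G.
Proof. by apply: ge0_emeasurable_sum => k *. Qed.

Let G_ge0 w : (0 <= G w)%E.
Proof. by apply: nneseries_ge0 => k _ _. Qed.

Let mE : measurable E.
Proof. by have := emeasurable_fun_infty_o measurableT mG +oo%E; rewrite setTI. Qed.

Let C_ge0 : 0 <= C.
Proof.
rewrite -[C]divr1 -[1](expr0 4) -lee_fin; apply: le_trans (XC 0).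
by apply: integral_ge0 => w _; rewrite lee_fin sqr_ge0.
Qed.

Let intG : (\int[P]_w G w <= (2 * C)%:E)%E.
Proof.
rewrite integral_nneseries//.
apply: lime_le; first by apply: is_cvg_nneseries => k _ _; apply: integral_ge0 => w _.
apply: nearW => n; rewrite big_mkord.
(* The weight [2 ^ k] against [4 ^ (- k)] leaves a geometric series of sum [2 * C]. A further factor
   2 from [sum_sq_le] makes the [4 * C] of [strong_limit]. *)
apply: (@le_trans _ _ (\sum_(k < n) (C * 2^-1 ^+ k)%:E)%E).
  apply: lee_sum => k _; under eq_integral do rewrite EFinM.
  rewrite ge0_integralZl_EFin ?exprn_ge0//; last 2 first.
  - by move=> w _; rewrite lee_fin.
  - exact/measurable_EFinP.
  apply: le_trans (lee_wpmul2l _ (XC k)) _; first by rewrite lee_fin exprn_ge0.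
  rewrite -EFinM lee_fin (_ : 4 = 2 * 2) ?exprMn; last by ring.
  by rewrite le_eqVlt (_ : _ == _)// exprVn; apply/eqP; field; rewrite expf_neq0.
rewrite sumEFin lee_fin.
have := @geometric_le_lim R n C 2^-1 C_ge0; rewrite gtr0_norm ?invr_gt0//.
rewrite /series/= big_mkord => h; apply: le_trans (h _ _) _ => //.
  by rewrite invf_lt1//; lra.
by rewrite le_eqVlt (_ : _ == _)//; apply/eqP; field.
Qed.

Let aeE : {ae P, forall w, E w}.
Proof.
have iG : P.-integrable setT G.
  apply/integrableP; split => //.
  under eq_integral do rewrite gee0_abs//.
  exact: le_lt_trans intG (ltry _).
have := integrable_ae measurableT iG; apply: filterS => w /(_ I).
by rewrite ge0_fin_numE.
Qed.

Let partial w n : E w -> \sum_(k < n) 2 ^+ k * a k w <= fine (G w).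
Proof.
move=> Ew; have Gf : G w \is a fin_num by rewrite ge0_fin_numE.
rewrite -lee_fin fineK// -sumEFin.
have := nneseries_lim_ge n (fun k _ _ => term_ge0 k w) (m := 0%N) (P := xpredT).
by rewrite big_mkord.
Qed.

(** Off the event [E], of full measure, the sequence is frozen at [X 0]. It then converges
    everywhere, which makes the limit measurable, and the distance to [X 0] is zero there. *)
Let X' k w : 'rV[R]_d := if `[< E w >] then X k w else X 0 w.

Let mX' k : measurable_fun setT (X' k : Omega -> borel_rV R d).
Proof.
apply: measurable_fun_ifT => //; apply: (measurable_fun_bool true).
rewrite setTI (_ : _ @^-1` _ = E)//; apply/seteqP; split => w /=.
  by move/asboolP.
by move=> Ew; apply/asboolP.
Qed.

Let Y w : borel_rV R d := \row_i limn (fun k => X' k w ord0 i).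

Let cX' w i : cvgn (fun k => X' k w ord0 i).
Proof.
rewrite /X'; case: asboolP => Ew; last exact: is_cvg_cst.
apply: (@cvg_of_sum_sq _ _ (fine (G w))) => n; apply: le_trans (partial n Ew).
apply: ler_sum => k _; rewrite ler_wpM2l ?exprn_ge0// /a.
rewrite -[leLHS]real_normK ?num_real//.
rewrite lerXn2r ?nnegrE ?normr_ge0 ?enorm_ge0//.
by have := normr_coord_le ((X k.+1 w : 'rV[R]_d) - (X k w : 'rV[R]_d)) i; rewrite !mxE.
Qed.

Let X'Y w i : X' k w ord0 i @[k --> \oo] --> (Y w : 'rV[R]_d) ord0 i.
Proof. by rewrite mxE; exact: cX'. Qed.

(* By Cauchy-Schwarz with the weights [2 ^ k], the square of the total variation
   of [X] is at most [2 * G]. *)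
Lemma strong_limit : exists Y0 : Omega -> borel_rV R d,
  [/\ measurable_fun setT Y0,
      {ae P, forall w, forall i,
        (X k w : 'rV[R]_d) ord0 i @[k --> \oo] --> (Y0 w : 'rV[R]_d) ord0 i} &
      (\int[P]_w (enorm ((Y0 w : 'rV[R]_d) - (X 0%N w : 'rV[R]_d)) ^+ 2)%:E <= (4 * C)%:E)%E].
Proof.
have mY : measurable_fun setT Y.
  apply: measurable_fun_rV => i.
  apply: (measurable_fun_cvg (h := fun k w => X' k w ord0 i)) => [k|w _]; last exact: X'Y.
  exact: measurable_fun_coord.
exists Y; split => //.
  apply: filterS aeE => w Ew i; have := @X'Y w i.
  by rewrite /X'; case: asboolP.
have bound w : ((enorm ((Y w : 'rV[R]_d) - (X 0%N w : 'rV[R]_d)) ^+ 2)%:E <= 2%:E * G w)%E.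
  have := cvg_enorm_sqr (z := X 0%N w) (@X'Y w); rewrite /X'; case: asboolP => Ew c.
    rewrite -[G w]fineK; last by rewrite ge0_fin_numE.
    rewrite -EFinM lee_fin -(cvg_lim _ c)//; apply: limr_le; first by apply/cvg_ex; eexists; exact: c.
    apply: nearW => n; apply: le_trans (enorm_telescope_sq (fun k => X k w : 'rV[R]_d) n) _.
    by rewrite ler_wpM2l//; exact: partial.
  rewrite -(cvg_lim _ c)// lim_cst// subrr enorm0 expr0n/=.
  exact: mule_ge0.
apply: (@le_trans _ _ (\int[P]_w (2%:E * G w))%E).
  apply: ge0_le_integral => //.
  - by move=> w _; rewrite lee_fin sqr_ge0.
  - apply/measurable_EFinP; apply: measurable_funX; apply: measurable_enorm.
    exact: measurable_subV.
  - exact: measurable_funeM.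
rewrite ge0_integralZl_EFin//.
apply: le_trans (lee_wpmul2l _ intG) _; first by rewrite lee_fin.
by rewrite -EFinM lee_fin le_eqVlt (_ : _ == _)//; apply/eqP; ring.
Qed.

End strong_limit.

Section density_measure.
Context {dT : measure_display} {T : measurableType dT} {R : realType}.
Variables (mu : {measure set T -> \bar R}) (f : T -> R).
Hypotheses (mf : measurable_fun setT f) (f0 : forall x, 0 <= f x).

Let density (A : set T) : \bar R := (\int[mu]_(x in A) (f x)%:E)%E.

Let density0 : density set0 = 0%E. Proof. exact: integral_set0. Qed.

Let density_ge0 A : (0 <= density A)%E.
Proof. by apply: integral_ge0 => x _; rewrite lee_fin. Qed.

Let density_sigma_additive : semi_sigma_additive density.
Proof.
move=> F mF tF mUF.
have ff0 x : (0 <= (f x)%:E)%E by rewrite lee_fin.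
rewrite {2}/density ge0_integral_bigcup//; last first.
  by apply/measurable_EFinP; exact: measurable_funS mf.
by apply: is_cvg_ereal_nneg_natsum_cond => n _ _; exact: integral_ge0.
Qed.

Definition density_measure : {measure set T -> \bar R} :=
  HB.pack_for (Measure.type T R) density
    (isMeasure.Build _ T R density density0 density_ge0 density_sigma_additive).

Lemma density_measureE A : density_measure A = (\int[mu]_(x in A) (f x)%:E)%E.
Proof. by []. Qed.

End density_measure.

Lemma cvg_Rintegral {dT : measure_display} {T : measurableType dT} {R : realType}
    (m : {measure set T -> \bar R}) (u : nat -> T -> R) (v K : T -> R) :
  (forall n, measurable_fun setT (u n)) -> measurable_fun setT v ->
  {ae m, forall x, u n x @[n --> \oo] --> v x} ->
  m.-integrable setT (EFin \o K) -> (forall n x, `|u n x| <= K x) ->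
  (\int[m]_x u n x)%R @[n --> \oo] --> (\int[m]_x v x)%R.
Proof.
move=> mu mv uv iK uK.
have [] := @dominated_convergence _ _ _ m setT measurableT
  (fun n x => (u n x)%:E) (EFin \o v) (EFin \o K).
- by move=> n; exact/measurable_EFinP.
- exact/measurable_EFinP.
- by apply: filterS uv => x h _; apply: cvg_EFin h; exact: nearW.
- exact: iK.
- by apply: nearW => x n _; exact: uK.
move=> iv _ c.
apply: fine_cvg; rewrite /Rintegral fineK; last exact: integrable_fin_num iv.
exact: c.
Qed.

(** * Approximation of the indicators of boxes *)

Section bumps.
Context {R : realType} {d : nat}.
Implicit Types (a b : 'I_d -> R) (x : 'rV[R]_d).

Lemma cvg_cutoff (t : R) : cutoff (k.+1%:R * t) @[k --> \oo] --> ((0 < t)%R%:R : R).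
Proof.
case: ltP => t0; last first.
  by under eq_fun do rewrite cutoff_le0 ?mulr_ge0_le0//; exact: cvg_cst.
rewrite -[X in _ --> X]subr0; apply: cvgB; first exact: cvg_cst.
apply: (@squeeze_cvgr _ _ _ _ (cst 0) (fun k => t^-1 * harmonic k)).
- apply: nearW => k; have s0 : 0 < k.+1%:R * t by rewrite mulr_gt0.
  have -> : Num.max (k.+1%:R * t) 0 = k.+1%:R * t by apply/max_idPl; exact: ltW.
  have r0 : 0 < 1 + (k.+1%:R * t) ^+ 2 by rewrite ltr_pwDl ?sqr_ge0.
  apply/andP; split; first by rewrite /cst invr_ge0 ltW.
  rewrite /harmonic /= -invfM [t * _]mulrC lef_pV2 ?posrE//.
  have := sqr_ge0 (k.+1%:R * t - 1); move: (k.+1%:R * t) s0 => s; lra.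
- exact: cvg_cst.
- rewrite -[X in _ --> X](mulr0 t^-1); apply: cvgM; first exact: cvg_cst.
  exact: cvg_harmonic.
Qed.

(** Since [cutoff] vanishes at 0, every bump vanishes on the boundary of the box, and the limit is
    the indicator of the open box at every point. *)
Definition box_bump a b (k : nat) x : R :=
  \prod_(i < d) (cutoff (k.+1%:R * (x ord0 i - a i)) * cutoff (k.+1%:R * (b i - x ord0 i))).

Lemma cvg_box_bump a b x : box_bump a b k x @[k --> \oo] --> (\1_(box a b) x : R).
Proof.
have -> : \1_(box a b) x = \prod_(i < d) ((0 < x ord0 i - a i)%R%:R * (0 < b i - x ord0 i)%R%:R) :> R.
  rewrite indicE; have [xb|/asboolPn/existsNP[i xi]] := boolP (x \in box a b).
    rewrite big1// => i _; have := set_mem xb i.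
    by rewrite in_itv/= !subr_gt0 => /andP[-> ->]; rewrite mulr1.
  apply/esym/eqP; rewrite (bigD1 i)//= mulf_eq0; apply/orP; left.
  move: xi; rewrite in_itv/= !subr_gt0.
  by case: (a i < _) => //=; case: (_ < b i) => //=; rewrite ?mulr0 ?mul0r.
apply: cvg_big => [|i _]; first exact: mul_continuous.
by apply: cvgM; exact: cvg_cutoff.
Qed.

Lemma box_bump01 a b k x : 0 <= box_bump a b k x <= 1.
Proof.
rewrite prodr_ge0/= => [|i _]; last by rewrite mulr_ge0 ?cutoff_ge0.
by apply: prodr_ile1 => i _; rewrite mulr_ge0 ?cutoff_ge0//= mulr_ile1 ?cutoff_ge0 ?cutoff_le1.
Qed.

(** Functions with values in [[0, 1]] and the [C11] property are stable under products. The
    constants grow with [k] and [d], but each [k] is used separately. *)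
Lemma C11_box_bump a b k : exists K G, C11 K (box_bump a b k) G.
Proof.
pose ok (f : 'rV[R]_d -> R) := (exists K G, C11 K f G) /\ forall x, 0 <= f x <= 1.
have okM f g : ok f -> ok g -> ok (fun x => f x * g x).
  move=> [[K [F CF]] f01] [[L [G CG]] g01]; split; last first.
    move=> x; have /andP[? ?] := f01 x; have /andP[? ?] := g01 x.
    by rewrite mulr_ge0//= mulr_ile1.
  have K0 : 0 <= K by case: CF.
  have L0 : 0 <= L by case: CG.
  have KM : K <= K + L + 1 by lra.
  have LM : L <= K + L + 1 by lra.
  exists (4 * (K + L + 1) ^+ 2); eexists.
  apply: (C11_mul (C11_le KM CF) (C11_le LM CG)) => x.
    by have /andP[? ?] := f01 x; rewrite ger0_norm//; lra.
  by have /andP[? ?] := g01 x; rewrite ger0_norm//; lra.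
have okc i (r c : R) : ok (fun x => cutoff (r * x ord0 i + c)).
  split; last by move=> x; rewrite cutoff_ge0 cutoff_le1.
  by do 2 eexists; exact: C11_cutoff.
suff [] : ok (box_bump a b k) by [].
rewrite /box_bump; elim: (index_enum _) => [|i s IH].
  under eq_fun do rewrite big_nil; split; last by move=> x; rewrite ler01 lexx.
  by do 2 eexists; exact: C11_cst.
under eq_fun do rewrite big_cons; apply: (okM _ _ _ IH); apply: (okM).
  by under eq_fun do rewrite mulrBr; exact: okc.
by under eq_fun do rewrite mulrBr addrC -mulNr; exact: okc.
Qed.

End bumps.

Lemma cvg_lipschitz {R : realType} d (f : 'rV[R]_d -> R) (K : R) (x : nat -> 'rV[R]_d)
    (y : 'rV[R]_d) :
  (forall u v, `|f u - f v| <= K * enorm (u - v)) ->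
  (forall i, x n ord0 i @[n --> \oo] --> y ord0 i) ->
  f (x n) @[n --> \oo] --> f y.
Proof.
move=> fK xy; have h : enorm (x n - y) @[n --> \oo] --> (0 : R).
  have h1 := cvg_enorm_sqr (z := y) xy; rewrite subrr enorm0 expr0n/= in h1.
  have h2 : Num.sqrt (enorm (x n - y) ^+ 2) @[n --> \oo] --> Num.sqrt (0 : R).
    by apply: (continuous_cvg _ _ h1); exact: sqrt_continuous.
  rewrite sqrtr0 in h2.
  apply: cvg_trans h2; apply: near_eq_cvg; apply: nearW => n /=.
  by rewrite sqrtr_sqr ger0_norm ?enorm_ge0.
apply/cvgrPdist_le => e e0.
have Ke : 0 < e / (`|K| + 1) by rewrite divr_gt0// ltr_wpDl.
move/cvgr0_norm_le : h => /(_ _ Ke); apply: filterS => n.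
rewrite ger0_norm ?enorm_ge0// ler_pdivlMr ?ltr_wpDl// => h.
rewrite distrC; apply: le_trans (fK _ _) _; apply: le_trans h.
rewrite mulrC ler_wpM2l ?enorm_ge0//; have := ler_norm K; lra.
Qed.

(** * Identification of the law of the limit *)

Section target.
Context {R : realType} {d : nat} (beta : R) (V : 'rV[R]_d -> R) (Lg rho : R).
Hypotheses (Lg0 : 0 < Lg) (rho0 : 0 < rho) (beta0 : 0 < beta).
Hypothesis B : assumptionB beta V Lg rho.
Variable mu : probability (borel_rV R d) R.
Hypothesis Gibbs : gibbs_target V mu.

Let g := g_beta beta V.

Let g_ge x : rho <= g x. Proof. by case: B. Qed.

Let gp x : 0 < g x. Proof. exact: lt_le_trans rho0 (g_ge x). Qed.

Let mg : measurable_fun [set: borel_rV R d] g.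
Proof. exact: C11_measurable (C11_g_beta Lg0 B). Qed.

Let mginv : measurable_fun [set: borel_rV R d] (fun x => (g x)^-1).
Proof. exact: C11_measurable (C11_inv rho0 (C11_g_beta Lg0 B) g_ge). Qed.

(** The normalising power and the quadratic exponential in [g_beta] are the inverses of those in
    [gauss_pdf]; what is left is [exp (- V)] over the partition function. *)
Lemma gauss_g_target A : measurable A ->
  (\int[@gauss_rV R d beta]_(x in A) (g x)%:E = mu A)%E.
Proof.
move=> mA; have [mV _ ->//] := Gibbs.
have Z0 : 0 <= (partition_function V)^-1.
  by rewrite invr_ge0 /partition_function /Rintegral fine_ge0//; apply: integral_ge0.
have mexp : measurable_fun [set: borel_rV R d] (fun x : borel_rV R d => expR (- V x)).
  by apply: measurableT_comp => //; exact: measurableT_comp.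
have mind : measurable_fun [set: borel_rV R d] (\1_A : _ -> R) by exact: measurable_indic.
rewrite integral_mkcond [in RHS]integral_mkcond !epatch_indic.
have mF : measurable_fun [set: borel_rV R d] (fun x => ((g x)%:E * (\1_A x)%:E)%E).
  by apply/measurable_EFinP; exact: measurable_funM.
have mH : measurable_fun [set: borel_rV R d] (fun x => ((expR (- V x))%:E * (\1_A x)%:E)%E).
  by apply/measurable_EFinP; exact: measurable_funM.
have F0 x : (0 <= (g x)%:E * (\1_A x)%:E)%E by rewrite -EFinM lee_fin mulr_ge0// ltW.
have H0 x : (0 <= (expR (- V x))%:E * (\1_A x)%:E)%E.
  by rewrite -EFinM lee_fin mulr_ge0 ?expR_ge0.
rewrite (ge0_integral_gauss _ mF F0).
rewrite -(ge0_integralZl_EFin _ measurableT _ mH Z0); last by move=> x _; exact: H0.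
apply: eq_integral => x _; rewrite -!EFinM; congr EFin.
rewrite [LHS]mulrAC [RHS]mulrA; congr (_ * _); rewrite /g /g_beta /gauss_pdf powRN.
rewrite expRD !expRN.
have := expR_gt0 (enorm x ^+ 2 / (2 * beta)).
have : 0 < (2 * pi * beta) `^ (d%:R / 2) by rewrite powR_gt0// !mulr_gt0// pi_gt0.
move: (expR (enorm x ^+ 2 / (2 * beta))) => e.
move: ((2 * pi * beta) `^ (d%:R / 2)) (partition_function V)^-1 (expR (V x))^-1 => p zi v p0 e0.
by field; rewrite !gt_eqF.
Qed.

(** At the starting point 0 the average of [g] is the total mass of [mu], so the initial value of
    the transported quotient is just the Gaussian mean of [psi]. *)
Lemma gavg_g_1 : gavg (noise beta 0) g 0 = 1.
Proof.
have sb : Num.sqrt beta != 0 by rewrite gt_eqF// sqrtr_gt0.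
apply/EFin_inj; rewrite /gavg gintE; last exact: C11_gint (C11_g_beta Lg0 B).
rewrite /noise subr0 mul1r; under eq_integral do rewrite add0r.
rewrite (gauss_rV_scale sb (b := 1) (F := fun x => (g x)%:E))//; last 2 first.
- exact/measurable_EFinP.
- by move=> x; rewrite lee_fin ltW.
by rewrite sqr_sqrtr ?(ltW beta0)// mulr1 gauss_g_target// probability_setT.
Qed.

Context {dO : measure_display} {Omega : measurableType dO}
  (P : probability Omega R) (W : R -> Omega -> borel_rV R d).
Hypothesis BW : brownian_motion P W.
Variables (N : nat -> nat) (Y : Omega -> borel_rV R d).
Hypotheses (N0 : forall k, (0 < N k)%N) (Noo : (N k)%:R^-1 @[k --> \oo] --> (0 : R)).
Hypothesis mY : measurable_fun setT Y.
Let X k w : 'rV[R]_d := euler beta (f_beta beta V) (N k) (W^~ w) (N k).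
Hypothesis XY : {ae P, forall w, forall i,
  X k w ord0 i @[k --> \oo] --> (Y w : 'rV[R]_d) ord0 i}.

Let ginv_gt0 x : 0 < (g x)^-1. Proof. by rewrite invr_gt0. Qed.

Let ginv_bound x : `|(g x)^-1| <= rho^-1.
Proof. by rewrite gtr0_norm ?invr_gt0// lef_pV2 ?posrE. Qed.

(** The quotient [psi / g] is continuous and bounded by [1 / rho], so dominated convergence carries
    the weak estimate, whose error vanishes with the step, over to the limit. *)
Let EP_limit (psi : 'rV[R]_d -> R) K G : C11 K psi G -> (forall x, 0 <= psi x <= 1) ->
  EP P (fun w => psi (Y w) / g (Y w)) = gE (fun z => psi (Num.sqrt beta *: z)).
Proof.
move=> Cpsi psi01; have [K1 K10 wk] := weak_euler Lg0 rho0 beta0 B BW Cpsi psi01.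
have mpsi := C11_measurable Cpsi.
have mq (Z : Omega -> borel_rV R d) : measurable_fun setT Z ->
    measurable_fun setT (fun w => psi (Z w) / g (Z w)).
  move=> mZ; apply: measurable_funM; first exact: (measurableT_comp mpsi mZ).
  exact: (measurableT_comp mginv mZ).
have mX k : measurable_fun setT (X k : Omega -> borel_rV R d).
  exact: (measurable_euler_W BW beta (N0 k) (leqnn _)
    (measurable_drift (f_beta_lip Lg0 rho0 beta0 B))).
have c1 : EP P (fun w => psi (X k w) / g (X k w)) @[k --> \oo] -->
    EP P (fun w => psi (Y w) / g (Y w)).
  apply: (@cvg_Rintegral _ _ _ _ _ _ (fun=> rho^-1)) => [k||||k w].
  - exact: mq.
  - exact: mq.
  - apply: filterS XY => w h.
    have [_ _ _ _ l1] := Cpsi; have [_ _ _ _ l2] := C11_g_beta Lg0 B.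
    apply: cvgM; first exact: cvg_lipschitz l1 h.
    by apply: cvgV; [rewrite gt_eqF|exact: cvg_lipschitz l2 h].
  - exact: finite_measure_integrable_cst.
  - rewrite normrM -[leRHS]mul1r ler_pM//.
    by have /andP[? ?] := psi01 (X k w); rewrite ger0_norm.
have c2 : EP P (fun w => psi (X k w) / g (X k w)) @[k --> \oo] -->
    (gE (fun z => psi (Num.sqrt beta *: z)) : R).
  have E : gE (fun z => psi (Num.sqrt beta *: z)) =
      gavg (noise beta 0) psi 0 * (gavg (noise beta 0) g 0)^-1.
    rewrite gavg_g_1 invr1 mulr1 /gavg /noise subr0 mul1r; congr gE.
    by apply/funext => z; rewrite add0r.
  rewrite E; apply/cvgrPdist_le => e e0.
  have c3 : K1 * Num.sqrt (N k)%:R^-1 @[k --> \oo] --> (0 : R).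
    rewrite -[X in _ --> X](mulr0 K1); apply: cvgM; first exact: cvg_cst.
    by rewrite -(@sqrtr0 R); apply: (continuous_cvg _ _ Noo); exact: sqrt_continuous.
  move/cvgr0_norm_le : c3 => /(_ _ e0); apply: filterS => k.
  rewrite ger0_norm ?mulr_ge0 ?sqrtr_ge0// => h.
  by rewrite distrC; apply: le_trans h; exact: wk.
exact: (cvg_unique _ c1 c2).
Qed.

Let nu := pushforward_measure P mY.
(** The law of [Y] divided by [g], to be recognised as the Gaussian. Dividing keeps all integrands
    bounded; [g] is multiplied back only in [limit_law], where the measures are already equal. *)
Let m1 := density_measure nu mginv (fun x => ltW (ginv_gt0 x)).

Let m1_box a b : m1 (box a b) = @gauss_rV R d beta (box a b).
Proof.
have mA := measurable_box a b.
have mind : measurable_fun [set: borel_rV R d] (\1_(box a b) : _ -> R).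
  exact: measurable_indic.
have ind1 (x : borel_rV R d) : `|\1_(box a b) x : R| <= 1.
  by rewrite indicE; case: (_ \in _); rewrite ?normr1 ?normr0.
have mb k : measurable_fun [set: borel_rV R d] (box_bump a b k).
  by have [K [G C]] := C11_box_bump a b k; exact: C11_measurable C.
have b1 k x : `|box_bump a b k x| <= 1.
  by have /andP[? ?] := box_bump01 a b k x; rewrite ger0_norm.
have sb : Num.sqrt beta != 0 by rewrite gt_eqF// sqrtr_gt0.
have msc := measurable_scale_rV (R := R) (d := d) (Num.sqrt beta).
have mq (f : borel_rV R d -> R) : measurable_fun setT f ->
    measurable_fun setT (fun w => f (Y w) / g (Y w)).
  move=> mf; apply: measurable_funM; first exact: (measurableT_comp mf mY).
  exact: (measurableT_comp mginv mY).
have q1 (f : borel_rV R d -> R) : (forall x, `|f x| <= 1) -> forall w, `|f (Y w) / g (Y w)| <= rho^-1.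
  by move=> f1 w; rewrite normrM -[leRHS]mul1r ler_pM.
have c1 : EP P (fun w => box_bump a b k (Y w) / g (Y w)) @[k --> \oo] -->
    EP P (fun w => \1_(box a b) (Y w) / g (Y w)).
  apply: (@cvg_Rintegral _ _ _ _ _ _ (fun=> rho^-1)) => [k||||k w].
  - exact: mq.
  - exact: mq.
  - apply: nearW => w; apply: cvgM; last exact: cvg_cst.
    exact: cvg_box_bump.
  - exact: finite_measure_integrable_cst.
  - exact: (q1 (box_bump a b k)).
have c2 : gE (fun z => box_bump a b k (Num.sqrt beta *: z)) @[k --> \oo] -->
    gE (fun z => (\1_(box a b) (Num.sqrt beta *: z) : R)).
  apply: (@cvg_Rintegral _ _ _ _ _ _ (fun=> 1)) => [k||||k w].
  - exact: (measurableT_comp (mb k) msc).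
  - exact: (measurableT_comp mind msc).
  - apply: nearW => w; exact: cvg_box_bump.
  - exact: gint_cst.
  - exact: b1.
have E : EP P (fun w => \1_(box a b) (Y w) / g (Y w)) =
    gE (fun z => (\1_(box a b) (Num.sqrt beta *: z) : R)).
  have E0 : (fun k => EP P (fun w => box_bump a b k (Y w) / g (Y w))) =
      (fun k => gE (fun z => box_bump a b k (Num.sqrt beta *: z))).
    apply/funext => k; have [K [G C]] := C11_box_bump a b k.
    exact: EP_limit C (box_bump01 a b k).
  rewrite -E0 in c2; exact: (cvg_unique _ c1 c2).
transitivity ((EP P (fun w => \1_(box a b) (Y w) / g (Y w)))%:E).
  rewrite -EP_EFin; last by split; [exact: mq|exists rho^-1; exact: (q1 (\1_(box a b)))].
  rewrite density_measureE integral_mkcond epatch_indic ge0_integral_pushforward//.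
  - by apply: eq_integral => w _; rewrite /= EFinM muleC.
  - by apply/measurable_EFinP; exact: measurable_funM.
  - by move=> x _; rewrite -EFinM lee_fin mulr_ge0// ltW// ginv_gt0.
rewrite E gintE; last first.
  apply: (@gint_growth _ _ _ 1); first exact: (measurableT_comp mind msc).
  move=> z; rewrite mul1r; apply: le_trans (ind1 _) _.
  by have := @enorm_pow3 R d z 0 isT; rewrite expr0.
have mi : measurable_fun [set: borel_rV R d] (fun x : borel_rV R d => (\1_(box a b) x : R)%:E).
  exact/measurable_EFinP.
have i0 (x : borel_rV R d) : (0 <= (\1_(box a b) x : R)%:E)%E by rewrite lee_fin.
rewrite (gauss_rV_scale sb ltr01 mi i0).
by rewrite sqr_sqrtr ?(ltW beta0)// mulr1 integral_indic// setIT.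
Qed.

Let m1_gauss A : measurable A -> m1 A = @gauss_rV R d beta A.
Proof.
rewrite borel_rV_boxes => mA.
pose cube (n : nat) : set (borel_rV R d) := box (fun=> - n%:R) (fun=> n%:R).
apply: (@g_sigma_algebra_measure_unique _ _ _ _ _ cube) mA.
- by move=> _ [a [b ->]]; exact: measurable_box.
- by move=> n; do 2 eexists.
- apply/seteqP; split => // x _.
  exists (Num.truncn (\sum_j `|x ord0 j|)).+1 => // j.
  have xj : `|x ord0 j| <= \sum_i `|x ord0 i| by rewrite (bigD1 j)//= lerDl sumr_ge0.
  by rewrite in_itv/= -ltr_norml (le_lt_trans xj)// truncnS_gt.
- move=> _ _ [a [b ->]] [a' [b' ->]].
  exists (fun i => Num.max (a i) (a' i)), (fun i => Num.min (b i) (b' i)).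
  apply/seteqP; split => x.
    by move=> [h h'] i; have := h i; have := h' i; rewrite !in_itv/= gt_max lt_min => /andP[-> ->] /andP[-> ->].
  by move=> h; split => i; have := h i; rewrite !in_itv/= gt_max lt_min => /andP[/andP[? ?] /andP[? ?]]; apply/andP.
- by move=> _ [a [b ->]]; exact: m1_box.
- move=> n; rewrite [ltLHS]m1_box; apply: le_lt_trans (_ : (1 < +oo)%E); last exact: ltry.
  rewrite -(gauss_rV_setT d beta0); apply: le_measure; rewrite ?inE//.
  exact: measurable_box.
Qed.

Lemma limit_law : has_law P Y mu.
Proof.
move=> A mA; rewrite -gauss_g_target//.
have -> : (\int[@gauss_rV R d beta]_(x in A) (g x)%:E = \int[m1]_(x in A) (g x)%:E)%E.
  by apply: eq_measure_integral => D mD _; rewrite [RHS]m1_gauss.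
rewrite integral_mkcond epatch_indic.
have mind : measurable_fun [set: borel_rV R d] (\1_A : _ -> R) by exact: measurable_indic.
rewrite (ge0_integral_density (mu := nu) mginv (fun x => ltW (ginv_gt0 x))).
- under eq_integral => x _.
    rewrite -!EFinM mulrAC mulfV ?gt_eqF// mul1r.
    over.
  by rewrite integral_indic// setIT.
- by move=> D mD; exact: density_measureE.
- by apply/measurable_EFinP; exact: measurable_funM.
- by move=> x; rewrite -EFinM lee_fin mulr_ge0// ltW.
Qed.

End target.

(** * Monte Carlo error *)

Section empirical_mean.
Context {R : realType} {d : nat} {dO : measure_display} {Omega : measurableType dO}
  (P : probability Omega R) (M : nat) (xi : 'I_M -> Omega -> borel_rV R d).
Hypotheses (M0 : (0 < M)%N) (Xi : iid_standard_gaussian P xi).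

Let mxi j : measurable_fun setT (xi j). Proof. by case: Xi. Qed.

Lemma sample_gE (F : borel_rV R d -> R) j : measurable_fun setT F ->
  EP P (fun w => F (xi j w)) = gE F.
Proof.
move=> mF; have [_ lxi _] := Xi.
rewrite (law_gE (mxi j) ltr01 (lxi j) mF); congr gE.
by apply/funext => z; rewrite sqrtr1 scale1r.
Qed.

Lemma sample_indep2 j k : j != k -> indep2 P (xi j) (xi k).
Proof.
move=> jk A B mA mB; have [_ _ /(_ [set j; k]%SET (fun i => if i == j then A else B))] := Xi.
rewrite big_setU1/=; last by rewrite inE.
rewrite big_set1 eqxx eq_sym (negbTE jk) => <-; last by move=> i; case: ifP.
congr (P _); apply/seteqP; split => [w [Aw Bw] i|w H].
  by rewrite /= !inE => /orP[] /eqP ->; rewrite ?eqxx// eq_sym (negbTE jk).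
split; first by have := H j; rewrite /= !inE eqxx/=; exact.
by have := H k; rewrite /= !inE eqxx orbT/= eq_sym (negbTE jk); exact.
Qed.

Lemma bounded_gint (F : borel_rV R d -> R) : bmeas F -> gint F.
Proof.
move=> [mF [K FK]]; apply: (@gint_growth _ _ _ `|K|) => // z.
apply: le_trans (FK z) _; apply: le_trans (ler_norm K) _.
by rewrite ler_peMr// exprn_ege1// lerDl enorm_ge0.
Qed.

(** The variance is at most the mean square distance to any centre [a]. A free centre allows the
    Lipschitz bound around a known point to be used in place of the mean. *)
Lemma empirical_variance (phi : borel_rV R d -> R) (a : R) : bmeas phi ->
  EP P (fun w => (M%:R^-1 * \sum_(j < M) phi (xi j w) - gE phi) ^+ 2)
    <= M%:R^-1 * gE (fun z => (phi z - a) ^+ 2).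
Proof.
move=> bphi; set m := gE phi; pose psi z := phi z - m.
have bpsi : bmeas psi by exact: bmeasB bphi (bmeas_cst m).
have bpsi2 : bmeas (fun z => psi z ^+ 2) by exact: (bmeasM bpsi bpsi).
have bxi j : bmeas (fun w => psi (xi j w)).
  have [mpsi [K psiK]] := bpsi; split; last by exists K.
  exact: (measurableT_comp mpsi (mxi j)).
have MR : 0 < M%:R :> R by rewrite ltr0n.
have psi0 : gE psi = 0.
  by rewrite gEB; [rewrite gE_cst subrr|exact: bounded_gint|exact: gint_cst].
have E1 : EP P (fun w => (M%:R^-1 * \sum_(j < M) phi (xi j w) - m) ^+ 2) =
    EP P (fun w => M%:R^-2 * \sum_(j < M) \sum_(k < M) psi (xi j w) * psi (xi k w)).
  congr (EP P); apply/funext => w.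
  have -> : M%:R^-1 * \sum_(j < M) phi (xi j w) - m = M%:R^-1 * \sum_(j < M) psi (xi j w).
    by rewrite /psi big_split/= sumr_const card_ord -mulr_natr; field; rewrite gt_eqF.
  by rewrite exprMn exprVn [(\sum_(j < M) _) ^+ 2]expr2 big_distrlr.
(* Pairwise independence removes the off-diagonal terms: with one sample frozen, the other has mean
   zero. *)
have cov j k : EP P (fun w => psi (xi j w) * psi (xi k w)) =
    (j == k)%:R * gE (fun z => psi z ^+ 2).
  have [->|jk] := eqVneq j k.
    by rewrite mul1r -(sample_gE k) //; case: bpsi2.
  rewrite mul0r; pose F (p : borel_rV R d * borel_rV R d) := psi p.1 * psi p.2.
  have bF : bmeas F.
    have [mpsi [K psiK]] := bpsi; apply: bmeasM; (split; last by exists K => p).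
      exact: (measurableT_comp mpsi measurable_fst).
    exact: (measurableT_comp mpsi measurable_snd).
  rewrite (freezing (mxi j) (mxi k) (sample_indep2 jk) bF) -[RHS](EP_cst P 0).
  congr (EP P); apply/funext => w; rewrite /F/= (EPZ P _ (bxi k)).
  by rewrite (sample_gE k) ?psi0 ?mulr0//; case: bpsi.
have bb j k : bmeas (fun w => psi (xi j w) * psi (xi k w)) by exact: bmeasM.
have bs j : bmeas (fun w => \sum_(k < M) psi (xi j w) * psi (xi k w)) by exact: bmeas_sum.
rewrite E1 (EPZ P _ (bmeas_sum _ bs)) (EP_sum P _ bs).
have -> : \sum_(j < M) EP P (fun w => \sum_(k < M) psi (xi j w) * psi (xi k w)) =
    M%:R * gE (fun z => psi z ^+ 2).
  rewrite (eq_bigr (fun=> gE (fun z => psi z ^+ 2))) => [|j _].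
    by rewrite sumr_const card_ord mulr_natl.
  rewrite (EP_sum P _ (bb j)) (bigD1 j)//= cov eqxx mul1r big1 ?addr0// => k kj.
  by rewrite cov eq_sym (negbTE kj) mul0r.
have mm (X : R) : M%:R ^- 2 * (M%:R * X) = M%:R^-1 * X by field; rewrite gt_eqF.
rewrite mm.
apply: ler_wpM2l; first by rewrite invr_ge0 ltW.
have -> : (fun z => (phi z - a) ^+ 2) = (fun z => psi z ^+ 2 + (2 * (m - a) * psi z + (m - a) ^+ 2)).
  by apply/funext => z; rewrite /psi; ring.
have i1 := bounded_gint bpsi2; have i2 := gintZ (2 * (m - a)) (bounded_gint bpsi).
rewrite (gED i1 (gintD i2 (gint_cst _))) (gED i2 (gint_cst _)) gEZ; last exact: bounded_gint.
by rewrite psi0 gE_cst mulr0 add0r lerDl sqr_ge0.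
Qed.

End empirical_mean.

Section monte_carlo.
Context {R : realType} {d : nat} (beta : R) (V : 'rV[R]_d -> R) (Lg rho : R).
Hypotheses (Lg0 : 0 < Lg) (rho0 : 0 < rho) (beta0 : 0 < beta).
Hypothesis B : assumptionB beta V Lg rho.
Variable (M : nat).
Hypothesis M0 : (0 < M)%N.

Let g := g_beta beta V.
Let Cg := C11_g_beta Lg0 B.

Let mg : measurable_fun [set: borel_rV R d] g.
Proof. exact: C11_measurable Cg. Qed.

Let mgrad : measurable_fun [set: borel_rV R d] (grad g : borel_rV R d -> borel_rV R d).
Proof.
have [_ _ _ u3 _] := Cg.
exact: continuous_measurable_vec (lipschitz_continuous_vec u3).
Qed.

Section measurability.
Context {dT : measure_display} {T : measurableType dT}.
Variables (z : 'I_M -> T -> borel_rV R d) (y : T -> borel_rV R d) (c : R).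
Hypotheses (mz : forall j, measurable_fun setT (z j)) (my : measurable_fun setT y).

Let mshift j : measurable_fun setT (fun t => (y t : 'rV[R]_d) + c *: (z j t : 'rV[R]_d) : borel_rV R d).
Proof.
by apply: measurable_addV => //; apply: measurable_scaleV => //; exact: measurable_cst.
Qed.

Lemma measurable_mc_mean : measurable_fun setT (fun t => mc_mean beta V c (z^~ t) (y t)).
Proof.
apply: measurable_funM => //; apply: measurable_sum => j.
exact: (measurableT_comp mg (mshift j)).
Qed.

Lemma measurable_mc_grad :
  measurable_fun setT (fun t => mc_grad beta V c (z^~ t) (y t) : borel_rV R d).
Proof.
apply: measurable_scaleV; first exact: measurable_cst.
apply: measurable_sumV => j.
exact: (measurableT_comp mgrad (mshift j)).
Qed.

End measurability.

Lemma measurable_mc_drift {dT : measure_display} {T : measurableType dT}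
    (z : 'I_M -> T -> borel_rV R d) (y : T -> borel_rV R d) t :
  (forall j, measurable_fun setT (z j)) -> measurable_fun setT y ->
  measurable_fun setT (fun w => mc_drift beta V (z^~ w) (y w) t : borel_rV R d).
Proof.
move=> mz my; under eq_fun do rewrite mc_driftE.
apply: measurable_scaleV; first exact: measurable_cst.
apply: measurable_scaleV; last exact: measurable_mc_grad.
have mc0 w : 0 <= mc_mean beta V (noise beta t) (z^~ w) (y w).
  exact: le_trans (ltW rho0) (mc_mean_ge B M0 _ _ _).
under eq_fun do rewrite -powR_inv1//.
apply: (measurableT_comp (measurable_powR _)); exact: measurable_mc_mean.
Qed.

Context {dO : measure_display} {Omega : measurableType dO}
  (P : probability Omega R) (xi : 'I_M -> Omega -> borel_rV R d).
Hypothesis Xi : iid_standard_gaussian P xi.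

Let mxi j : measurable_fun setT (xi j). Proof. by case: Xi. Qed.

Let MR : 0 < M%:R :> R. Proof. by rewrite ltr0n. Qed.

Let mshift c x : measurable_fun [set: borel_rV R d]
  (fun z : borel_rV R d => x + c *: (z : 'rV[R]_d) : borel_rV R d).
Proof. exact: measurable_shift. Qed.

(** No factor [d] appears: the coordinatewise second moments add up to the squared norm of the
    gradient, which is at most [Lg ^+ 2]. *)
Lemma mc_grad_variance c x :
  EP P (fun w => enorm (mc_grad beta V c (xi^~ w) x - gavgV c (grad g) x) ^+ 2)
    <= M%:R^-1 * Lg ^+ 2.
Proof.
have [_ _ u2 u3 _] := Cg.
pose phi i (z : borel_rV R d) := grad g (x + c *: (z : 'rV[R]_d)) ord0 i.
have bphi i : bmeas (phi i).
  split; first exact: (measurable_fun_coord i (measurableT_comp mgrad (mshift c x))).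
  by exists Lg => z; exact: le_trans (normr_coord_le _ _) (u2 _).
have bS i : bmeas (fun w => (M%:R^-1 * \sum_(j < M) phi i (xi j w) - gE (phi i)) ^+ 2).
  apply: bmeasM; (apply: bmeasB; last exact: bmeas_cst); apply: bmeasZ; apply: bmeas_sum => j;
  have [mp [K pK]] := bphi i; (split; last by exists K => w); exact: (measurableT_comp mp (mxi j)).
have -> : (fun w => enorm (mc_grad beta V c (xi^~ w) x - gavgV c (grad g) x) ^+ 2) =
    (fun w => \sum_(i < d) (M%:R^-1 * \sum_(j < M) phi i (xi j w) - gE (phi i)) ^+ 2).
  apply/funext => w; rewrite enorm_sqr; apply: eq_bigr => i _.
  by rewrite !mxE summxE -expr2.
rewrite (EP_sum P _ bS).
apply: (@le_trans _ _ (\sum_(i < d) M%:R^-1 * gE (fun z => (phi i z - 0) ^+ 2))).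
  by apply: ler_sum => i _; exact: (empirical_variance M0 Xi 0 (bphi i)).
have bp i : bmeas (fun z => (phi i z - 0) ^+ 2).
  by apply: bmeasM; apply: bmeasB => //; exact: bmeas_cst.
have ip i := bounded_gint (bp i).
rewrite -mulr_sumr; apply: ler_wpM2l; first by rewrite invr_ge0 ltW.
rewrite -(gE_sum _ ip) -[leRHS](@gE_cst _ d); apply: gE_le.
- exact: gint_sum.
- exact: gint_cst.
move=> z; have -> : \sum_(i < d) (phi i z - 0) ^+ 2 = enorm (grad g (x + c *: z)) ^+ 2.
  by rewrite enorm_sqr; apply: eq_bigr => i _; rewrite subr0 expr2.
by rewrite lerXn2r ?nnegrE ?enorm_ge0// ltW.
Qed.

(** Truncating [g] at level [n] preserves its Lipschitz constant and makes [empirical_variance]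
    applicable; the cap [b] dominates the passage to the limit. The factor [d] is the mean square
    norm of the noise. *)
Lemma mc_mean_variance c x b : 0 <= b ->
  EP P (fun w => Num.min ((mc_mean beta V c (xi^~ w) x - gavg c g x) ^+ 2) b)
    <= M%:R^-1 * (Lg ^+ 2 * c ^+ 2 * d%:R).
Proof.
move=> b0; have [_ _ _ _ u4] := Cg.
have g0 y : 0 <= g y by have [_ _ _ gr] := B; exact: le_trans (ltW rho0) (gr y).
pose phi n (z : borel_rV R d) := Num.min (g (x + c *: (z : 'rV[R]_d))) n%:R.
have mgs := measurableT_comp mg (mshift c x).
have bphi n : bmeas (phi n).
  split; first by apply: measurable_minr => //; exact: mgs.
  exists n%:R => z; rewrite ger0_norm; first by rewrite ge_min lexx orbT.
  by rewrite le_min g0 ler0n.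
pose S n w := M%:R^-1 * \sum_(j < M) phi n (xi j w) - gE (phi n).
have bS n : bmeas (S n).
  apply: bmeasB; last exact: bmeas_cst.
  apply: bmeasZ; apply: bmeas_sum => j.
  by have [mp [K pK]] := bphi n; split; [exact: (measurableT_comp mp (mxi j))|exists K => w].
have bS2 n : bmeas (fun w => S n w ^+ 2) by exact: (bmeasM (bS n) (bS n)).
have bmin (u : Omega -> R) : measurable_fun setT u -> bmeas (fun w => Num.min (u w ^+ 2) b).
  move=> mu; split; first by apply: measurable_minr => //; exact: measurable_funX.
  exists b => w; rewrite ger0_norm; first by rewrite ge_min lexx orbT.
  by rewrite le_min sqr_ge0.
have step n : EP P (fun w => Num.min (S n w ^+ 2) b) <= M%:R^-1 * (Lg ^+ 2 * c ^+ 2 * d%:R).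
  apply: (@le_trans _ _ (EP P (fun w => S n w ^+ 2))).
    apply: EP_le => // [|w]; first by apply: bmin; case: (bS n).
    by rewrite ge_min lexx.
  apply: le_trans (empirical_variance M0 Xi (Num.min (g x) n%:R) (bphi n)) _.
  apply: ler_wpM2l; first by rewrite invr_ge0 ltW.
  have bq : bmeas (fun z => (phi n z - Num.min (g x) n%:R) ^+ 2).
    by apply: bmeasM; apply: bmeasB => //; exact: bmeas_cst.
  rewrite -(@gE_enorm2 R d) -(gEZ _ (@gint_enorm2 R d)); apply: gE_le.
  - exact: bounded_gint.
  - exact: gintZ (@gint_enorm2 R d).
  move=> z; apply: (@le_trans _ _ (`|g (x + c *: z) - g x| ^+ 2)).
    rewrite -[leLHS]real_normK ?num_real// lerXn2r ?nnegrE// /phi.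
    have := ler_norm (g (x + c *: z) - g x); have := ler_norm (g x - g (x + c *: z)).
    rewrite [`|g x - _|]distrC ler_norml /Num.min.
    by case: ltP => h1; case: ltP => h2; lra.
  have := u4 (x + c *: z) x; rewrite [x + _]addrC addrK enormZ => h.
  apply: (@le_trans _ _ ((Lg * (`|c| * enorm z)) ^+ 2)).
    by rewrite lerXn2r ?nnegrE// (le_trans _ h).
  by rewrite !exprMn real_normK ?num_real// mulrA.
have cphi z : phi n z @[n --> \oo] --> g (x + c *: (z : 'rV[R]_d)).
  apply: cvg_near_cst; exists (Num.truncn (g (x + c *: z))).+1 => // n /= h.
  apply/min_idPl/ltW; apply: lt_le_trans (truncnS_gt _) _; by rewrite ler_nat.
have cS w : S n w @[n --> \oo] --> mc_mean beta V c (xi^~ w) x - gavg c g x.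
  apply: cvgB; last first.
    apply: (@cvg_Rintegral _ _ _ _ _ _ (fun z : borel_rV R d => g (x + c *: (z : 'rV[R]_d)))).
    - by move=> n; case: (bphi n).
    - exact: mgs.
    - by apply: nearW => z; exact: cphi.
    - exact: C11_gint Cg.
    - move=> n z; rewrite ger0_norm; first by rewrite ge_min lexx.
      by rewrite le_min g0 ler0n.
  apply: cvgM; first exact: cvg_cst.
  by apply: cvg_big => [|j _]; [exact: add_continuous|exact: cphi].
have c1 : EP P (fun w => Num.min (S n w ^+ 2) b) @[n --> \oo] -->
    EP P (fun w => Num.min ((mc_mean beta V c (xi^~ w) x - gavg c g x) ^+ 2) b).
  apply: (@cvg_Rintegral _ _ _ _ _ _ (fun=> b)).
  - by move=> n; case: (bmin _ (bS n).1).
  - have mm : measurable_fun setT (fun w => mc_mean beta V c (xi^~ w) x - gavg c g x).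
      apply: measurable_funB; last exact: measurable_cst.
      by apply: (measurable_mc_mean (y := fun=> x)) => //; exact: measurable_cst.
    by case: (bmin _ mm).
  - apply: nearW => w; have cm : continuous (fun u : R => Num.min u b).
      by move=> u; apply: (@continuous_min _ _ id (fun=> b)); [exact: cvg_id|exact: cvg_cst].
    have c2 : S n w ^+ 2 @[n --> \oo] --> (mc_mean beta V c (xi^~ w) x - gavg c g x) ^+ 2.
      by apply: cvgM; exact: cS.
    have c3 := cvg_comp _ _ c2 (cm _).
    exact: c3.
  - exact: finite_measure_integrable_cst.
  - move=> n w; rewrite ger0_norm; first by rewrite ge_min lexx orbT.
    by rewrite le_min sqr_ge0.
rewrite -(cvg_lim _ c1)//; apply: limr_le; first by apply/cvg_ex; eexists; exact: c1.
by apply: nearW => n; exact: step.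
Qed.

End monte_carlo.

Lemma enorm_sub_sq_bound {R : realType} d (u v : 'rV[R]_d) (K : R) :
  enorm u <= K -> enorm v <= K -> enorm (u - v) ^+ 2 <= (2 * K) ^+ 2.
Proof.
move=> uK vK; have K0 : 0 <= K := le_trans (enorm_ge0 _) uK.
rewrite lerXn2r ?nnegrE ?enorm_ge0 ?mulr_ge0//.
by apply: le_trans (enormB _ _) _; lra.
Qed.

Section monte_carlo_error.
Context {R : realType} {d : nat} (beta : R) (V : 'rV[R]_d -> R) (Lg rho : R).
Hypotheses (d0 : (0 < d)%N) (Lg0 : 0 < Lg) (rho0 : 0 < rho) (beta0 : 0 < beta).
Hypothesis B : assumptionB beta V Lg rho.
Variable (M : nat).
Hypothesis M0 : (0 < M)%N.
Context {dO : measure_display} {Omega : measurableType dO}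
  (P : probability Omega R) (xi : 'I_M -> Omega -> borel_rV R d).
Hypothesis Xi : iid_standard_gaussian P xi.

Let g := g_beta beta V.
Let f := f_beta beta V.
Let K := drift_bound beta Lg rho.
Let L := drift_lip beta Lg rho.

Let mxi j : measurable_fun setT (xi j). Proof. by case: Xi. Qed.
Let MR : 0 < M%:R :> R. Proof. by rewrite ltr0n. Qed.
Let mf t : measurable_fun setT (f^~ t : borel_rV R d -> borel_rV R d).
Proof. exact: (measurable_drift (f_beta_lip Lg0 rho0 beta0 B)). Qed.

Definition mc_C : R :=
  2 * beta ^+ 2 / rho ^+ 2 * Lg ^+ 2 + 2 * beta ^+ 2 * Lg ^+ 2 / rho ^+ 4 * (Lg ^+ 2 * beta).

Lemma mc_drift_variance x t : 0 <= t <= 1 ->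
  EP P (fun w => enorm (mc_drift beta V (xi^~ w) x t - f x t) ^+ 2) <= mc_C * (d%:R / M%:R).
Proof.
move=> /andP[t0 t1]; set c := noise beta t.
pose A w := enorm (mc_grad beta V c (xi^~ w) x - gavgV c (grad g) x).
pose s w := mc_mean beta V c (xi^~ w) x - gavg c g x.
pose r := 2 * beta ^+ 2 * Lg ^+ 2 / rho ^+ 4.
have r0 : 0 < r by rewrite /r divr_gt0 ?mulr_gt0 ?exprn_gt0.
(* With this cap [r * b] is the a priori bound [(2 * K) ^+ 2] on the squared error of the drift, so
   capping [s w ^+ 2] costs nothing. *)
pose b := (2 * K) ^+ 2 / r.
have b0 : 0 <= b by rewrite /b divr_ge0 ?sqr_ge0 ?ltW.
have a0 : 0 <= 2 * beta ^+ 2 / rho ^+ 2 :=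
  divr_ge0 (mulr_ge0 (ler0n R 2) (sqr_ge0 beta)) (sqr_ge0 rho).
have pw w : enorm (mc_drift beta V (xi^~ w) x t - f x t) ^+ 2 <=
    2 * beta ^+ 2 / rho ^+ 2 * A w ^+ 2 + r * Num.min (s w ^+ 2) b.
  have e1 := mc_drift_error Lg0 rho0 beta0 B M0 (xi^~ w) x t.
  have e2 := enorm_sub_sq_bound (mc_drift_bound Lg0 rho0 beta0 B M0 (xi^~ w) x t)
    (f_beta_bound Lg0 rho0 beta0 B x t).
  have A0 : 0 <= 2 * beta ^+ 2 / rho ^+ 2 * A w ^+ 2 by rewrite mulr_ge0 ?sqr_ge0.
  rewrite /Num.min; case: ltP => _; last first.
    have -> : r * b = (2 * K) ^+ 2 by rewrite /b mulrC divfK ?gt_eqF.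
    by apply: le_trans e2 _; rewrite lerDr.
  have D0 := enorm_ge0 (mc_drift beta V (xi^~ w) x t - f x t).
  apply: (@le_trans _ _ ((beta * (A w / rho + Lg * `|s w| / rho ^+ 2)) ^+ 2)).
    by rewrite lerXn2r ?nnegrE// (le_trans D0 e1).
  have -> : 2 * beta ^+ 2 / rho ^+ 2 * A w ^+ 2 + r * s w ^+ 2 =
      beta ^+ 2 * (2 * (A w / rho) ^+ 2 + 2 * (Lg * `|s w| / rho ^+ 2) ^+ 2).
    rewrite /r -[s w ^+ 2]real_normK ?num_real//; field; rewrite gt_eqF//.
  rewrite exprMn; apply: ler_wpM2l; first exact: sqr_ge0.
  move: (A w / rho) (Lg * _ / _) => u v; have := sqr_ge0 (u - v); lra.
have mA : measurable_fun setT A.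
  apply: measurable_enorm; apply: measurable_subV; last exact: measurable_cst.
  by apply: (measurable_mc_grad Lg0 B _ (y := fun=> x)) => //; exact: measurable_cst.
have bA : bmeas (fun w => A w ^+ 2).
  split; first exact: measurable_funX.
  exists ((2 * Lg) ^+ 2) => w; rewrite ger0_norm ?sqr_ge0//.
  have [_ _ u2 _ _] := C11_gavg c (C11_g_beta Lg0 B).
  exact: enorm_sub_sq_bound (mc_grad_bound Lg0 B M0 _ _ _) (u2 x).
have ms : measurable_fun setT s.
  apply: measurable_funB; last exact: measurable_cst.
  by apply: (measurable_mc_mean Lg0 B _ (y := fun=> x)) => //; exact: measurable_cst.
have bm : bmeas (fun w => Num.min (s w ^+ 2) b).
  split; first by apply: measurable_minr => //; exact: measurable_funX.
  exists b => w; rewrite ger0_norm; first by rewrite ge_min lexx orbT.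
  by rewrite le_min sqr_ge0.
have bD : bmeas (fun w => enorm (mc_drift beta V (xi^~ w) x t - f x t) ^+ 2).
  split.
    apply: measurable_funX; apply: measurable_enorm; apply: measurable_subV; last exact: measurable_cst.
    by apply: (measurable_mc_drift Lg0 rho0 B M0 (y := fun=> x)) => //; exact: measurable_cst.
  exists ((2 * K) ^+ 2) => w; rewrite ger0_norm ?sqr_ge0//.
  exact: enorm_sub_sq_bound (mc_drift_bound Lg0 rho0 beta0 B M0 _ _ _) (f_beta_bound Lg0 rho0 beta0 B _ _).
apply: le_trans (EP_le P bD (bmeasD (bmeasZ _ bA) (bmeasZ r bm)) pw) _.
rewrite (EPD P (bmeasZ _ bA) (bmeasZ r bm)) (EPZ P _ bA) (EPZ P r bm).
have h1 := mc_grad_variance Lg0 B M0 Xi c x.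
have h2 := mc_mean_variance Lg0 rho0 B M0 Xi c x b0.
have c2 : c ^+ 2 <= beta.
  rewrite sqr_sqrtr; last by rewrite mulr_ge0 ?subr_ge0// ltW.
  by rewrite ler_piMl ?(ltW beta0)//; lra.
have Mi0 : 0 <= M%:R^-1 :> R by rewrite invr_ge0 ltW.
have d1 : 1 <= d%:R :> R by rewrite ler1n.
apply: le_trans (lerD (ler_wpM2l a0 h1) (ler_wpM2l (ltW r0) h2)) _.
rewrite /mc_C -/r [leRHS]mulrDl; apply: lerD.
  rewrite -[leRHS]mulrA; apply: ler_wpM2l => //.
  rewrite mulrC; apply: ler_wpM2l; first exact: sqr_ge0.
  by rewrite ler_peMl.
rewrite -[leRHS]mulrA; apply: ler_wpM2l; first exact: ltW.
rewrite [leRHS]mulrA mulrC; apply: ler_wpM2r => //.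
apply: ler_wpM2r => //; apply: ler_wpM2l => //; exact: sqr_ge0.
Qed.

Variable (W : R -> Omega -> borel_rV R d).
Hypothesis BW : brownian_motion P W.
Hypothesis XW : independent_sigma P (sigma_family [set: 'I_M] xi)
                        (sigma_family `[0, 1]%classic W).
Variable N : nat.
Hypothesis N0 : (0 < N)%N.

Let h : R := N%:R^-1.
Let y n w : borel_rV R d := euler beta f N (W^~ w) n.
Let z n w : borel_rV R d := mc_euler beta V N (W^~ w) (xi^~ w) n.
Let eps n w := enorm (mc_drift beta V (xi^~ w) (y n w) (n%:R / N%:R) - f (y n w) (n%:R / N%:R)).

Lemma measurable_mc_euler n : (n <= N)%N -> measurable_fun setT (z n).
Proof.
elim: n => [_|n IH nN]; first exact: measurable_cst.
have mz := IH (ltnW nN).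
apply: measurable_addV.
  apply: measurable_addV => //; apply: measurable_scaleV; first exact: measurable_cst.
  exact: (measurable_mc_drift Lg0 rho0 B M0).
by apply: measurable_scaleV; [exact: measurable_cst|exact: (measurable_inc BW N0 nN)].
Qed.

Let my n : (n <= N)%N -> measurable_fun setT (y n).
Proof. by move=> nN; exact: (measurable_euler_W BW beta N0 nN mf). Qed.

Let noise_independent n : (n < N)%N -> EP P (fun w => eps n w ^+ 2) <= mc_C * (d%:R / M%:R).
Proof.
move=> nN; pose t : R := n%:R / N%:R.
have t01 : 0 <= (t : R) <= 1.
  by rewrite divr_ge0//= ler_pdivrMr ?ltr0n// mul1r ler_nat ltnW.
pose gX : set (set Omega) := \bigcup_(i in [set: 'I_M]) preimage_set_system setT (xi i) measurable.
pose gW : set (set Omega) := \bigcup_(s in `[0, 1]%classic) preimage_set_system setT (W s) measurable.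
have mX j : measurable_fun setT (xi j : g_sigma_algebraType gX -> borel_rV R d).
  by move=> _ A mA; apply: sub_sigma_algebra; exists j => //; exists A.
have mW s : 0 <= s <= 1 -> measurable_fun setT (W s : g_sigma_algebraType gW -> borel_rV R d).
  move=> s01 _ A mA; apply: sub_sigma_algebra; exists s; last by exists A.
  by rewrite /= in_itv.
have frac01 i : (i <= N)%N -> 0 <= (i%:R / N%:R : R) <= 1.
  by move=> iN; rewrite divr_ge0//= ler_pdivrMr ?ltr0n// mul1r ler_nat.
have myW : measurable_fun setT (y n : g_sigma_algebraType gW -> borel_rV R d).
  apply: (@measurable_euler _ _ _ (g_sigma_algebraType gW) beta f N n (inc W N)) => // i ni.
  have iN := leq_trans ni (ltnW nN).
  by apply: (@measurable_subV R d _ (g_sigma_algebraType gW)); apply: mW; apply: frac01 => //; exact: ltnW.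
(* The whole family of samples is encoded as the identity map into [Omega] with the sigma-algebra
   [gX]; freezing it against [y n], a function of [W] alone, brings the error back to a fixed
   point. *)
have mid : measurable_fun setT (id : Omega -> g_sigma_algebraType gX).
  move=> _ A mA; rewrite setTI; apply: smallest_sub mA; first exact: sigma_algebra_measurable.
  by move=> _ [j _ [C mC <-]]; exact: mxi.
have ind : indep2 P (y n) (id : Omega -> g_sigma_algebraType gX).
  move=> A C mA mC; rewrite setIC [RHS]muleC; apply: XW; first exact: mC.
  by have := myW measurableT A mA; rewrite setTI.
pose F (p : borel_rV R d * g_sigma_algebraType gX) :=
  enorm (mc_drift beta V (xi^~ p.2) p.1 t - f p.1 t) ^+ 2.
have bF : bmeas F.
  split.
    apply: measurable_funX; apply: measurable_enorm; apply: measurable_subV.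
      apply: (measurable_mc_drift Lg0 rho0 B M0
        (z := fun j (p : borel_rV R d * g_sigma_algebraType gX) => xi j p.2)) => // j.
      exact: (measurableT_comp (mX j) measurable_snd).
    exact: (measurableT_comp (mf t) measurable_fst).
  exists ((2 * K) ^+ 2) => p; rewrite ger0_norm ?sqr_ge0//.
  exact: enorm_sub_sq_bound (mc_drift_bound Lg0 rho0 beta0 B M0 _ _ _) (f_beta_bound Lg0 rho0 beta0 B _ _).
have E := freezing (my (ltnW nN)) mid ind bF.
have bi := bmeas_freezing_inner P mid bF.
apply: (@le_trans _ _ (EP P (fun w => EP P (fun v => F (y n w, v))))).
  by rewrite le_eqVlt; apply/orP; left; apply/eqP; exact: E.
rewrite -[leRHS](EP_cst P); apply: EP_le; last by move=> w; exact: mc_drift_variance.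
  have [mI [KI IK]] := bi; split; last by exists KI => w; exact: IK.
  exact: (measurableT_comp mI (my (ltnW nN))).
exact: bmeas_cst.
Qed.

Let diff_id (a b m1 m2 m3 i : 'rV[R]_d) :
  (a + h *: m1 + Num.sqrt beta *: i) - (b + h *: m3 + Num.sqrt beta *: i) =
  (a - b) + (h *: (m1 - m2) + h *: (m2 - m3)).
Proof. by apply/rowP => k; rewrite !mxE; ring. Qed.

Let diff_id0 (a b m1 m3 i : 'rV[R]_d) :
  (a + h *: m1 + Num.sqrt beta *: i) - (b + h *: m3 + Num.sqrt beta *: i) =
  (a - b) + h *: (m1 - m3).
Proof. by apply/rowP => k; rewrite !mxE; ring. Qed.

(** The intermediate term is the Monte Carlo drift at the exact iterate [y n w]. With the exact
    drift at [z n w] instead, the sampling error would be taken at a point that depends on the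
    samples. *)
Let diff_step n w : enorm ((z n.+1 w : 'rV[R]_d) - (y n.+1 w : 'rV[R]_d)) <=
  (1 + h * L) * enorm ((z n w : 'rV[R]_d) - (y n w : 'rV[R]_d)) + h * eps n w.
Proof.
have h0 : 0 <= h by rewrite invr_ge0.
have -> : (z n.+1 w : 'rV[R]_d) - (y n.+1 w : 'rV[R]_d) =
    ((z n w : 'rV[R]_d) - (y n w : 'rV[R]_d)) +
    (h *: (mc_drift beta V (xi^~ w) (z n w) (n%:R / N%:R) - mc_drift beta V (xi^~ w) (y n w) (n%:R / N%:R)) +
     h *: (mc_drift beta V (xi^~ w) (y n w) (n%:R / N%:R) - f (y n w) (n%:R / N%:R))).
  exact: diff_id.
apply: le_trans (enormD _ _) _; rewrite mulrDl mul1r -addrA; apply: lerD => //.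
apply: le_trans (enormD _ _) _; rewrite !enormZ (ger0_norm h0) -mulrA; apply: lerD => //.
by apply: ler_wpM2l => //; exact: (mc_drift_lip Lg0 rho0 beta0 B M0).
Qed.

Let diff_bound n w : enorm ((z n w : 'rV[R]_d) - (y n w : 'rV[R]_d)) <= n%:R * (h * (2 * K)).
Proof.
have h0 : 0 <= h by rewrite invr_ge0.
elim: n => [|n IH]; first by rewrite mul0r subrr enorm0.
have -> : (z n.+1 w : 'rV[R]_d) - (y n.+1 w : 'rV[R]_d) =
    ((z n w : 'rV[R]_d) - (y n w : 'rV[R]_d)) +
    h *: (mc_drift beta V (xi^~ w) (z n w) (n%:R / N%:R) - f (y n w) (n%:R / N%:R)).
  exact: diff_id0.
apply: le_trans (enormD _ _) _; rewrite -natr1 mulrDl mul1r; apply: lerD => //.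
rewrite enormZ (ger0_norm h0); apply: ler_wpM2l => //.
apply: le_trans (enormB _ _) _.
have := mc_drift_bound Lg0 rho0 beta0 B M0 (xi^~ w) (z n w) (n%:R / N%:R).
have := f_beta_bound Lg0 rho0 beta0 B (y n w) (n%:R / N%:R); rewrite -/f -/K; lra.
Qed.

Lemma bmeas_mc_diff n : (n <= N)%N ->
  bmeas (fun w => enorm ((z n w : 'rV[R]_d) - (y n w : 'rV[R]_d)) ^+ 2).
Proof.
move=> nN; split.
  apply: measurable_funX; apply: measurable_enorm; apply: measurable_subV; last exact: my.
  exact: measurable_mc_euler.
exists ((n%:R * (h * (2 * K))) ^+ 2) => w; rewrite ger0_norm ?sqr_ge0//.
have b := diff_bound n w; have e0 := enorm_ge0 ((z n w : 'rV[R]_d) - (y n w : 'rV[R]_d)).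
by apply: lerXn2r => //; rewrite nnegrE (le_trans e0 b).
Qed.

Lemma mc_error : EP P (fun w => enorm ((z N w : 'rV[R]_d) - (y N w : 'rV[R]_d)) ^+ 2) <=
  2 * expR (1 + 2 * L) * mc_C * (d%:R / M%:R).
Proof.
have h0 : 0 < h by rewrite invr_gt0 ltr0n.
have L0 : 0 <= L := drift_lip_ge0 Lg0 rho0 beta0.
have sq_le (a b : R) : 0 <= a -> a <= b -> a ^+ 2 <= b ^+ 2.
  by move=> a0 ab; rewrite lerXn2r ?nnegrE// (le_trans a0).
pose D n w := enorm ((z n w : 'rV[R]_d) - (y n w : 'rV[R]_d)).
have bD n (nN : (n <= N)%N) := bmeas_mc_diff nN.
have be n : (n < N)%N -> bmeas (fun w => eps n w ^+ 2).
  move=> nN; split.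
    apply: measurable_funX; apply: measurable_enorm; apply: measurable_subV.
      exact: (measurable_mc_drift Lg0 rho0 B M0 _ mxi (my (ltnW nN))).
    exact: (measurableT_comp (mf _) (my (ltnW nN))).
  exists ((2 * K) ^+ 2) => w; rewrite ger0_norm ?sqr_ge0//.
  exact: enorm_sub_sq_bound (mc_drift_bound Lg0 rho0 beta0 B M0 _ _ _) (f_beta_bound Lg0 rho0 beta0 B _ _).
have C0 : 0 <= mc_C * (d%:R / M%:R).
  by apply: le_trans (noise_independent N0); rewrite -(EP_cst P 0); apply: EP_le => [||w];
    [exact: bmeas_cst|exact: be|exact: sqr_ge0].
have h1 : h <= 1 by rewrite /h invf_le1 ?ltr0n// ler1n.
have step n : (n < N)%N -> EP P (fun w => D n.+1 w ^+ 2) <=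
    expR (h * (1 + 2 * L)) * EP P (fun w => D n w ^+ 2) + 2 * h * (mc_C * (d%:R / M%:R)).
  move=> nN; have bn := bD n (ltnW nN).
  have pw w : D n.+1 w ^+ 2 <= expR (h * (1 + 2 * L)) * D n w ^+ 2 + 2 * h * eps n w ^+ 2.
    have e0 : 0 <= eps n w := enorm_ge0 _.
    have D0 : 0 <= D n w := enorm_ge0 _.
    apply: (@le_trans _ _ (((1 + h * L) * D n w + h * eps n w) ^+ 2)).
      exact: sq_le (enorm_ge0 _) (diff_step n w).
    (* Young's inequality weighted by [h], together with [h^2 <= h]. The sampling error then counts
       with weight [O (h)] per step, so no independence between steps is required. *)
    apply: (@le_trans _ _ ((1 + h) * ((1 + h * L) * D n w) ^+ 2 + 2 * h * eps n w ^+ 2)).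
      have := mulr_ge0 (ltW h0) (sqr_ge0 ((1 + h * L) * D n w - eps n w)).
      have := mulr_ge0 (mulr_ge0 (ltW h0) (_ : 0 <= 1 - h)) (sqr_ge0 (eps n w)).
      rewrite subr_ge0 => /(_ h1).
      move: ((1 + h * L) * D n w) (eps n w) => s e; lra.
    apply: lerD => //; rewrite exprMn mulrA; apply: ler_wpM2r; first exact: sqr_ge0.
    have -> : h * (1 + 2 * L) = h + (h * L + h * L) by ring.
    rewrite expRD expRD expr2; have hL : 0 <= h * L by rewrite mulr_ge0// ltW.
    apply: ler_pM; [by rewrite addr_ge0// ltW|by rewrite mulr_ge0 ?addr_ge0|exact: expR_ge1Dx|].
    by apply: ler_pM; rewrite ?addr_ge0 ?expR_ge1Dx.
  apply: le_trans (EP_le P (bD n.+1 nN) (bmeasD (bmeasZ _ bn) (bmeasZ _ (be n nN))) pw) _.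
  rewrite (EPD P (bmeasZ _ bn) (bmeasZ _ (be n nN))) (EPZ P _ bn) (EPZ P _ (be n nN)).
  apply: lerD => //; apply: ler_wpM2l; first by rewrite mulr_ge0// ltW.
  exact: noise_independent.
have := @gronwall R (fun n => EP P (fun w => D n w ^+ 2)) (fun=> h * (1 + 2 * L))
  (fun=> 2 * h * (mc_C * (d%:R / M%:R))) N.
rewrite !sumr_const !card_ord -[(_ * (1 + _)) *+ N]mulr_natl -[(2 * h * _) *+ N]mulr_natl.
have hN : N%:R * h = 1 by rewrite /h divff// pnatr_eq0 -lt0n.
have e1 : N%:R * (h * (1 + 2 * L)) = 1 + 2 * L by rewrite mulrA hN mul1r.
have e2 v : N%:R * (2 * h * v) = 2 * v by rewrite -mulrA mulrCA (mulrA N%:R) hN mul1r.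
rewrite e1 e2.
move=> /(_ _ _ _ step) G; apply: le_trans (G _ _ _) _.
- have -> : (fun w => D 0%N w ^+ 2) = (fun=> 0).
    by apply/funext => w; rewrite /D subrr enorm0 expr0n.
  by rewrite EP_cst.
- by move=> k _; exact: mulr_ge0 (ltW h0) (addr_ge0 ler01 (mulr_ge0 (ler0n R 2) L0)).
- by move=> k _; exact: mulr_ge0 (mulr_ge0 (ler0n R 2) (ltW h0)) C0.
by rewrite le_eqVlt; apply/orP; left; apply/eqP; ring.
Qed.

End monte_carlo_error.

(** * The coupling *)

Section drift_regularity.
Context {R : realType} {d : nat} (beta : R) (V : 'rV[R]_d -> R) (Lf Lft : R).
Hypothesis C : assumptionC beta V Lf Lft.

(** Here and for [Lft] absolute values are taken, since the constants of the assumption are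
    arbitrary functions of the parameters, with no sign prescribed. *)
Lemma f_beta_second_order (t : R) : 0 <= t <= 1 -> forall w x, exists q, forall v,
  `|dot w (f_beta beta V (x + v) t) - dot w (f_beta beta V x t) - dot q v|
    <= enorm w * `|Lf| * enorm v ^+ 2.
Proof.
move=> t01 w x; have [C1 C2 _] := C; have [CC _] := C1 t t01.
eexists => v; apply: (expansion_of_D2 w x v (normr_ge0 Lf) CC) => x0 v0.
apply: le_trans (C2 t x0 v0 v0 t01) _.
by rewrite ler_wpM2r ?enorm_ge0// ler_wpM2r ?enorm_ge0// ler_norm.
Qed.

(** On the interval from [t] to [t'] the singular weight is largest at the right end. *)
Lemma f_beta_time_lipschitz x (t t' : R) : 0 <= t -> t < t' -> t' < 1 ->
  enorm (f_beta beta V x t' - f_beta beta V x t)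
    <= `|Lft| * Num.sqrt d%:R * (t' - t) / Num.sqrt (1 - t').
Proof.
move=> t0 tt' t'1; have [_ _ /(_ x)[df [D _ Db]]] := C.
rewrite mulrAC; apply: (time_lipschitz t0 tt' t'1 D) => s /andP[ts st'].
have s01 : 0 <= s < 1 by rewrite (le_trans t0 (ltW ts)) (lt_trans st').
apply: le_trans (Db s s01) _; apply: ler_pM => //.
- have := le_trans (enorm_ge0 _) (Db s s01).
  by rewrite pmulr_lge0// invr_gt0 sqrtr_gt0 subr_gt0 (lt_trans st').
- by apply: ler_wpM2r => //; exact: ler_norm.
- have s1 : 0 < 1 - t' by rewrite subr_gt0.
  rewrite lef_pV2 ?posrE ?sqrtr_gt0//; last by rewrite subr_gt0 (lt_trans st').
  by rewrite ler_wsqrtr// lerB// ltW.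
Qed.

End drift_regularity.

Lemma iter_doubleE N k : iter k double N = (2 ^ k * N)%N.
Proof. by elim: k => [|k IH] /=; rewrite ?mul1n// IH -mul2n expnS mulnA. Qed.

Section exact_coupling.
Context {R : realType} {d : nat} (beta : R) (V : 'rV[R]_d -> R) (Lg rho Lf Lft : R).
Hypotheses (d0 : (0 < d)%N) (Lg0 : 0 < Lg) (rho0 : 0 < rho) (beta0 : 0 < beta).
Hypothesis B : assumptionB beta V Lg rho.
Hypothesis C : assumptionC beta V Lf Lft.
Variable mu : probability (borel_rV R d) R.
Hypothesis Gibbs : gibbs_target V mu.
Context {dO : measure_display} {Omega : measurableType dO}
  (P : probability Omega R) (W : R -> Omega -> borel_rV R d).
Hypothesis BW : brownian_motion P W.
Variable N : nat.
Hypothesis N0 : (0 < N)%N.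

Definition exact_C : R :=
  strong_C beta (drift_bound beta Lg rho) (drift_lip beta Lg rho) `|Lf| `|Lft|.

Let f := f_beta beta V.
Let X k w : borel_rV R d := euler beta f (iter k double N) (W^~ w) (iter k double N).

Let Nk_gt0 k : (0 < iter k double N)%N.
Proof. by rewrite iter_doubleE muln_gt0 expn_gt0. Qed.

Lemma exact_coupling : exists Y : Omega -> borel_rV R d,
  [/\ measurable_fun setT Y, has_law P Y mu &
      (\int[P]_w (enorm ((Y w : 'rV[R]_d) - (euler beta f N (W^~ w) N : 'rV[R]_d)) ^+ 2)%:E
        <= (4 * (exact_C * (d%:R / N%:R) ^+ 2))%:E)%E].
Proof.
have fL := f_beta_lip Lg0 rho0 beta0 B; have fB := f_beta_bound Lg0 rho0 beta0 B.
have L0 := drift_lip_ge0 Lg0 rho0 beta0; have K0 := drift_bound_ge0 Lg0 rho0 beta0.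
have mX k : measurable_fun setT (X k).
  exact: (measurable_euler_W BW beta (Nk_gt0 k) (leqnn _) (measurable_drift fL)).
have XC k : (\int[P]_w (enorm ((X k.+1 w : 'rV[R]_d) - (X k w : 'rV[R]_d)) ^+ 2)%:E
    <= (exact_C * (d%:R / N%:R) ^+ 2 / 4 ^+ k)%:E)%E.
  have bk := bmeas_diff beta L0 fB fL BW (Nk_gt0 k) (leqnn _).
  have := strong_doubling d0 beta0 K0 L0 (normr_ge0 Lf) (normr_ge0 Lft) fB fL
    (f_beta_second_order C) (f_beta_time_lipschitz C) BW (Nk_gt0 k).
  rewrite -lee_fin -(EP_EFin P bk) => /le_trans; apply.
  (* Level [k] has [2 ^ k * N] steps, so its squared doubling error carries the factor [4 ^ (- k)],
     the rate that [strong_limit] asks for. *)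
  rewrite lee_fin -/exact_C iter_doubleE natrM natrX -mulrA.
  rewrite le_eqVlt; apply/orP; left; apply/eqP; congr (_ * _).
  rewrite (_ : 4 = 2 ^+ 2); last by ring.
  by rewrite -exprM mulnC exprM invfM mulrA mulrAC exprMn exprVn.
have [Y [mY XY YC]] := strong_limit mX XC.
exists Y; split => //.
apply: (limit_law Lg0 rho0 beta0 B Gibbs BW (N := fun k => iter k double N)) => //.
have c : (N%:R^-1 * 2^-1 ^+ k) @[k --> \oo] --> (0 : R).
  rewrite -[X in _ --> X](mulr0 N%:R^-1); apply: cvgM; first exact: cvg_cst.
  by apply: cvg_expr; rewrite gtr0_norm ?invr_gt0// invf_lt1//; lra.
apply: cvg_trans c; apply: near_eq_cvg; apply: nearW => k /=.
by rewrite iter_doubleE natrM natrX invfM mulrC exprVn.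
Qed.

End exact_coupling.

Lemma enorm_subr_sq {R : realType} d (u v : 'rV[R]_d) :
  enorm (u - v) ^+ 2 <= 2 * enorm u ^+ 2 + 2 * enorm v ^+ 2.
Proof.
have := sqr_ge0 (enorm (u + v)); rewrite !enorm_sqrD enormN dotNr; lra.
Qed.

Section final_bound.
Context {R : realType}.

Lemma sqrtr_add_le (a b : R) : 0 <= a -> 0 <= b -> Num.sqrt (a + b) <= Num.sqrt a + Num.sqrt b.
Proof.
move=> a0 b0; rewrite -(@ler_pXn2r _ 2) ?nnegrE ?addr_ge0 ?sqrtr_ge0//.
rewrite sqrrD !sqr_sqrtr ?addr_ge0//.
have := mulr_ge0 (sqrtr_ge0 a) (sqrtr_ge0 b); lra.
Qed.

Lemma wasserstein2_le {d : nat} {dO : measure_display} {Omega : measurableType dO}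
    (P : probability Omega R) (X Y : Omega -> borel_rV R d)
    (nu1 nu2 : set (borel_rV R d) -> \bar R) (r : R) :
  measurable_fun setT X -> measurable_fun setT Y -> has_law P X nu1 -> has_law P Y nu2 ->
  0 <= r ->
  (\int[P]_w (enorm ((X w : 'rV[R]_d) - (Y w : 'rV[R]_d)) ^+ 2)%:E <= r%:E)%E ->
  (wasserstein2 nu1 nu2 <= (Num.sqrt r)%:E)%E.
Proof.
move=> mX mY lX lY r0 h.
pose X' : {mfun Omega >-> borel_rV R d} := HB.pack X (isMeasurableFun.Build _ _ _ _ X mX).
pose Y' : {mfun Omega >-> borel_rV R d} := HB.pack Y (isMeasurableFun.Build _ _ _ _ Y mY).
apply: (@le_trans _ _ ((\int[P]_w (enorm ((X w : 'rV[R]_d) - (Y w : 'rV[R]_d)) ^+ 2)%:E)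
             `^ (2^-1)%R)%E).
  by apply: ereal_inf_lbound; exists dO, Omega, P, X', Y'; split.
rewrite -powR12_sqrt// -poweR_EFin; apply: gt0_ler_poweR => //.
  by rewrite in_itv/= leey andbT; apply: integral_ge0 => w _; rewrite lee_fin sqr_ge0.
by rewrite in_itv/= leey andbT lee_fin.
Qed.

End final_bound.

Theorem theorem3p7 (R : realType)
    (* the constants of Assumption (C), as functions of (Lg, rho, beta) *)
    (Lf' Lft : R -> R -> R -> R) :
  exists C : R -> R -> R -> R,
  forall Lg rho beta : R, 0 < Lg -> 0 < rho -> 0 < beta ->
  forall d : nat, (0 < d)%N ->
  forall (V : 'rV[R]_d -> R) (mu : probability (borel_rV R d) R),
    assumptionA beta V mu ->
    assumptionB beta V Lg rho ->
    assumptionC beta V (Lf' Lg rho beta) (Lft Lg rho beta) ->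
  forall M N : nat, (0 < M)%N -> (0 < N)%N ->
  forall (dO : measure_display) (Omega : measurableType dO)
    (P : probability Omega R) (W : R -> Omega -> borel_rV R d)
    (xi : 'I_M -> Omega -> borel_rV R d),
    brownian_motion P W ->
    iid_standard_gaussian P xi ->
    independent_sigma P (sigma_family [set: 'I_M] xi)
                        (sigma_family `[0, 1]%classic W) ->
  (wasserstein2
     (pushforward P
        (fun w => mc_euler beta V N (W^~ w) (xi^~ w) N : borel_rV R d))
     mu
   <= (C Lg rho beta * d%:R * N%:R^-1
       + C Lg rho beta * Num.sqrt (d%:R / M%:R))%:E)%E.
Proof.
(* Splitting the squared distance at the exact scheme doubles both errors: [4 = 2 * 2] with the
   factor of [mc_error], [8 = 2 * 4] with that of [exact_coupling]. The absolute values make the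
   square roots meaningful whatever the signs. *)
pose A (Lg rho beta : R) : R := `|4 * expR (1 + 2 * drift_lip beta Lg rho) * mc_C beta Lg rho|.
pose E (Lg rho beta : R) : R :=
  `|8 * exact_C beta Lg rho (Lf' Lg rho beta) (Lft Lg rho beta)|.
exists (fun Lg rho beta => Num.sqrt (A Lg rho beta) + Num.sqrt (E Lg rho beta)).
move=> Lg rho beta Lg0 rho0 beta0 d d0 V mu [Gibbs _] B C M N M0 N0 dO Omega P W xi BW Xi XW.
have [Y [mY lY hY]] := exact_coupling d0 Lg0 rho0 beta0 B C Gibbs BW N0.
have mZ := measurable_mc_euler Lg0 rho0 B M0 Xi BW N0 (leqnn N).
have hZ := mc_error d0 Lg0 rho0 beta0 B M0 Xi BW XW N0.
set a := A Lg rho beta; set e := E Lg rho beta.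
have MR : 0 <= d%:R / M%:R :> R by rewrite divr_ge0.
have NR : 0 <= d%:R / N%:R :> R by rewrite divr_ge0.
pose r := a * (d%:R / M%:R) + e * (d%:R / N%:R) ^+ 2.
have a0 : 0 <= a * (d%:R / M%:R) := mulr_ge0 (normr_ge0 _) MR.
have e0 : 0 <= e * (d%:R / N%:R) ^+ 2 := mulr_ge0 (normr_ge0 _) (sqr_ge0 _).
have r0 : 0 <= r := addr_ge0 a0 e0.
apply: (@le_trans _ _ (Num.sqrt r)%:E).
  apply: (wasserstein2_le mZ mY) => //.
  pose y w : borel_rV R d := euler beta (f_beta beta V) N (W^~ w) N.
  pose z w : borel_rV R d := mc_euler beta V N (W^~ w) (xi^~ w) N.
  have my : measurable_fun setT y.
    exact: (measurable_euler_W BW beta N0 (leqnn N) (measurable_drift (f_beta_lip Lg0 rho0 beta0 B))).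
  have mq (u v : Omega -> borel_rV R d) : measurable_fun setT u -> measurable_fun setT v ->
      measurable_fun setT (fun w => (enorm ((u w : 'rV[R]_d) - (v w : 'rV[R]_d)) ^+ 2)%:E).
    move=> mu' mv; apply/measurable_EFinP; apply: measurable_funX; apply: measurable_enorm.
    exact: measurable_subV.
  have q0 (u v : Omega -> borel_rV R d) w :
    (0 <= (enorm ((u w : 'rV[R]_d) - (v w : 'rV[R]_d)) ^+ 2)%:E)%E by rewrite lee_fin sqr_ge0.
  have hz : (\int[P]_w (enorm ((z w : 'rV[R]_d) - (y w : 'rV[R]_d)) ^+ 2)%:E <=
      (2 * expR (1 + 2 * drift_lip beta Lg rho) * mc_C beta Lg rho * (d%:R / M%:R))%:E)%E.
    rewrite EP_EFin ?lee_fin//.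
    exact: (bmeas_mc_diff Lg0 rho0 beta0 B M0 Xi BW N0 (leqnn N)).
  apply: (@le_trans _ _ (2%:E * \int[P]_w (enorm ((z w : 'rV[R]_d) - (y w : 'rV[R]_d)) ^+ 2)%:E +
      2%:E * \int[P]_w (enorm ((Y w : 'rV[R]_d) - (y w : 'rV[R]_d)) ^+ 2)%:E)%E).
    rewrite -(ge0_integralZl_EFin _ measurableT (fun w _ => q0 z y w) (mq _ _ mZ my) (ler0n R 2)).
    rewrite -(ge0_integralZl_EFin _ measurableT (fun w _ => q0 Y y w) (mq _ _ mY my) (ler0n R 2)).
    rewrite -ge0_integralD//.
    - apply: ge0_le_integral => //.
      + by move=> w _; exact: (q0 z Y w).
      + exact: mq.
      + by apply: emeasurable_funD; apply: measurable_funeM; exact: mq.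
      + move=> w _; rewrite -!EFinM -EFinD lee_fin.
        have -> : (z w : 'rV[R]_d) - Y w = (z w - y w) - ((Y w : 'rV[R]_d) - y w).
          by rewrite opprB addrA subrK.
        exact: enorm_subr_sq.
    - by move=> w _; exact: mule_ge0.
    - by apply: measurable_funeM; exact: mq.
    - by move=> w _; exact: mule_ge0.
    - by apply: measurable_funeM; exact: mq.
  have two0 : (0 <= 2%:E :> \bar R)%E by rewrite lee_fin.
  apply: le_trans (leeD (lee_wpmul2l two0 hz) (lee_wpmul2l two0 hY)) _.
  rewrite -!EFinM -EFinD lee_fin /r; apply: lerD.
    rewrite [leLHS]mulrA; apply: ler_wpM2r => //.
    by apply: le_trans (ler_norm _); rewrite le_eqVlt; apply/orP; left; apply/eqP; ring.
  rewrite 2![leLHS]mulrA; apply: ler_wpM2r; first exact: sqr_ge0.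
  by apply: le_trans (ler_norm _); rewrite le_eqVlt; apply/orP; left; apply/eqP; ring.
rewrite lee_fin; apply: le_trans (sqrtr_add_le a0 e0) _.
have -> : Num.sqrt (a * (d%:R / M%:R)) = Num.sqrt a * Num.sqrt (d%:R / M%:R).
  by apply: sqrtrM; exact: normr_ge0.
have -> : Num.sqrt (e * (d%:R / N%:R) ^+ 2) = Num.sqrt e * (d%:R / N%:R).
  by rewrite sqrtrM ?sqrtr_sqr ?(ger0_norm NR)//; exact: normr_ge0.
rewrite addrC.
apply: lerD.
  by rewrite -mulrA; apply: ler_wpM2r => //; rewrite lerDr sqrtr_ge0.
by apply: ler_wpM2r; rewrite ?sqrtr_ge0// lerDl sqrtr_ge0.
Qed.
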